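(* (1) Let $G=\mathbb{Z}/2\mathbb{Z}\star\mathbb{Z}/4\mathbb{Z}$, with $a,b$ generators of $\mathbb{Z}/2\mathbb{Z}$ and $\mathbb{Z}/4\mathbb{Z}$ respectively, and let $S=\{a,b,b^{-1}\}$. Then $S$ is extremal, but $h(\mu)/(\gamma(S,\mu)v(S))<1$ for all $\mu\in\mathcal{S}$. (2) Let $G=\mathbb{Z}/3\mathbb{Z}\star\mathbb{Z}/4\mathbb{Z}$, with $a,b$ generators of $\mathbb{Z}/3\mathbb{Z}$ and $\mathbb{Z}/4\mathbb{Z}$ respectively, and let $S=\{a,a^{-1},b,b^{-1}\}$. Then $S$ is extremal. Moreover, the only $\mu\in\mathcal{S}$ for which $h(\mu)=\gamma(S,\mu)v(S)$ is $$\mu=p(\delta_a+\delta_{a^{-1}})+\bigl(\tfrac12-p\bigr)(\delta_b+\delta_{b^{-1}}),$$ where $p=0.432692\cdots$ is the middle root of the polynomial $5x^3-13x^2+7x-1$. (3) Let $G=\mathbb{Z}/4\mathbb{Z}\star\mathbb{Z}/4\mathbb{Z}$, with $a,b$ generators of the two cyclic factors, and let $S=\{a,a^{-1},b,b^{-1}\}$. Then $S$ is not extremal; indeed $$Q(S)=\frac{5+\sqrt5}{4}\cdot\frac{\log\bigl(\frac12+\frac{\sqrt5}{2}\bigr)}{\log(1+\sqrt2)}=0.987686\cdots.$$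
   Context: Let $G$ be a finitely generated group and $S=S^{-1}$ a finite generating set. $|g|_S$ denotes the word length of $g\in G$ with respect to $S$. The volume is $v(S)=\lim_n\frac1n\log\#\{g\in G:|g|_S\le n\}$. For a probability measure $\mu$ on $S$, the random walk $(G,\mu)$ is $X_0=1$, $X_{n+1}=X_nx_n$ with $(x_n)$ i.i.d. of law $\mu$. Its drift with respect to $S$ is $\gamma(S,\mu)=\lim_n|X_n|_S/n$ (a.s.), and its entropy is $h(\mu)=\lim_n-\frac1n\sum_{g\in G}\mu^{*n}(g)\log\mu^{*n}(g)$, where $\mu^{*n}$ is the $n$-th convolution power. One always has $h(\mu)\le\gamma(S,\mu)v(S)$. $\mathcal{S}$ denotes the set of symmetric probability measures $\mu$ on $S$ (i.e. $\mu(s)=\mu(s^{-1})$ for all $s\in S$) whose support generates $G$. Put $Q(S)=\sup_{\mu\in\mathcal{S}}\frac{h(\mu)}{\gamma(S,\mu)v(S)}$. The generating set $S$ is called extremal if $Q(S)=1$. *)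

(* Defs.v *)
From HB Require Import structures.
From mathcomp Require Import all_boot all_order all_algebra.
From mathcomp Require Import all_fingroup all_solvable.
From mathcomp Require Import finmap.
From mathcomp Require Import all_classical all_reals all_analysis.

Set Implicit Arguments.
Unset Strict Implicit.
Unset Printing Implicit Defensive.

Import Order.TTheory GRing.Theory Num.Theory.
Import numFieldNormedType.Exports.

Local Open Scope classical_set_scope.
Local Open Scope ring_scope.

(* A group G together with i : A -> G and j : B -> G is the free product of A
   and B when it is their coproduct in the category of groups.  For A = 'Z_m the
   group law of A is the addition modulo m.                                  *)
Definition is_free_product (A B G : groupType) (i : A -> G) (j : B -> G) :
    Prop :=
  [/\ monoid.monoid_morphism i, monoid.monoid_morphism j &
      forall (H : groupType) (f : A -> H) (g : B -> H),
        monoid.monoid_morphism f -> monoid.monoid_morphism g ->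
        exists! h : G -> H,
          [/\ monoid.monoid_morphism h, h \o i =1 f & h \o j =1 g]].

Definition generates (G : groupType) (A : set G) : Prop :=
  forall K : set G, K 1%g ->
    (forall x y, K x -> K y -> K (x * y^-1)%g) ->
    A `<=` K -> K = setT.

Definition is_word (G : groupType) (S : set G) (n : nat) (g : G) : Prop :=
  exists w : seq G,
    [/\ size w = n, (forall s, s \in w -> S s) & (\prod_(s <- w) s)%g = g].

(* The value 0 for an element that is not a product of elements of S is never
   met below, where S is symmetric and generates G.                          *)
Definition wordlen (G : groupType) (S : set G) (g : G) : nat :=
  xget 0%N
    [set n | is_word S n g /\ forall m, is_word S m g -> (n <= m)%N].

Definition volume (R : realType) (G : groupType) (S : set G) : R :=
  limn (fun n : nat =>
    ln (#|` fset_set [set g : G | (wordlen S g <= n)%N] |%:R) / n%:R).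

(* Probability measures with finite support on the discrete set G are given by
   their mass functions G -> R; sums over G are finite-support sums.         *)
Definition mass1 (R : realType) (G : groupType) (a : G) : G -> R :=
  fun g => (g == a)%:R.

Definition conv (R : realType) (G : groupType) (mu nu : G -> R) : G -> R :=
  fun g => \sum_(h \in [set: G]) mu h * nu (h^-1 * g)%g.

Definition convpow (R : realType) (G : groupType) (mu : G -> R) (n : nat) :
    G -> R :=
  iter n (conv mu) (mass1 R 1%g).

Definition entropy (R : realType) (G : groupType) (mu : G -> R) : R :=
  limn (fun n : nat =>
    - (\sum_(g \in [set: G]) convpow mu n g * ln (convpow mu n g)) / n%:R).

(* G carries its discrete sigma-algebra, so that every preimage of a subset of G
   has to be an event; independence is the product rule for every finite
   subfamily.                                                                *)
Definition iid_of_law (R : realType) (G : groupType) (mu : G -> R)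
    (d : measure_display) (Omega : measurableType d) (P : probability Omega R)
    (x : nat -> Omega -> G) : Prop :=
  [/\ forall n (A : set G), measurable (x n @^-1` A),
      forall n g, P (x n @^-1` [set g]) = (mu g)%:E &
      forall (J : {fset nat}) (A : nat -> set G),
        P (\bigcap_(k in [set` J]) (x k @^-1` A k)) =
        (\prod_(k <- J) P (x k @^-1` A k))%E].

Fixpoint walk (G : groupType) (Omega : Type) (x : nat -> Omega -> G) (n : nat)
    (w : Omega) : G :=
  if n is m.+1 then (walk x m w * x m w)%g else 1%g.

(* The almost sure limit does not depend on the probability space that carries
   the increments.                                                           *)
Definition is_drift (R : realType) (G : groupType) (S : set G) (mu : G -> R)
    (c : R) : Prop :=
  forall (d : measure_display) (Omega : measurableType d)
    (P : probability Omega R) (x : nat -> Omega -> G),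
    iid_of_law mu P x ->
    {ae P, forall w, (wordlen S (walk x n w))%:R / n%:R @[n --> \oo] --> c}.

Definition drift (R : realType) (G : groupType) (S : set G) (mu : G -> R) : R :=
  xget 0 [set c | is_drift S mu c].

Definition symmetric_laws (R : realType) (G : groupType) (S : set G) :
    set (G -> R) :=
  [set mu | [/\ forall g, 0 <= mu g,
                forall g, ~ S g -> mu g = 0,
                \sum_(s \in S) mu s = 1,
                forall s, S s -> mu s = mu s^-1%g &
                generates [set g | mu g != 0]]].
Arguments symmetric_laws R {G} S _.

Definition Qratio (R : realType) (G : groupType) (S : set G) : R :=
  sup [set entropy mu / (drift S mu * volume R S)
      | mu in symmetric_laws R S].

Definition extremal (R : realType) (G : groupType) (S : set G) : Prop :=
  Qratio R S = 1.

(* Main.v *)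
Require Import Defs.
From HB Require Import structures.
From mathcomp Require Import all_boot all_order all_algebra.
From mathcomp Require Import all_fingroup all_solvable.
From mathcomp Require Import finmap.
From mathcomp Require Import all_classical all_reals all_analysis.
From mathcomp Require Import ring lra.
From Stdlib Require NArith.

Set Implicit Arguments.
Unset Strict Implicit.
Unset Printing Implicit Defensive.

Import Order.TTheory GRing.Theory Num.Theory.
Import numFieldNormedType.Exports.

Local Open Scope classical_set_scope.
Local Open Scope ring_scope.

(* Elements of a free product of two finite groups are reduced words.  For a
   walk with steps in the two factors, the probability F(g) of ever visiting g
   is multiplicative along the reduced word of g.  Entropy is the rate of growth
   of the additive functional -log F: the convolution powers are at most F, and
   the sum of F over the words of length at most n grows linearly, so that
   Gibbs' inequality gives the converse bound.  Word length is another additive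
   functional.  Corrected by a function of the last letter, an additive
   functional has increments of constant mean, hence an explicit rate, and the
   convergence is almost sure by Chernoff's bound.

   On the factor Z/4 the values of F are t/(2-t^2) and t^2/(2-t^2) for one
   parameter t.  Put eta(t) = (2+t) log(2+t) - t log t.  The ratio of entropy to
   drift becomes eta(t)/(4+3t) if the other factor is Z/2, and
   (eta(t) + (2+t) log 2)/(4+3t) if it is Z/3.  Let -log r be the volume.  Then
   log x <= x-1 gives eta(t) <= (2+t) log(2+r) - t log r, with equality only at
   t = r.  For Z/3 * Z/4 one law has t = r; for Z/2 * Z/4 it would have to give
   mass 0 to b, so t = r is only approached.  For Z/4 * Z/4 the parameters s, t
   of the two factors satisfy (2s+s^2)(1+t) = (2-t^2)(1+s); a Lagrange
   multiplier for this constraint separates the variables, and each summand is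
   maximal at the inverse of the golden ratio. *)

(** * Normal forms in a free product *)

(** Only the universal property of [G] is given, so reduced words are first made into a group of
    their own, which then supplies the normal forms of [G]. The parameter [t] has a meaning: at a
    point of a coset of the factor, it is the probability that the walk moves again inside the coset
    instead of escaping from that point. On a cyclic factor [F] is then a hitting probability of the
    simple random walk on a cycle that survives each step with probability [t], and the weights
    become rational functions of the parameters. The letters of the limit word alternate between the
    factors, so both factors produce letters at the same rate; hence the ratio of entropy to drift
    is a function of the parameters alone. The sums of [F] over the nontrivial letters of the two
    factors have product 1 because the walk spends a bounded and non-vanishing expected time among
    the words with [n] letters. The drift is a statement about every probability space that carries
    the increments, so it determines a number only once such a space exists. The unit interval
    serves: the digits of an expanding map are independent there. *)

Section Words.
Variables (P : finGroupType) (H : bool -> {group P}).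
Implicit Types (c : bool) (x y : P) (w : seq P).

(* The head of a word is its last letter: the steps of the walk act on it. *)
Fixpoint alt_word c w : bool :=
  if w is x :: w' then [&& x \in H c, x != 1%g & alt_word (~~ c) w']
  else true.

Definition reduced w := alt_word true w || alt_word false w.

Definition push x w := if x == 1%g then w else x :: w.

(** The colour of a nontrivial letter [x] is the boolean [x \in H true]; the inner test asks whether
    [y] lies in the factor of [x]. *)
Definition append w x : seq P :=
  if w is y :: w' then
    if y \in H (x \in H true) then push (y * x)%g w' else push x w
  else push x w.

Definition wmul (u v : seq P) := foldr (fun x w => append w x) u v.

Definition winv w := rev (map (fun x : P => x^-1%g) w).

Hypothesis tiH : forall x, x \in H true -> x \in H false -> x = 1%g.

Lemma factor_inj c c' x : x \in H c -> x \in H c' -> x != 1%g -> c = c'.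
Proof.
by case: c; case: c' => // h h' /eqP[]; apply: tiH.
Qed.

Lemma reduced_alt_word c w : alt_word c w -> reduced w.
Proof. by rewrite /reduced; case: c => ->; rewrite ?orbT. Qed.

Lemma reducedP w : reduced w -> exists c, alt_word c w.
Proof. by case/orP=> h; [exists true|exists false]. Qed.

Lemma alt_word_push c y w :
  y \in H c -> alt_word (~~ c) w -> reduced (push y w).
Proof.
move=> yc aw; rewrite /push; case: eqVneq => [_|y1]; last first.
  by apply: (@reduced_alt_word c); rewrite /= yc y1.
exact: reduced_alt_word aw.
Qed.

(** Allowing [y = 1] gives every reduced word the same shape relative to the colour [c]. The steps
    in [H c] then act on [y] alone, whatever the last letter was. *)
Lemma push_split c w : reduced w ->
  exists y w', [/\ y \in H c, alt_word (~~ c) w' & w = push y w'].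
Proof.
case/reducedP=> c'; case: (eqVneq c' c) => [->|cc'].
  case: w => [|y w'] /=; first by exists 1%g, [::]; rewrite group1 /push eqxx.
  by case/and3P=> yc y1 aw; exists y, w'; rewrite /push (negbTE y1).
have -> : c' = ~~ c by case: c' c cc' => [] [].
by move=> aw; exists 1%g, w; rewrite group1 /push eqxx.
Qed.

Lemma append1 w : reduced w -> append w 1%g = w.
Proof.
case/reducedP=> c; case: w => [|z u] /=; first by rewrite /push eqxx.
by case/and3P=> _ z1 _; rewrite mulg1 /push (negbTE z1) eqxx; case: ifP.
Qed.

Lemma append_push c y w x : y \in H c -> alt_word (~~ c) w -> x \in H c ->
  append (push y w) x = push (y * x)%g w.
Proof.
move=> yc aw xc; have [->|x1] := eqVneq x 1%g.
  by rewrite mulg1 append1 // (alt_word_push yc aw).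
have cx : (x \in H true) = c.
  case: c xc {yc aw} => // xc; apply/negP => xt.
  by move: x1; rewrite (tiH xt xc) eqxx.
rewrite {1}/push; case: eqVneq => [y1|y1].
  rewrite y1 mul1g /append cx.
  case: w aw => //= z u /and3P[zc z1 _]; case: ifP => // zc'.
  by move: (factor_inj zc zc' z1); case: (c).
by rewrite /append cx yc.
Qed.

Lemma append_reduced c w x : reduced w -> x \in H c -> reduced (append w x).
Proof.
move=> /(push_split c)[y [w' [yc aw ->]]] xc.
by rewrite (append_push yc aw xc) (@alt_word_push c) // groupM.
Qed.

(** Each factor acts on reduced words from the right. As in van der Waerden's construction,
    associativity of the product comes from these actions and not from an analysis of
    cancellations. *)
Lemma appendM c w x y : reduced w -> x \in H c -> y \in H c ->
  append (append w x) y = append w (x * y)%g.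
Proof.
move=> /(push_split c)[z [w' [zc aw ->]]] xc yc.
by rewrite !(append_push (c:=c)) ?groupM // mulgA.
Qed.

Lemma append_cons c x w : alt_word c (x :: w) -> append w x = x :: w.
Proof.
rewrite /= => /and3P[xc x1 aw].
have := append_push (group1 (H c)) aw xc.
by rewrite {1}/push eqxx mul1g /push (negbTE x1).
Qed.

Lemma reduced_cons x w : reduced (x :: w) ->
  [/\ reduced w, append w x = x :: w & exists c, x \in H c].
Proof.
case/reducedP=> c a; have := a => /= /and3P[xc x1 aw].
by split; [exact: reduced_alt_word aw|exact: append_cons a|exists c].
Qed.

Lemma wmul_reduced u v : reduced u -> reduced v -> reduced (wmul u v).
Proof.
move=> ru; elim: v => //= x v IH /reduced_cons[rv _ [c xc]].
exact: append_reduced (IH rv) xc.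
Qed.

Lemma wmul_append c u v x : reduced u -> reduced v -> x \in H c ->
  wmul u (append v x) = append (wmul u v) x.
Proof.
move=> ru /(push_split c)[y [w [yc aw ->]]] xc.
have rw := reduced_alt_word aw.
have pushE z : z \in H c -> wmul u (push z w) = append (wmul u w) z.
  move=> zc; rewrite /push; case: eqVneq => [->|//].
  by rewrite append1 // wmul_reduced.
rewrite (append_push yc aw xc) !pushE ?groupM //.
by rewrite (appendM (wmul_reduced ru rw) yc xc).
Qed.

Lemma wmulA u v w : reduced u -> reduced v -> reduced w ->
  wmul u (wmul v w) = wmul (wmul u v) w.
Proof.
move=> ru rv; elim: w => //= x w IH /reduced_cons[rw _ [c xc]].
by rewrite (wmul_append ru (wmul_reduced rv rw) xc) IH.
Qed.

Lemma wmul0 w : reduced w -> wmul [::] w = w.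
Proof. by elim: w => //= x w IH /reduced_cons[rw h _]; rewrite IH. Qed.

Lemma alt_word_rcons c w x :
  alt_word c (rcons w x) =
  [&& alt_word c w, x \in H (c (+) odd (size w)) & x != 1%g].
Proof.
elim: w c => [|y w IH] c /=; first by rewrite addbF andbT.
by rewrite IH -!andbA; case: c; case: (odd _).
Qed.

Lemma alt_word_winv c w : alt_word c w ->
  alt_word (c (+) ~~ odd (size w)) (winv w).
Proof.
elim: w c => [|x w IH] c //= /and3P[xc x1 aw].
rewrite /winv /= rev_cons alt_word_rcons.
rewrite size_rev size_map groupV invg_eq1 x1 andbT.
move: (IH _ aw); rewrite /winv.
by case: (c) xc; case: (odd _) => /= -> ->.
Qed.

Lemma winv_reduced w : reduced w -> reduced (winv w).
Proof.
by case/reducedP=> c /alt_word_winv; exact: reduced_alt_word.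
Qed.

Lemma wmul_winv w : reduced w -> wmul w (winv w) = [::].
Proof.
elim: w => // x w IH rw; have [rw' h [c xc]] := reduced_cons rw.
(* A product without cancellation is a concatenation, in reverse order because heads are last
   letters. *)
have -> : winv (x :: w) = wmul [:: x^-1%g] (winv w).
  rewrite /winv /= rev_cons -cats1; set u := rev _.
  have : reduced (u ++ [:: x^-1%g]).
    by have := winv_reduced rw; rewrite /winv /= rev_cons -cats1.
  elim: u => //= z u IHu /reduced_cons[ru <- _].
  by rewrite -IHu.
have rx : reduced [:: x^-1%g].
  have := rw; case/reducedP => d /= /and3P[xd x1 _].
  by apply: (@reduced_alt_word d); rewrite /= groupV xd invg_eq1 x1.
rewrite wmulA ?winv_reduced //.
suff -> : wmul (x :: w) [:: x^-1%g] = w by rewrite IH.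
by rewrite -[LHS]/(append (x :: w) x^-1%g) -h (appendM (c:=c)) ?groupV // mulgV append1.
Qed.

Lemma winvK w : winv (winv w) = w.
Proof.
by rewrite /winv map_rev revK -map_comp map_id_in // => x _ /=; rewrite invgK.
Qed.

Record fword := FWord { fval :> seq P; fvalP : reduced fval }.
HB.instance Definition _ := [isSub for fval].
HB.instance Definition _ := [Choice of fword by <:].

(* The argument lets the group structure be inferred from the type. *)
Definition fgroup (_ : forall x, x \in H true -> x \in H false -> x = 1%g) :=
  fword.
HB.instance Definition _ := Choice.copy (fgroup tiH) fword.

Definition fone := @FWord [::] isT.
Definition fmul (u v : fword) := FWord (wmul_reduced (fvalP u) (fvalP v)).
Definition finv (u : fword) := FWord (winv_reduced (fvalP u)).

Lemma fmulA : associative fmul.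
Proof. by move=> u v w; apply: val_inj; rewrite /= wmulA ?fvalP. Qed.
Lemma fmul1g : left_id fone fmul.
Proof. by move=> u; apply: val_inj; rewrite /= wmul0 ?fvalP. Qed.
Lemma fmulg1 : right_id fone fmul.
Proof. by move=> u; apply: val_inj. Qed.
Lemma fmulgV : right_inverse fone finv fmul.
Proof. by move=> u; apply: val_inj; rewrite /= wmul_winv ?fvalP. Qed.
Lemma fmulVg : left_inverse fone finv fmul.
Proof.
move=> u; apply: val_inj => /=.
by rewrite -{2}[fval u]winvK wmul_winv ?winv_reduced ?fvalP.
Qed.

HB.instance Definition _ :=
  isGroup.Build (fgroup tiH) fmulA fmul1g fmulg1 fmulVg fmulgV.

Lemma flet_reduced c x : x \in H c -> reduced (append [::] x).
Proof. exact: append_reduced. Qed.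

End Words.

(** * Normal forms from the universal property *)

Section FreeProduct.
Variables (A B : finGroupType).
Let P : finGroupType := (A * B)%type.

(** The direct product is used as an alphabet: it holds both factors as subgroups of one finite
    group with trivial intersection. The letters of reduced words have one trivial coordinate. *)
Definition free_factor (c : bool) : {group P} :=
  if c then setX_group [set: A]%G 1%G else setX_group 1%G [set: B]%G.

Lemma factorT (x : P) : (x \in free_factor true) = (x.2 == 1%g).
Proof. by case: x => a b; rewrite /free_factor !inE. Qed.

Lemma factorF (x : P) : (x \in free_factor false) = (x.1 == 1%g).
Proof. by case: x => a b; rewrite /free_factor !inE /= andbT. Qed.

Lemma factor_ti (x : P) : x \in free_factor true -> x \in free_factor false -> x = 1%g.
Proof.
by rewrite factorT factorF; case: x => a b /= /eqP -> /eqP ->.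
Qed.

Variables (G : groupType) (i : A -> G) (j : B -> G).
Hypothesis free : is_free_product i j.

Definition letter_val (x : P) : G := (i x.1 * j x.2)%g.

Lemma letter_val1 : letter_val 1%g = 1%g.
Proof. by case: free => [[i1 _] [j1 _] _]; rewrite /letter_val i1 j1 mulg1. Qed.

Lemma letter_valM c (x y : P) : x \in free_factor c -> y \in free_factor c ->
  letter_val (x * y)%g = (letter_val x * letter_val y)%g.
Proof.
case: free => [[i1 iM] [j1 jM] _]; rewrite /letter_val.
case: c; rewrite ?factorT ?factorF; case: x => a b; case: y => a' b' /=.
  by move=> /eqP -> /eqP ->; rewrite mulg1 j1 !mulg1 iM.
by move=> /eqP -> /eqP ->; rewrite mulg1 i1 !mul1g jM.
Qed.

Local Notation W := (fgroup factor_ti).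

Definition evalw (w : seq P) : G := foldr (fun x g => g * letter_val x)%g 1%g w.

Lemma evalw_push x w : evalw (push x w) = (evalw w * letter_val x)%g.
Proof. by rewrite /push; case: eqVneq => [->|//]; rewrite letter_val1 mulg1. Qed.

Lemma evalw_append c w x : reduced free_factor w -> x \in free_factor c ->
  evalw (append free_factor w x) = (evalw w * letter_val x)%g.
Proof.
move=> /(push_split c)[y [w' [yc aw ->]]] xc.
rewrite (append_push factor_ti yc aw xc) !evalw_push.
by rewrite (letter_valM yc xc) mulgA.
Qed.

Lemma evalw_mul u v : reduced free_factor u -> reduced free_factor v ->
  evalw (wmul free_factor u v) = (evalw u * evalw v)%g.
Proof.
move=> ru; elim: v => /= [|x v IH]; first by rewrite mulg1.
move=> /(reduced_cons factor_ti)[rv _ [c xc]].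
rewrite (evalw_append (wmul_reduced factor_ti ru rv) xc) IH //.
by rewrite -mulgA.
Qed.

Let evalW (w : W) : G := evalw (fval w).

Lemma evalW_morphism : monoid.monoid_morphism evalW.
Proof.
by split=> // u v; rewrite /evalW /= evalw_mul ?fvalP.
Qed.

Definition fletter c (x : P) (xc : x \in free_factor c) : W :=
  FWord (flet_reduced factor_ti xc).

Lemma inl_factor (a : A) : ((a, 1%g) : P) \in free_factor true.
Proof. by rewrite factorT. Qed.
Lemma inr_factor (b : B) : ((1%g, b) : P) \in free_factor false.
Proof. by rewrite factorF. Qed.

Let fl (a : A) : W := fletter (inl_factor a).
Let fr (b : B) : W := fletter (inr_factor b).

Lemma fletterM c (x y : P) (xc : x \in free_factor c) (yc : y \in free_factor c)
   (xyc : (x * y)%g \in free_factor c) :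
  (fletter xc * fletter yc)%g = fletter xyc.
Proof.
apply: val_inj => /=.
have r0 : reduced free_factor [::] by [].
rewrite (wmul_append factor_ti (append_reduced factor_ti r0 xc) r0 yc) /=.
exact: (appendM factor_ti r0 xc yc).
Qed.

Lemma fl_morphism : monoid.monoid_morphism fl.
Proof.
split; first by apply: val_inj; rewrite /= /push eqxx.
move=> a a'; rewrite /fl.
have xyc : (((a, 1%g) : P) * (a', 1%g))%g \in free_factor true by rewrite groupM ?inl_factor.
rewrite (fletterM _ _ xyc); apply: val_inj => /=.
by congr push; congr (_, _); rewrite /= mulg1.
Qed.

Lemma fr_morphism : monoid.monoid_morphism fr.
Proof.
split; first by apply: val_inj; rewrite /= /push eqxx.
move=> b b'; rewrite /fr.
have xyc : (((1%g, b) : P) * (1%g, b'))%g \in free_factor false by rewrite groupM ?inr_factor.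
rewrite (fletterM _ _ xyc); apply: val_inj => /=.
by congr push; congr (_, _); rewrite /= mulg1.
Qed.

(** The universal property maps [G] to the group of reduced words, and [evalW] maps back. The
    composite and the identity are both endomorphisms of [G] compatible with [i] and [j], so they
    coincide by uniqueness. *)
Lemma normal_form_exists : exists nf : G -> seq P,
  [/\ nf 1%g = [::], forall g, reduced free_factor (nf g),
      forall g, evalw (nf g) = g,
      forall w, reduced free_factor w -> nf (evalw w) = w &
      forall c g x, x \in free_factor c ->
        nf (g * letter_val x)%g = append free_factor (nf g) x].
Proof.
case: (free) => im jm UP.
have [h [[[h1 hM] hi hj] _]] := UP _ _ _ fl_morphism fr_morphism.
exists (fun g => fval (h g)).
have hlet c (x : P) (xc : x \in free_factor c) : h (letter_val x) = fletter xc.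
  rewrite /letter_val hM; case: c xc; case: x => a b /= xc.
    have b1 : b = 1%g by move: (xc); rewrite factorT => /eqP.
    subst b; rewrite jm.1 h1 mulg1 (hi a : h (i a) = fl a).
    exact: val_inj.
  have a1 : a = 1%g by move: (xc); rewrite factorF => /eqP.
  subst a; rewrite im.1 h1 mul1g (hj b : h (j b) = fr b).
  exact: val_inj.
have hx c g x : x \in free_factor c ->
    fval (h (g * letter_val x)%g) = append free_factor (fval (h g)) x.
  move=> xc; rewrite hM (hlet c x xc) /=.
  by rewrite (wmul_append (v:=[::]) factor_ti (fvalP _) _ xc).
split=> //.
- by rewrite h1.
- by move=> g; exact: fvalP.
- have [eW1 eWM] := evalW_morphism.
  have [k [_ kU]] := UP _ _ _ im jm.
  have id1 : k = id.
    by apply: kU; split=> //; split.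
  have id2 : k = evalW \o h.
    apply: kU; split.
    + by split=> [|x y] /=; [rewrite h1 eW1|rewrite hM eWM].
    + move=> a; have /= := hi a; rewrite /comp => ->.
      by rewrite /evalW /= evalw_push /= mul1g /letter_val /= jm.1 mulg1.
    + move=> b; have /= := hj b; rewrite /comp => ->.
      by rewrite /evalW /= evalw_push /= mul1g /letter_val /= im.1 mul1g.
  by move=> g; rewrite -[LHS]/((evalW \o h) g) -id2 id1.
- elim=> [|x w IH] /=; first by rewrite h1.
  move=> /(reduced_cons factor_ti)[rw hh [c xc]].
  by rewrite (hx _ _ _ xc) IH.
Qed.

End FreeProduct.

(** * Walks on normal forms *)

Section Walk.
Variables (R : realType) (P : finGroupType) (H : bool -> {group P}).
Hypothesis tiH : forall x, x \in H true -> x \in H false -> x = 1%g.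
Variables (G : groupType) (iota : P -> G) (nf : G -> seq P).
Implicit Types (c : bool) (x y : P) (w : seq P) (f : G -> R) (g h : G).

Record normal_form_map : Prop := NormalFormMap {
  nf1 : nf 1%g = [::];
  nf_reduced : forall g, reduced H (nf g);
  nf_inj : injective nf;
  nf_surj : forall w, reduced H w -> exists g, nf g = w;
  nf_mul : forall c g x, x \in H c -> nf (g * iota x)%g = append H (nf g) x }.

Hypothesis nfP : normal_form_map.

Lemma nf_split c g : exists y w,
  [/\ y \in H c, alt_word H (~~ c) w & nf g = push y w].
Proof. exact: push_split (nf_reduced nfP g). Qed.

Lemma nf_push c g y w x : y \in H c -> alt_word H (~~ c) w -> x \in H c ->
  nf g = push y w -> nf (g * iota x)%g = push (y * x)%g w.
Proof.
by move=> yc aw xc gE; rewrite (nf_mul nfP g xc) gE (append_push tiH yc aw xc).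
Qed.

Definition wsum (phi : P -> R) w := \sum_(x <- w) phi x.
Definition wprod (F : P -> R) w := \prod_(x <- w) F x.
(** Each [k x] is discounted by the values of [F] at all later letters, that is, by the probability
    that the walk ever comes back to the letter [x]. Harmonicity of [F] then removes the earlier
    letters from the mean increment. *)
Definition wcorr (F k : P -> R) w := foldr (fun x r => F x * r + k x) 0 w.

Lemma wsum_push phi y w : phi 1%g = 0 -> wsum phi (push y w) = wsum phi w + phi y.
Proof.
move=> p1; rewrite /push; case: eqVneq => [->|_]; first by rewrite p1 addr0.
by rewrite /wsum big_cons addrC.
Qed.

Lemma wprod_push F y w : F 1%g = 1 -> wprod F (push y w) = F y * wprod F w.
Proof.
move=> F1; rewrite /push; case: eqVneq => [->|_]; first by rewrite F1 mul1r.
by rewrite /wprod big_cons.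
Qed.

Lemma wcorr_push F k y w : F 1%g = 1 -> k 1%g = 0 ->
  wcorr F k (push y w) = F y * wcorr F k w + k y.
Proof.
by move=> F1 k1; rewrite /push; case: eqVneq => [->|//]; rewrite F1 k1 mul1r addr0.
Qed.

Variable m : P -> R.

(* For the color c of the last letter, the two sums are the steps that change
   this letter and the steps that add a letter. *)
Definition avg f g := \sum_(c : bool) \sum_(x in H c) m x * f (g * iota x)%g.

Lemma avgE c f g : avg f g = \sum_(x in H c) m x * f (g * iota x)%g +
  \sum_(x in H (~~ c)) m x * f (g * iota x)%g.
Proof.
rewrite /avg big_bool /=; case: c => //=; by rewrite addrC.
Qed.

Record step_weights : Prop := StepWeights {
  step_ge0 : forall x, 0 <= m x;
  step_one : m 1%g = 0;
  step_sym : forall x, m x^-1%g = m x;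
  step_sum : \sum_(c : bool) \sum_(x in H c) m x = 1 }.

Hypothesis mP : step_weights.

Lemma avg_le f1 f2 g : (forall h, f1 h <= f2 h) -> avg f1 g <= avg f2 g.
Proof.
move=> le12; apply: ler_sum => c _; apply: ler_sum => x _.
by rewrite ler_wpM2l // (step_ge0 mP).
Qed.

Lemma avg_ext f1 f2 g : f1 =1 f2 -> avg f1 g = avg f2 g.
Proof. by move=> e; congr avg; exact/funext. Qed.

Lemma avg_cst a g : avg (fun=> a) g = a.
Proof.
rewrite /avg -[RHS]mul1r -(step_sum mP) mulr_suml; apply: eq_bigr => c _.
by rewrite mulr_suml.
Qed.

Lemma avgD f1 f2 g : avg (fun h => f1 h + f2 h) g = avg f1 g + avg f2 g.
Proof.
rewrite /avg -big_split /=; apply: eq_bigr => c _.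
by rewrite -big_split /=; apply: eq_bigr => x _; rewrite mulrDr.
Qed.

Lemma avgZ a f g : avg (fun h => a * f h) g = a * avg f g.
Proof.
rewrite /avg mulr_sumr; apply: eq_bigr => c _.
by rewrite mulr_sumr; apply: eq_bigr => x _; rewrite mulrCA.
Qed.

Notation avgn n := (iter n avg).

Lemma avgn_ext n f1 f2 g : f1 =1 f2 -> avgn n f1 g = avgn n f2 g.
Proof. by move/funext=> ->. Qed.

Lemma avgn_le n f1 f2 g : (forall h, f1 h <= f2 h) -> avgn n f1 g <= avgn n f2 g.
Proof.
by move=> le12; elim: n g => [|n IH] g //=; exact: avg_le.
Qed.

Lemma avgn_cst n a g : avgn n (fun=> a) g = a.
Proof.
elim: n g => //= n IH g; rewrite -[RHS](avg_cst a g); exact: avg_ext.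
Qed.

Lemma avgnD n f1 f2 g : avgn n (fun h => f1 h + f2 h) g = avgn n f1 g + avgn n f2 g.
Proof.
by elim: n g => //= n IH g; rewrite -avgD; apply: avg_ext.
Qed.

Lemma avgnZ n a f g : avgn n (fun h => a * f h) g = a * avgn n f g.
Proof.
by elim: n g => //= n IH g; rewrite -avgZ; apply: avg_ext.
Qed.

Lemma avgn_sum n (I : Type) (s : seq I) (p : pred I) (F : I -> G -> R) g :
  avgn n (fun h => \sum_(u <- s | p u) F u h) g = \sum_(u <- s | p u) avgn n (F u) g.
Proof.
elim: s => [|u s IH].
  rewrite big_nil -[RHS](avgn_cst n 0 g); by apply: avgn_ext => h; rewrite big_nil.
rewrite big_cons -IH; case: ifP => pu; last first.
  by apply: avgn_ext => h; rewrite big_cons pu.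
rewrite -avgnD; by apply: avgn_ext => h; rewrite big_cons pu.
Qed.

Lemma avgn_translate n f h g :
  avgn n (fun z => f (h * z)%g) g = avgn n f (h * g)%g.
Proof.
elim: n g => //= n IH g; apply: eq_bigr => c _; apply: eq_bigr => x _.
by rewrite IH mulgA.
Qed.

(** An explicit finite list that contains the support of the law after [n] steps, so that
    finite-support sums over [G] become sums over a list. *)
Fixpoint reach g n : seq G :=
  if n is n'.+1 then
    flatten [seq reach (g * iota x)%g n'
            | x <- enum P & (x \in H true) || (x \in H false)]
  else [:: g].

Lemma reachS g n c x h : x \in H c -> h \in reach (g * iota x)%g n ->
  h \in reach g n.+1.
Proof.
move=> xc hr /=; apply/flattenP; exists (reach (g * iota x)%g n) => //.
apply: map_f; rewrite mem_filter mem_enum andbT.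
by case: c xc => ->; rewrite ?orbT.
Qed.

Lemma avgn_local n f1 f2 g : (forall h, h \in reach g n -> f1 h = f2 h) ->
  avgn n f1 g = avgn n f2 g.
Proof.
elim: n g => [|n IH] g e; first by apply: e; rewrite inE.
apply: eq_bigr => c _; apply: eq_bigr => x xc; congr (_ * _).
by apply: IH => h hr; apply: e; exact: (reachS xc hr).
Qed.

Lemma size_push x w : (size (push x w) <= (size w).+1)%N.
Proof. by rewrite /push; case: ifP. Qed.

Lemma size_append w x : (size (append H w x) <= (size w).+1)%N.
Proof.
case: w => [|y w] /=; first exact: size_push.
case: ifP => _; last exact: size_push.
by rewrite (leq_trans (size_push _ _)).
Qed.

Lemma size_reach g n h : h \in reach g n -> (size (nf h) <= size (nf g) + n)%N.
Proof.
elim: n g => [|n IH] g /=; first by rewrite inE addn0 => /eqP ->.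
case/flattenP=> s /mapP[x]; rewrite mem_filter => /andP[xc _] -> hr.
have {hr} := IH _ hr.
have sx : (size (nf (g * iota x)%g) <= (size (nf g)).+1)%N.
  by case/orP: xc => xc; rewrite (nf_mul nfP g xc) size_append.
move=> /leq_trans; apply.
by rewrite addnS -addSn leq_add2r.
Qed.

(** * Convolution powers *)

Variable mu : G -> R.
Hypothesis muE :
  forall g, mu g = \sum_(c : bool) \sum_(x in H c) m x * (g == iota x)%:R.

Lemma fsum_setTE (s : seq G) (u : G -> R) : uniq s ->
  (forall g, g \notin s -> u g = 0) -> \sum_(g \in [set: G]) u g = \sum_(g <- s) u g.
Proof.
move=> us u0; rewrite (fsbigE s) //; last by move=> g _; exact: u0.
by apply: eq_bigl => g; rewrite in_setT.
Qed.

Lemma fsum_step (u : G -> R) :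
  \sum_(g \in [set: G]) mu g * u g = \sum_(c : bool) \sum_(x in H c) m x * u (iota x).
Proof.
set s := undup [seq iota x | x <- enum P].
have is_ x : iota x \in s by rewrite mem_undup map_f // mem_enum.
rewrite (@fsum_setTE s) ?undup_uniq //; last first.
  move=> g gs; rewrite muE big1 ?mul0r // => c _; rewrite big1 // => x _.
  by case: eqVneq => [gx|]; rewrite ?mulr0 //; rewrite gx is_ in gs.
transitivity (\sum_(g <- s) \sum_(c : bool) \sum_(x in H c)
     m x * ((g == iota x)%:R * u g)).
  apply: eq_bigr => g _; rewrite muE mulr_suml; apply: eq_bigr => c _.
  by rewrite mulr_suml; apply: eq_bigr => x _; rewrite mulrA.
rewrite exchange_big /=; apply: eq_bigr => c _.
rewrite exchange_big /=; apply: eq_bigr => x _.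
rewrite -mulr_sumr; congr (_ * _).
rewrite (bigD1_seq (iota x)) ?undup_uniq //= eqxx mul1r big1 ?addr0 //.
by move=> g /negbTE ->; rewrite mul0r.
Qed.

(** [conv] inserts a new first step on the left, whereas [avg] moves by a step on the right. Left
    translation carries the average started at [iota x] to the one started at 1. *)
Lemma convpowE n g : convpow mu n g = avgn n (mass1 R g) 1%g.
Proof.
rewrite /convpow; elim: n g => [|n IH] g; first by rewrite /= /mass1 eq_sym.
rewrite iterS {1}/Defs.conv (eq_fsbigr (fun h => mu h *
   avgn n (mass1 R (h^-1 * g)%g) 1%g)); last by move=> h _; rewrite IH.
rewrite fsum_step; apply: eq_bigr => c _; apply: eq_bigr => x _; congr (_ * _).
rewrite mul1g -[RHS]/(avgn n (mass1 R g) (iota x)) -[in RHS](mulg1 (iota x)) -(avgn_translate n _ (iota x)).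
apply: avgn_ext => z; rewrite /mass1; congr (_%:R); congr nat_of_bool.
by apply/eqP/eqP => [->|<-]; rewrite ?mulKVg ?mulKg.
Qed.

Notation reached n := (undup (reach 1%g n)).

Lemma convpow_ge0 n g : 0 <= convpow mu n g.
Proof.
rewrite convpowE -[X in X <= _](avgn_cst n 0 1%g); apply: avgn_le => h.
by rewrite /mass1 ler0n.
Qed.

Lemma convpow_out n g : g \notin reached n -> convpow mu n g = 0.
Proof.
rewrite mem_undup convpowE -[RHS](avgn_cst n 0 1%g) => gr.
apply: avgn_local => h hr; rewrite /mass1; case: eqVneq => // hg.
by rewrite hg (negbTE gr) in hr.
Qed.

Lemma avgn_convpow n f : avgn n f 1%g = \sum_(g <- reached n) convpow mu n g * f g.
Proof.
transitivity (avgn n (fun h => \sum_(g <- reached n) f g * mass1 R g h) 1%g).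
  apply: avgn_local => h hr; rewrite (bigD1_seq h) ?undup_uniq ?mem_undup //=.
  rewrite /mass1 eqxx mulr1 big1 ?addr0 // => g gh.
  by rewrite eq_sym (negbTE gh) mulr0.
rewrite avgn_sum; apply: eq_bigr => g _.
by rewrite avgnZ convpowE mulrC.
Qed.

Lemma convpow_sum n : \sum_(g <- reached n) convpow mu n g = 1.
Proof.
rewrite -[RHS](avgn_cst n 1 1%g) avgn_convpow.
by apply: eq_bigr => g _; rewrite mulr1.
Qed.

(** * Hitting probabilities bound the convolution powers *)

Section Green.
Variable F : P -> R.

(* F x is the probability that the walk from 1 ever visits iota x. *)
Record green : Prop := Green {
  green1 : F 1%g = 1;
  green_gt0 : forall x, 0 < F x;
  green_lt1 : forall c x, x \in H c -> x != 1%g -> F x < 1;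
  green_le1 : \sum_(c : bool) \sum_(x in H c) m x * F x <= 1;
  green_harmonic : forall c y, y \in H c -> y != 1%g ->
    \sum_(x in H c) m x * F (y * x)%g +
      (\sum_(x in H (~~ c)) m x * F x) * F y = F y;
  green_sum : \prod_(c : bool) \sum_(x in H c | x != 1%g) F x = 1 }.

Hypothesis FP : green.

Lemma wprod_gt0 w : 0 < wprod F w.
Proof. by apply: prodr_gt0 => x _; exact: green_gt0 FP x. Qed.

(** Superharmonicity: away from the identity the harmonic equation of the last letter gives
    equality, and at the identity the claim is [green_le1]. *)
Lemma avg_wprod_le g : avg (wprod F \o nf) g <= wprod F (nf g).
Proof.
have [w0|w0] := eqVneq (nf g) [::].
  rewrite w0 {2}/wprod big_nil; apply: le_trans (green_le1 FP).
  apply: ler_sum => c _; apply: ler_sum => x xc.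
  rewrite /= (nf_mul nfP g xc) w0 /= wprod_push ?(green1 FP) //.
  by rewrite /wprod big_nil mulr1.
case/reducedP: (nf_reduced nfP g) => c; case E : (nf g) w0 => [//|y w] _.
move=> /= /and3P[yc y1 aw].
have gE : nf g = push y w by rewrite /push (negbTE y1).
have ayw : alt_word H (~~ (~~ c)) (y :: w) by rewrite negbK /= yc y1.
rewrite (avgE c) -E.
rewrite (eq_bigr (fun x => (m x * F (y * x)%g) * wprod F w)); last first.
  move=> x xc /=; rewrite (nf_push yc aw xc gE) wprod_push ?(green1 FP) //.
  by rewrite mulrA.
rewrite [X in _ + X](eq_bigr (fun x => (m x * F x) * (F y * wprod F w))); last first.
  move=> x xc /=.
  rewrite (@nf_push (~~ c) g 1%g (y :: w) x) ?group1 // ?mul1g.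
    by rewrite wprod_push ?(green1 FP) // /wprod big_cons mulrA.
  by rewrite /push eqxx.
rewrite -!mulr_suml gE wprod_push ?(green1 FP) // mulrA -mulrDl.
by rewrite (green_harmonic FP yc y1).
Qed.

Lemma iotaV c x : x \in H c -> iota x^-1%g = (iota x)^-1%g.
Proof.
move=> xc; have h : (iota x * iota x^-1)%g = 1%g.
  apply: (nf_inj nfP); rewrite -[(iota x * _)%g]mul1g mulgA.
  rewrite (nf_mul nfP (c:=c)) ?groupV // (nf_mul nfP _ xc).
  rewrite (appendM tiH (c:=c)) ?groupV ?(nf_reduced nfP) //.
  by rewrite mulgV append1 // (nf_reduced nfP).
by rewrite -[LHS]mul1g -(mulVg (iota x)) -mulgA h mulg1.
Qed.

Lemma avg_reverse f g :
  \sum_(c : bool) \sum_(x in H c) m x * f (g * (iota x)^-1)%g = avg f g.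
Proof.
apply: eq_bigr => c _; rewrite (reindex_inj invg_inj) /=.
apply: eq_big => [x|x]; first by rewrite groupV.
by rewrite groupV => xc; rewrite (step_sym mP) (iotaV xc) invgK.
Qed.

(** Conditioning on the last step expresses the power at [g] through the points [g * (iota x)^-1].
    As the weights are symmetric this is again an average, so the bound propagates by
    superharmonicity. *)
Lemma convpow_le_wprod n g : convpow mu n g <= wprod F (nf g).
Proof.
elim: n g => [|n IH] g.
  rewrite convpowE /= /mass1; case: eqVneq => [<-|_].
    by rewrite (nf1 nfP) /wprod big_nil.
  by rewrite ltW // wprod_gt0.
apply: le_trans (avg_wprod_le g); rewrite -avg_reverse.
have -> : convpow mu n.+1 g =
    \sum_(c : bool) \sum_(x in H c) m x * convpow mu n (g * (iota x)^-1)%g.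
  rewrite convpowE iterSr.
  transitivity (avgn n (fun h => \sum_(c <- index_enum bool)
      \sum_(x <- index_enum P | x \in H c) m x * mass1 R (g * (iota x)^-1)%g h) 1%g).
    apply: avgn_ext => h; apply: eq_bigr => c _; apply: eq_bigr => x _.
    congr (_ * _%:R); congr nat_of_bool.
    by apply/eqP/eqP => [<-|->]; rewrite ?mulgK ?mulgKV.
  rewrite avgn_sum; apply: eq_bigr => c _.
  rewrite avgn_sum; apply: eq_bigr => x _.
  by rewrite avgnZ -convpowE.
apply: ler_sum => c _; apply: ler_sum => x _.
by rewrite ler_wpM2l ?(step_ge0 mP) // IH.
Qed.

End Green.
End Walk.

(** * Additive functionals along the walk *)

Section Additive.
Variables (R : realType) (P : finGroupType) (H : bool -> {group P}).
Hypothesis tiH : forall x, x \in H true -> x \in H false -> x = 1%g.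
Variables (G : groupType) (iota : P -> G) (nf : G -> seq P).
Hypothesis nfP : normal_form_map H iota nf.
Variable m : P -> R.
Hypothesis mP : step_weights H m.
Implicit Types (c : bool) (x y : P) (w : seq P) (f : G -> R) (g h : G).

Local Notation avg := (avg H iota m).
Local Notation avgn n := (iter n avg).

Lemma alt_word_last c w : alt_word H c w -> exists y w',
  [/\ y \in H c, alt_word H (~~ c) w', w = push y w' & y = 1%g -> w' = [::]].
Proof.
case: w => [_|y w /= /and3P[yc y1 aw]].
  by exists 1%g, [::]; rewrite group1 /push eqxx.
exists y, w; split=> //; first by rewrite /push (negbTE y1).
by move=> y1'; rewrite y1' eqxx in y1.
Qed.

Lemma avg_last c g y w f : y \in H c -> alt_word H (~~ c) w ->
  alt_word H c (push y w) -> nf g = push y w ->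
  forall u : seq P -> R,
  avg (u \o nf) g = \sum_(x in H c) m x * u (push (y * x)%g w) +
    \sum_(x in H (~~ c)) m x * u (push x (push y w)).
Proof.
move=> yc aw ayw gE u; rewrite (avgE _ _ _ c); congr (_ + _).
  by apply: eq_bigr => x xc /=; rewrite (nf_push tiH nfP yc aw xc gE).
apply: eq_bigr => x xc /=.
rewrite (@nf_push _ _ tiH _ _ _ nfP (~~ c) g 1%g (push y w)) ?group1 ?mul1g //.
  by rewrite negbK.
by rewrite /push eqxx.
Qed.

Variable F : P -> R.
Hypothesis FP : green H m F.

Local Notation M c := (\sum_(x in H c) m x * F x).

(** [add_eq] says that the mean increment of the corrected functional at a word with last letter [y]
    is the one at the empty word. The term in [M (~~ c)] is the part of [k y] that survives when a
    letter of the other colour is added. *)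
Record additive_drift (phi k : P -> R) (gamma : R) : Prop := AdditiveDrift {
  add_phi1 : phi 1%g = 0;
  add_k1 : k 1%g = 0;
  add_eq : forall c y, y \in H c ->
    \sum_(x in H c) m x * (phi (y * x)%g + k (y * x)%g) -
      (\sum_(x in H c) m x) * phi y - (1 - M (~~ c)) * k y =
    \sum_(x in H c) m x * (phi x + k x);
  add_gamma : \sum_(c : bool) \sum_(x in H c) m x * (phi x + k x) = gamma }.

Lemma big_boolE (V : nmodType) (u : bool -> V) c : \sum_(d : bool) u d = u c + u (~~ c).
Proof. by rewrite big_bool; case: c => //=; rewrite addrC. Qed.

Section Corrected.
Variables (phi k : P -> R) (gamma : R).
Hypothesis dP : additive_drift phi k gamma.

Definition corrected w := wsum phi w + wcorr F k w.

Lemma avg_corrected g : avg (corrected \o nf) g = corrected (nf g) + gamma.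
Proof.
case/reducedP: (nf_reduced nfP g) => c ag.
have [y [w [yc aw gE y1]]] := alt_word_last ag.
have F1 := green1 FP; have k1 := add_k1 dP; have p1 := add_phi1 dP.
have ayw : alt_word H c (push y w) by rewrite -gE.
rewrite (avg_last (fun=> 0) yc aw ayw gE) gE -(add_gamma dP) (big_boolE _ c).
(* The correction of the earlier letters drops out by harmonicity. For [y = 1] there is no harmonic
   equation, but then [w] is empty. *)
have harm : (\sum_(x in H c) m x * F (y * x)%g + M (~~ c) * F y - F y) *
    wcorr F k w = 0.
  have [/y1 -> | yn1] := eqVneq y 1%g; first by rewrite /wcorr /= mulr0.
  by rewrite (green_harmonic FP yc yn1) subrr mul0r.
have eqs := add_eq dP yc.
have mass := step_sum mP; rewrite (big_boolE _ c) in mass.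
under eq_bigr => x xc.
  rewrite /corrected wsum_push // wcorr_push //.
  rewrite (_ : m x * _ = m x * wsum phi w + (m x * F (y * x)%g) * wcorr F k w +
      m x * (phi (y * x)%g + k (y * x)%g)); last by ring.
  over.
under [X in _ + X = _]eq_bigr => x xc.
  rewrite /corrected wsum_push // [wcorr F k (push x _)]wcorr_push //.
  rewrite (_ : m x * _ = m x * wsum phi (push y w) +
      (m x * F x) * wcorr F k (push y w) + m x * (phi x + k x)); last by ring.
  over.
rewrite !big_split /= -!mulr_suml.
rewrite /corrected wsum_push // wcorr_push //.
rewrite -eqs; move: harm mass.
set a := \sum_(x in H c) m x * F (y * x)%g; set b := M (~~ c).
set s := \sum_(x in H c) m x; set s' := \sum_(x in H (~~ c)) m x.
set n := \sum_(x in H c) m x * (_ + _).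
set n' := \sum_(x in H (~~ c)) m x * (_ + _).
move=> harm mass; have -> : s' = 1 - s by lra.
apply/eqP; rewrite -subr_eq0 -harm; apply/eqP; ring.
Qed.

Lemma avgn_corrected n g :
  avgn n (corrected \o nf) g = corrected (nf g) + n%:R * gamma.
Proof.
elim: n => [|n IH] /=; first by rewrite mul0r addr0.
rewrite -iterS iterSr.
transitivity (avgn n (fun h => (corrected \o nf) h + gamma) g).
  by apply: avgn_ext => h; exact: avg_corrected.
rewrite avgnD // avgn_cst // IH -addrA; congr (_ + _).
by rewrite -natr1 mulrDl mul1r.
Qed.

(** A geometric series: the letters of a reduced word have [F] at most some [r < 1]. *)
Lemma wcorr_bounded : exists C : R, 0 <= C /\ forall w, reduced H w -> `|wcorr F k w| <= C.
Proof.
have F1 := FP.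
pose r : R := \big[Num.max/0]_(x | [exists c, (x \in H c) && (x != 1%g)]) F x.
have r0 : 0 <= r by exact: bigmax_ge_id.
have r1 : r < 1.
  apply/bigmax_ltP; split=> // x /existsP[c /andP[xc x1]].
  exact: (green_lt1 FP xc x1).
pose K : R := \sum_x `|k x|.
have K0 : 0 <= K by apply: sumr_ge0.
exists (K / (1 - r)); have C0 : 0 <= K / (1 - r).
  by rewrite divr_ge0 // subr_ge0 ltW.
split=> // w /reducedP[c]; elim: w c => [|x w IH] c /=; first by rewrite normr0.
case/and3P=> xc x1 aw; apply: le_trans (ler_normD _ _) _.
have kx : `|k x| <= K by rewrite /K (bigD1 x) //= lerDl sumr_ge0.
have Fx : F x <= r.
  by apply: (le_bigmax_cond 0); apply/existsP; exists c; rewrite xc.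
have Fx0 := ltW (green_gt0 FP x).
rewrite normrM (ger0_norm Fx0).
have : F x * `|wcorr F k w| <= r * (K / (1 - r)).
  by apply: ler_pM => //; exact: IH aw.
move=> h; apply: le_trans (lerD h kx) _.
have d0 : 1 - r != 0 by rewrite gt_eqF // subr_gt0.
have := divfK d0 K; set C := K / _ => e.
by rewrite -[X in _ + X <= _]e mulrBr mulr1 mulrC addrC subrK.
Qed.

Lemma cvg_bounded_div (u : nat -> R) C a : (forall n, `|u n - n%:R * a| <= C) ->
  u n / n%:R @[n --> \oo] --> a.
Proof.
move=> uC.
have C0 : 0 <= C by apply: le_trans (uC 0%N).
have h0 : (fun n : nat => C * n%:R^-1 : R) @ \oo --> 0.
  rewrite -(mulr0 C); apply: cvgMr; apply/gtr0_cvgV0.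
    by exists 1%N => // n /=; rewrite ltr0n.
  exact: cvgr_idn.
have h1 : (fun n : nat => a - C * n%:R^-1 : R) @ \oo --> a.
  by rewrite -[X in _ --> X]subr0; apply: cvgB => //; exact: cvg_cst.
have h2 : (fun n : nat => a + C * n%:R^-1 : R) @ \oo --> a.
  by rewrite -[X in _ --> X]addr0; apply: cvgD => //; exact: cvg_cst.
apply: squeeze_cvgr h1 h2.
exists 1%N => // n /= n1.
have n0 : (0 : R) < n%:R by rewrite ltr0n.
have := uC n; rewrite ler_norml => /andP[l u'].
rewrite ler_pdivlMr // ler_pdivrMr // !mulrDl mulNr -!mulrA mulVf ?gt_eqF //.
by apply/andP; split; lra.
Qed.

Lemma avgn_additive_cvg :
  avgn n (wsum phi \o nf) 1%g / n%:R @[n --> \oo] --> gamma.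
Proof.
have [C [C0 CP]] := wcorr_bounded.
apply: (@cvg_bounded_div _ C) => n.
have c1 : corrected (nf 1%g) = 0.
  by rewrite (nf1 nfP) /corrected /wsum /wcorr big_nil /= addr0.
have := avgn_corrected n 1%g; rewrite c1 add0r => <-.
rewrite ler_norml; apply/andP; split.
  rewrite lerBrDl -[X in _ + X <= _](avgn_cst iota mP n (- C) 1%g) -avgnD //.
  apply: avgn_le => // h; rewrite /= /corrected.
  by have := CP _ (nf_reduced nfP h); rewrite ler_norml => /andP[]; lra.
rewrite lerBlDl -[X in _ <= _ + X](avgn_cst iota mP n C 1%g) -avgnD //.
apply: avgn_le => // h; rewrite /= /corrected.
by have := CP _ (nf_reduced nfP h); rewrite ler_norml => /andP[]; lra.
Qed.

End Corrected.
End Additive.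

(** * Counting words by weight *)

Lemma ler_sum_subset (R : numDomainType) (T : eqType) (s t : seq T) (u : T -> R) :
  uniq s -> {subset s <= t} -> (forall x, 0 <= u x) ->
  \sum_(x <- s) u x <= \sum_(x <- t) u x.
Proof.
move=> us st u0; elim: s t us st => [|x s IH] t /=; first by rewrite big_nil sumr_ge0.
case/andP=> xs us st; have xt : x \in t by rewrite st ?mem_head.
rewrite big_cons (big_rem x xt) /= lerD2l IH // => y ys.
have : y \in t by rewrite st // inE ys orbT.
rewrite (perm_mem (perm_to_rem xt)) inE => /orP[/eqP yx|//].
by rewrite yx (negbTE xs) in ys.
Qed.

Lemma ln_le_sub1 (R : realType) (x : R) : 0 < x -> ln x <= x - 1.
Proof.
move=> x0; have {1}-> : x = 1 + (x - 1) by rewrite addrC subrK.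
by apply: le_ln1Dx; rewrite ltrBrDl subrr.
Qed.

(** The explicit null sequence comes from [ln y = 2 ln (sqrt y) <= 2 sqrt y]. *)
Lemma ln_linear_over_n (R : realType) (C : R) : 0 < C ->
  exists a : nat -> R, a n @[n --> \oo] --> 0 /\
    forall n, (0 < n)%N -> ln (C * n.+1%:R) / n%:R <= a n.
Proof.
move=> C0; exists (fun n => 2 * Num.sqrt (2 * C * n%:R^-1)); split.
  rewrite -(mulr0 2); apply: cvgMr; rewrite -[X in _ --> X](@sqrtr0 R).
  apply: (@cvg_comp _ _ _ _ _ _ (nbhs (0 : R)) _ _); last exact: sqrt_continuous.
  rewrite -(mulr0 (2 * C)); apply: cvgMr; apply/gtr0_cvgV0.
    by exists 1%N => // n /=; rewrite ltr0n.
  exact: cvgr_idn.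
move=> n n0; have n0' : (0 : R) < n%:R by rewrite ltr0n.
rewrite ler_pdivrMr // -(mulrA 2 (Num.sqrt _)).
have -> : Num.sqrt (2 * C / n%:R) * n%:R = Num.sqrt (2 * C * n%:R).
  have sq : n%:R = Num.sqrt (n%:R ^+ 2) :> R by rewrite sqrtr_sqr ger0_norm ?ltW.
  rewrite [X in _ * X = _]sq -sqrtrM; last by rewrite !mulr_ge0 ?invr_ge0 ?ltW.
  by congr Num.sqrt; field; rewrite gt_eqF.
have y0 : 0 < C * n.+1%:R by rewrite mulr_gt0 ?ltr0n.
have yle : C * n.+1%:R <= 2 * C * n%:R.
  rewrite [2 * C]mulrC -mulrA ler_pM2l // -natrM ler_nat mul2n -addnn -addn1.
  by rewrite leq_add2l.
apply: le_trans (_ : 2 * Num.sqrt (C * n.+1%:R) <= _); last first.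
  by rewrite ler_pM2l // ler_sqrt // (le_trans _ yle) // ltW.
have s0 : 0 < Num.sqrt (C * n.+1%:R) by rewrite sqrtr_gt0.
rewrite -{1}(sqr_sqrtr (ltW y0)) lnXn // -[_ *+ 2]mulr_natl ler_pM2l //.
by apply: le_trans (ln_le_sub1 s0) _; rewrite gerBl.
Qed.

Section Weights.
Variables (R : realType) (P : finGroupType) (H : bool -> {group P}).
Variable F : P -> R.
Hypothesis F0 : forall x, 0 < F x.
Hypothesis FS : \prod_(c : bool) \sum_(x in H c | x != 1%g) F x = 1.

Local Notation S c := (\sum_(x in H c | x != 1%g) F x).

Fixpoint words c n : seq (seq P) :=
  if n is n'.+1 then
    [::] :: [seq x :: w | x <- [seq x <- enum P | (x \in H c) && (x != 1%g)], w <- words (~~ c) n']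
  else [:: [::]].

Lemma mem_words c n w : alt_word H c w -> (size w <= n)%N -> w \in words c n.
Proof.
elim: n c w => [|n IH] c [|x w] //= /and3P[xc x1 aw] sw.
rewrite inE; apply/orP; right; apply/allpairsP; exists (x, w) => /=; split=> //.
  by rewrite mem_filter xc x1 mem_enum.
exact: IH.
Qed.

Lemma weights_ge0 c : 0 <= S c.
Proof. by apply: sumr_ge0 => x _; exact: ltW. Qed.

Lemma weightsM c : S c * S (~~ c) = 1.
Proof. by move: FS; rewrite big_bool; case: c => //=; rewrite mulrC. Qed.

(** Since the two letter sums have product 1, the words with exactly [k] letters contribute 1 for
    even [k] and [S c] for odd [k]; the total is therefore linear in [n]. *)
Lemma sum_words c n :
  \sum_(w <- words c n) wprod F w <= (1 + S c) * n.+1%:R.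
Proof.
elim: n c => [|n IH] c /=.
  by rewrite big_seq1 /wprod big_nil mulr1 lerDl weights_ge0.
rewrite big_cons {1}/wprod big_nil big_allpairs_dep /=.
rewrite big_filter big_enum_cond /=.
apply: le_trans (_ : 1 + \sum_(x in H c | x != 1%g) F x * ((1 + S (~~ c)) * n.+1%:R) <= _).
  rewrite lerD2l; apply: ler_sum => x _.
  under eq_bigr do rewrite /wprod big_cons.
  by rewrite -mulr_sumr ler_pM2l.
rewrite -mulr_suml mulrA mulrDr mulr1 weightsM [S c + 1]addrC.
rewrite -[n.+2]addn1 natrD mulrDr mulr1 [X in X <= _]addrC lerD2l.
by rewrite lerDl weights_ge0.
Qed.

Lemma sum_reduced_le : exists C : R, 0 < C /\ forall n (s : seq (seq P)), uniq s ->
  (forall w, w \in s -> reduced H w /\ (size w <= n)%N) ->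
  \sum_(w <- s) wprod F w <= C * n.+1%:R.
Proof.
exists ((1 + S true) + (1 + S false)); split.
  by have := weights_ge0 true; have := weights_ge0 false; lra.
move=> n s us sP; apply: le_trans (_ : \sum_(w <- words true n ++ words false n) wprod F w <= _).
  apply: ler_sum_subset => //.
    move=> w /sP[/orP[aw|aw] sw]; rewrite mem_cat (mem_words aw sw) ?orbT //.
  by move=> w; apply: prodr_ge0 => x _; exact: ltW.
by rewrite big_cat /= mulrDl lerD // sum_words.
Qed.

End Weights.

(** * Entropy *)

Section Entropy.
Variables (R : realType) (P : finGroupType) (H : bool -> {group P}).
Hypothesis tiH : forall x, x \in H true -> x \in H false -> x = 1%g.
Variables (G : groupType) (iota : P -> G) (nf : G -> seq P).
Hypothesis nfP : normal_form_map H iota nf.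
Variable m : P -> R.
Hypothesis mP : step_weights H m.
Variable mu : G -> R.
Hypothesis muE :
  forall g, mu g = \sum_(c : bool) \sum_(x in H c) m x * (g == iota x)%:R.
Variable F : P -> R.
Hypothesis FP : green H m F.

Local Notation avgn n := (iter n (avg H iota m)).
Local Notation p n g := (convpow mu n g).
Local Notation reached n := (undup (reach H iota 1%g n)).

Lemma wsum_ln w : wsum (fun x => - ln (F x)) w = - ln (wprod F w).
Proof.
elim: w => [|x w IH]; first by rewrite /wsum /wprod !big_nil ln1 oppr0.
rewrite /wsum big_cons -/(wsum _ w) IH /wprod big_cons lnM ?opprD // posrE.
  exact: green_gt0 FP x.
exact: wprod_gt0 FP w.
Qed.

Lemma entropy_sum n : - (\sum_(g \in [set: G]) p n g * ln (p n g)) =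
  \sum_(g <- reached n) p n g * - ln (p n g).
Proof.
rewrite (@fsum_setTE _ _ (reached n)) ?undup_uniq //.
  by rewrite -sumrN; apply: eq_bigr => g _; rewrite mulrN.
by move=> g gr; rewrite (convpow_out mP muE gr) mul0r.
Qed.

Local Notation E n := (avgn n (wsum (fun x => - ln (F x)) \o nf) 1%g).

Lemma entropy_ge n : E n <= \sum_(g <- reached n) p n g * - ln (p n g).
Proof.
rewrite (avgn_convpow mP muE); apply: ler_sum => g _ /=; rewrite wsum_ln.
have [->|p0] := eqVneq (p n g) 0; first by rewrite !mul0r.
have pg : 0 < p n g by rewrite lt_def p0 (convpow_ge0 mP muE).
apply: ler_wpM2l; first exact: ltW.
rewrite lerN2 ler_ln ?posrE ?(wprod_gt0 FP) //.
exact: (convpow_le_wprod tiH nfP mP muE FP).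
Qed.

Lemma entropy_le : exists C : R, 0 < C /\ forall n,
  \sum_(g <- reached n) p n g * - ln (p n g) <= E n + ln (C * n.+1%:R).
Proof.
have [C [C0 CP]] := sum_reduced_le (green_gt0 FP) (green_sum FP).
exists C; split=> // n; have Z0 : 0 < C * n.+1%:R by rewrite mulr_gt0.
set Z := C * _ in Z0 *.
(* A point reached in [n] steps has at most [n] letters, so this is a subprobability and can be the
   reference measure in Gibbs' inequality. *)
have qle : \sum_(g <- reached n) wprod F (nf g) / Z <= 1.
  rewrite -mulr_suml ler_pdivrMr // mul1r.
  have := CP n [seq nf g | g <- reached n]; rewrite big_map; apply.
    by rewrite map_inj_uniq ?undup_uniq //; exact: nf_inj nfP.
  move=> w /mapP[g]; rewrite mem_undup => gr ->; split.
    exact: nf_reduced nfP g.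
  by have := size_reach nfP gr; rewrite (nf1 nfP).
rewrite (avgn_convpow mP muE) -[ln Z]mul1r -[X in X * ln Z](convpow_sum mP muE n).
rewrite mulr_suml -big_split /= -subr_le0 -sumrB.
apply: le_trans (_ : \sum_(g <- reached n) (wprod F (nf g) / Z - p n g) <= _).
  apply: ler_sum => g _; rewrite wsum_ln.
  have W0 := wprod_gt0 FP (nf g).
  have [->|p0] := eqVneq (p n g) 0.
    by rewrite !mul0r addr0 !subr0 divr_ge0 // ltW.
  have pg : 0 < p n g by rewrite lt_def p0 (convpow_ge0 mP muE).
  have q0 : 0 < wprod F (nf g) / Z / p n g by rewrite !divr_gt0.
  have := ln_le_sub1 q0; rewrite !ln_div ?posrE ?divr_gt0 // => h.
  have := ler_wpM2l (ltW pg) h; rewrite [X in _ <= X]mulrBr mulrC.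
  rewrite [p n g * (_ / p n g)]mulrC divfK // mulr1; lra.
by rewrite sumrB (convpow_sum mP muE) subr_le0.
Qed.

Lemma entropyE k gamma :
  additive_drift H m F (fun x => - ln (F x)) k gamma -> entropy mu = gamma.
Proof.
move=> dP; apply/cvg_lim => //.
have lo := avgn_additive_cvg tiH nfP mP FP dP.
have [C [C0 CP]] := entropy_le.
have [a [a0 aP]] := ln_linear_over_n C0.
have hi : (fun n => E n / n%:R + a n) @ \oo --> gamma.
  by rewrite -[X in _ --> X]addr0; apply: cvgD.
apply: squeeze_cvgr lo hi; exists 1%N => // n /= n1.
have n0 : (0 : R) < n%:R by rewrite ltr0n.
rewrite entropy_sum; apply/andP; split.
  by rewrite ler_pM2r ?invr_gt0 // entropy_ge.
apply: le_trans (_ : (E n + ln (C * n.+1%:R)) / n%:R <= _).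
  by rewrite ler_pM2r ?invr_gt0.
by rewrite mulrDl lerD2l aP.
Qed.

End Entropy.

(** * Concentration *)

(** Here [exp x <= 1 / (1 - x)], and [(1 - x) (1 + x + 2 x^2) = 1 + x^2 (1 - 2 x)]. *)
Lemma expR_le_quadratic (R : realType) (x : R) :
  `|x| <= 2^-1 -> expR x <= 1 + x + 2 * x ^+ 2.
Proof.
rewrite ler_norml => /andP[x1 x2].
have h : 0 < 1 - x by lra.
apply: le_trans (_ : (1 - x)^-1 <= _).
  rewrite -[x in X in X <= _]opprK expRN lef_pV2 ?posrE ?expR_gt0 //.
  exact: expR_ge1Dx.
rewrite -[X in X <= _]mul1r ler_pdivrMr //.
have : 0 <= x ^+ 2 * (1 - 2 * x) by rewrite mulr_ge0 ?sqr_ge0 //; lra.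
rewrite !expr2; lra.
Qed.

Section Concentration.
Variables (R : realType) (P : finGroupType) (H : bool -> {group P}).
Variables (G : groupType) (iota : P -> G).
Variable m : P -> R.
Hypothesis mP : step_weights H m.
Local Notation avg := (avg H iota m).
Local Notation avgn n := (iter n avg).

Variables (f : G -> R) (gamma B : R).
Hypothesis avgf : forall g, avg f g = f g + gamma.
Hypothesis B1 : 1 <= B.
Hypothesis incr : forall c x g, x \in H c -> `|f (g * iota x)%g - f g - gamma| <= B.

(** The mean increment of [f] is exactly [gamma], so the linear terms of the exponential cancel on
    average and only the quadratic error remains. *)
Lemma avg_expR t g : 0 <= t -> t * B <= 2^-1 ->
  avg (fun h => expR (t * f h)) g <= expR (2 * (t * B) ^+ 2 + t * gamma) * expR (t * f g).
Proof.
move=> t0 tB.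
have step c x : x \in H c -> expR (t * f (g * iota x)%g) <=
    expR (t * gamma + t * f g) *
      (1 + 2 * (t * B) ^+ 2 - t * gamma - t * f g + t * f (g * iota x)%g).
  move=> xc; have d := incr g xc.
  set d0 := f _ - f g - gamma in d.
  have -> : t * f (g * iota x)%g = (t * gamma + t * f g) + t * d0.
    by rewrite /d0; ring.
  rewrite [X in X <= _]expRD ler_wpM2l ?expR_ge0 //.
  have td : `|t * d0| <= t * B by rewrite normrM ger0_norm // ler_wpM2l.
  apply: le_trans (expR_le_quadratic (le_trans td tB)) _.
  have : (t * d0) ^+ 2 <= (t * B) ^+ 2.
    by rewrite -real_normK ?num_real // lerXn2r // nnegrE // (le_trans _ td).
  lra.
apply: le_trans (_ : avg (fun h => expR (t * gamma + t * f g) *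
    (1 + 2 * (t * B) ^+ 2 - t * gamma - t * f g + t * f h)) g <= _).
  apply: ler_sum => c _; apply: ler_sum => x xc.
  by rewrite ler_wpM2l ?(step_ge0 mP) // (step c).
rewrite avgZ avgD avgZ (avg_cst _ mP) avgf.
have -> : expR (2 * (t * B) ^+ 2 + t * gamma) * expR (t * f g) =
    expR (t * gamma + t * f g) * expR (2 * (t * B) ^+ 2).
  by rewrite -!expRD; congr expR; ring.
rewrite ler_wpM2l ?expR_ge0 //.
apply: le_trans (expR_ge1Dx _); lra.
Qed.

Lemma avgn_expR n t g : 0 <= t -> t * B <= 2^-1 ->
  avgn n (fun h => expR (t * f h)) g <=
  expR (2 * (t * B) ^+ 2 + t * gamma) ^+ n * expR (t * f g).
Proof.
move=> t0 tB; elim: n g => [|n IH] g; first by rewrite expr0 mul1r.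
rewrite iterSr exprS -mulrA.
apply: le_trans (_ : avgn n (fun h => expR (2 * (t * B) ^+ 2 + t * gamma) *
   expR (t * f h)) g <= _).
  by apply: avgn_le => // h; exact: avg_expR.
by rewrite avgnZ ler_wpM2l ?expR_ge0.
Qed.

Lemma avgn_tail n (e : R) : 0 < e <= 1 ->
  avgn n (fun g => (n%:R * e <= f g - f 1%g - n%:R * gamma)%R%:R) 1%g <=
  expR (- (e ^+ 2 / (8 * B ^+ 2))) ^+ n.
Proof.
(* This [t] minimises [2 (t B)^2 - t e], the exponent per step, with minimum [- e^2 / (8 B^2)];
   [e <= 1 <= B] keeps [t B] below one half. *)
case/andP=> e0 e1; have [t tE] : exists t, t = e / (4 * B ^+ 2) by exists (e / (4 * B ^+ 2)).
have B0 : 0 < B := lt_le_trans ltr01 B1.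
have t0 : 0 <= t by rewrite tE divr_ge0 ?mulr_ge0 ?exprn_ge0 // ltW.
have tBE : t * B = e / (4 * B) by rewrite tE; field; rewrite gt_eqF.
have tB : t * B <= 2^-1.
  by rewrite tBE ler_pdivrMr ?mulr_gt0 //; have := B1; move: e1; lra.
apply: le_trans (_ : avgn n (fun g => expR (- (t * (f 1%g + n%:R * gamma + n%:R * e))) * expR (t * f g)) 1%g <= _).
  apply: avgn_le => // h; rewrite -expRD; case: (leP (n%:R * e) _) => c; last first.
    by rewrite /= expR_ge0.
  rewrite -[X in X <= _]expR0 ler_expR.
  have : 0 <= t * (f h - f 1%g - n%:R * gamma - n%:R * e) by rewrite mulr_ge0 //; lra.
  lra.
rewrite avgnZ; apply: le_trans (ler_wpM2l (expR_ge0 _) (avgn_expR n 1%g t0 tB)) _.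
rewrite mulrCA -expRD -!expRM_natl -expRD ler_expR tBE tE.
rewrite le_eqVlt; apply/orP; left; apply/eqP; field.
by rewrite gt_eqF.
Qed.

End Concentration.

(** * Sample paths *)

Section Paths.
Variables (R : realType) (P : finGroupType) (H : bool -> {group P}).
Hypothesis tiH : forall x, x \in H true -> x \in H false -> x = 1%g.
Variables (G : groupType) (iota_ : P -> G) (nf : G -> seq P).
Hypothesis nfP : normal_form_map H iota_ nf.
Variable m : P -> R.
Hypothesis mP : step_weights H m.
Variable mu : G -> R.
Hypothesis muE :
  forall g, mu g = \sum_(c : bool) \sum_(x in H c) m x * (g == iota_ x)%:R.

Local Notation avg := (avg H iota_ m).
Local Notation avgn n := (iter n avg).

Definition letter x := [exists c, x \in H c] && (x != 1%g).
Definition letters := [seq x <- enum P | letter x].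

Lemma mem_letters x : (x \in letters) = letter x.
Proof. by rewrite mem_filter mem_enum andbT. Qed.

Lemma letters_uniq : uniq letters.
Proof. by rewrite filter_uniq ?enum_uniq. Qed.

Lemma letter_cases (x : P) : letter x = (x \in H true) && (x != 1%g) || (x \in H false) && (x != 1%g).
Proof.
rewrite /letter -andb_orl; congr andb.
apply/existsP/orP => [[[] h]|[h|h]]; [by left|by right|by exists true|by exists false].
Qed.

Lemma nf_iota c x : x \in H c -> nf (iota_ x) = push x [::].
Proof.
by move=> xc; rewrite -[iota_ x]mul1g (nf_mul nfP _ xc) (nf1 nfP).
Qed.

Lemma iota_inj x y : letter x -> letter y -> iota_ x = iota_ y -> x = y.
Proof.
case/andP=> /existsP[c xc] x1 /andP[/existsP[c' yc] y1] /(congr1 nf).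
by rewrite (nf_iota xc) (nf_iota yc) /push (negbTE x1) (negbTE y1) => -[].
Qed.

Lemma sum_letters (u : P -> R) :
  \sum_(c : bool) \sum_(x in H c) m x * u x = \sum_(x <- letters) m x * u x.
Proof.
have D c : \sum_(x in H c) m x * u x = \sum_(x in H c | x != 1%g) m x * u x.
  by rewrite (bigD1 1%g) ?group1 //= (step_one mP) mul0r add0r.
rewrite big_bool /= !D big_filter big_enum_cond /=.
rewrite [RHS](bigID (fun x => x \in H true)) /=; congr (_ + _).
  apply: eq_bigl => x; rewrite letter_cases.
  by case: (x \in H true); rewrite ?andbF //= andbT orb_idr // => /andP[].
apply: eq_bigl => x; rewrite letter_cases.
case: (boolP (x \in H true)) => /= xt; last by rewrite andbT.
rewrite andbF; apply/negP => /andP[xf /eqP]; apply; exact: tiH.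
Qed.

Lemma mu_letter x : letter x -> mu (iota_ x) = m x.
Proof.
move=> xl; rewrite muE sum_letters (bigD1_seq x) ?letters_uniq ?mem_letters //=.
rewrite eqxx mulr1 big_seq_cond big1 ?addr0 // => y /andP[].
rewrite mem_letters => yl yx; case: eqVneq => [e|]; rewrite ?mulr0 //.
by rewrite (iota_inj xl yl e) eqxx in yx.
Qed.

Lemma sum_letters1 : \sum_(x <- letters) m x = 1.
Proof.
rewrite -(step_sum mP); have := sum_letters (fun=> 1).
under eq_bigr do under eq_bigr do rewrite mulr1.
by under [X in _ = X -> _]eq_bigr do rewrite mulr1.
Qed.

Fixpoint paths n : seq (seq P) :=
  if n is n'.+1 then [seq x :: s | x <- letters, s <- paths n'] else [:: [::]].

Definition endpoint g (s : seq P) := foldl (fun h x => h * iota_ x)%g g s.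

Lemma avgn_paths n f g :
  avgn n f g = \sum_(s <- paths n) (\prod_(x <- s) m x) * f (endpoint g s).
Proof.
elim: n g => [|n IH] g /=; first by rewrite big_seq1 big_nil mul1r.
rewrite big_allpairs_dep /= -[LHS]/(avg _ g) /avg sum_letters.
apply: eq_bigr => x _; rewrite IH mulr_sumr; apply: eq_bigr => s _.
by rewrite big_cons mulrA.
Qed.

Lemma mem_paths n s : (s \in paths n) = (size s == n) && all letter s.
Proof.
elim: n s => [|n IH] [|x s] //=.
  by apply/negP => /allpairsP[[y t] []].
rewrite eqSS; apply/allpairsP/idP => [[[y t] [yl tp [-> ->]]]|].
  by move: yl tp; rewrite mem_letters IH /= => -> /andP[-> ->].
by move=> /and3P[sn xl sl]; exists (x, s); rewrite mem_letters IH sn sl.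
Qed.

Section IID.
Context (d : measure_display) (Omega : measurableType d) (Pr : probability Omega R).
Variable X : nat -> Omega -> G.
Hypothesis iidX : iid_of_law mu Pr X.

Definition cyl (s : seq P) : set Omega :=
  \bigcap_(k in [set` [fset k | k in iota 0 (size s)]%fset])
     (X k @^-1` [set iota_ (nth 1%g s k)]).

Lemma cyl_measurable s : measurable (cyl s).
Proof.
case: iidX => mX _ _; apply: fin_bigcap_measurable => // k _; exact: mX.
Qed.

Lemma cyl_prob s : all letter s -> Pr (cyl s) = (\prod_(x <- s) m x)%:E.
Proof.
case: iidX => _ X1 Xind sl; rewrite /cyl.
rewrite (Xind _ (fun k => [set iota_ (nth 1%g s k)])).
rewrite (perm_big (iota 0 (size s))); last first.
  apply: uniq_perm; rewrite ?fset_uniq ?iota_uniq // => k.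
  by rewrite in_fset /= .
rewrite -prodEFin (big_nth 1%g) /index_iota subn0 big_seq [in RHS]big_seq.
apply: eq_bigr => k; rewrite mem_iota add0n => /andP[_ ks].
by rewrite X1 mu_letter // (allP sl) // mem_nth.
Qed.

Lemma walk_cyl s w : cyl s w -> walk X (size s) w = endpoint 1%g s.
Proof.
have : forall k, (k < size s)%N -> cyl s w -> X k w = iota_ (nth 1%g s k).
  by move=> k ks cw; apply: (cw k); rewrite /= in_fset mem_iota.
move=> h cw; have {h cw} : forall k, (k < size s)%N -> X k w = iota_ (nth 1%g s k).
  by move=> k ks; exact: h.
elim/last_ind: s => [//|s x IH] h; rewrite size_rcons /endpoint foldl_rcons /=.
rewrite -/(endpoint _ _) -IH; last first.
  by move=> k ks; rewrite h ?size_rcons 1?ltnW // nth_rcons ks.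
by rewrite h ?size_rcons // nth_rcons ltnn eqxx.
Qed.

(** A finite union of cylinders, hence an event with an immediate probability bound. Outside the
    null events [bad_step] it contains the paths whose walk satisfies [E] at time [n]. *)
Definition hit n (E : pred G) : set Omega :=
  \big[setU/set0]_(s <- [seq s <- paths n | E (endpoint 1%g s)]) cyl s.

Lemma hit_measurable n E : measurable (hit n E).
Proof. by apply: bigsetU_measurable => s _; exact: cyl_measurable. Qed.

Lemma hit_prob n E : (Pr (hit n E) <= (avgn n (fun g => (E g)%:R) 1%g)%:E)%E.
Proof.
rewrite avgn_paths /hit.
have : all (all letter) (paths n).
  by apply/allP => s; rewrite mem_paths => /andP[].
elim: (paths n) => [|s t IH] /=; first by rewrite !big_nil measure0.
case/andP=> sl /IH {}IH; rewrite big_cons; case: ifP => Es; last first.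
  by rewrite mulr0 add0r.
rewrite big_cons mulr1 EFinD; apply: le_trans (measureU2 _ _ _) _.
- exact: cyl_measurable.
- by apply: bigsetU_measurable => u _; exact: cyl_measurable.
by rewrite -(cyl_prob sl); apply: leeD.
Qed.

(** The increments have values in all of [G], and their law is prescribed only point by point; the
    letters already carry mass 1, so this event is null. *)
Definition bad_step k : set Omega :=
  X k @^-1` (~` [set` [seq iota_ x | x <- letters]]).

Lemma prob_seq k (s : seq G) : uniq s ->
  Pr (X k @^-1` [set` s]) = (\sum_(g <- s) mu g)%:E.
Proof.
case: iidX => mX X1 _; elim: s => [|g s IH] /=.
  by rewrite big_nil set_nil preimage_set0 measure0.
case/andP=> gs us; rewrite big_cons EFinD -(X1 k) -IH // -measureU //.
- rewrite -preimage_setU; congr (Pr (_ @^-1` _)).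
  by apply/seteqP; split=> h /=; rewrite inE => /predU1P.
- rewrite -preimage_setI [X in _ @^-1` X](_ : _ = set0) ?preimage_set0 //.
  by apply/seteqP; split=> h //= [-> ]; rewrite (negbTE gs).
Qed.

Lemma bad_step0 k : Pr (bad_step k) = 0%E.
Proof.
case: (iidX) => mX _ _; rewrite /bad_step preimage_setC probability_setC //.
- have -> : Pr (X k @^-1` [set` [seq iota_ x | x <- letters]]) = 1%E.
  rewrite prob_seq; last first.
    rewrite map_inj_in_uniq ?letters_uniq // => x y.
    by rewrite !mem_letters; exact: iota_inj.
  rewrite big_map big_seq (eq_bigr m) -?big_seq ?sum_letters1 //.
  by move=> x; rewrite mem_letters => /mu_letter.
  by rewrite subee.
exact: (mX k [set` [seq iota_ x | x <- letters]]).
Qed.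

Lemma walk_hit n (E : pred G) w : (forall k, ~ bad_step k w) ->
  E (walk X n w) -> hit n E w.
Proof.
move=> good Ew.
have ex k : exists x, letter x /\ X k w = iota_ x.
  have /contrapT : ~ ~ [set` [seq iota_ x | x <- letters]] (X k w) := good k.
  by move=> /mapP[x]; rewrite mem_letters => xl ->; exists x.
have [a aP] := choice ex.
have sz : size (mkseq a n) = n by rewrite size_mkseq.
have al : all letter (mkseq a n).
  by apply/allP => y /mapP[k _ ->]; case: (aP k).
have cw : cyl (mkseq a n) w.
  by move=> k; rewrite /= in_fset mem_iota sz add0n => kn; rewrite nth_mkseq //; case: (aP k).
rewrite /hit -bigcup_seq; exists (mkseq a n) => //=.
rewrite mem_filter mem_paths sz eqxx al /= andbT.
by rewrite -(walk_cyl cw) sz.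
Qed.

End IID.
End Paths.

(** * Almost sure drift *)

(** The Borel-Cantelli lemma with a geometric majorant. *)
Lemma lim_sup_set_geometric (R : realType) (d : measure_display)
    (T : measurableType d) (mu : {measure set T -> \bar R}) (E : (set T)^nat) (a r : R) :
  (forall n, measurable (E n)) -> 0 <= a -> 0 < r < 1 ->
  (forall n, (mu (E n) <= (a * r ^+ n)%:E)%E) -> mu (lim_sup_set E) = 0%E.
Proof.
move=> mE a0 /andP[r0 r1] Er; apply: lim_sup_set_cvg0 => //.
apply: (@le_lt_trans _ _ (a * (1 - r)^-1)%:E); last exact: ltry.
apply: lime_le; first by apply: is_cvg_nneseries.
apply: nearW => n /=.
apply: (@le_trans _ _ (series (geometric a r) n)%:E); last first.
  by rewrite lee_fin geometric_le_lim // gtr0_norm.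
by rewrite /series /= -sumEFin; apply: lee_sum => i _; exact: Er.
Qed.

Section Drift.
Variables (R : realType) (P : finGroupType) (H : bool -> {group P}).
Hypothesis tiH : forall x, x \in H true -> x \in H false -> x = 1%g.
Variables (G : groupType) (iota_ : P -> G) (nf : G -> seq P).
Hypothesis nfP : normal_form_map H iota_ nf.
Variable m : P -> R.
Hypothesis mP : step_weights H m.
Variable mu : G -> R.
Hypothesis muE :
  forall g, mu g = \sum_(c : bool) \sum_(x in H c) m x * (g == iota_ x)%:R.
Variable F : P -> R.
Hypothesis FP : green H m F.
Variables (phi k : P -> R) (gamma : R).
Hypothesis dP : additive_drift H m F phi k gamma.

Local Notation avg := (avg H iota_ m).
Local Notation avgn n := (iter n avg).
Local Notation f := (corrected F phi k \o nf).

Lemma wsum_increment : exists K : R, forall c x g, x \in H c ->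
  `|wsum phi (nf (g * iota_ x)%g) - wsum phi (nf g)| <= K.
Proof.
exists (2 * \sum_x `|phi x|) => c x g xc.
have [y [w [yc aw gE]]] := nf_split nfP c g.
rewrite (nf_push tiH nfP yc aw xc gE) gE !wsum_push ?(add_phi1 dP) //.
have le1 z : `|phi z| <= \sum_x `|phi x| by rewrite (bigD1 z) //= lerDl sumr_ge0.
have -> : wsum phi w + phi (y * x)%g - (wsum phi w + phi y) = phi (y * x)%g - phi y.
  by ring.
apply: le_trans (ler_normB _ _) _.
by have := le1 (y * x)%g; have := le1 y; lra.
Qed.

Lemma corrected_increment : exists B : R, 1 <= B /\ forall c x g, x \in H c ->
  `|f (g * iota_ x)%g - f g - gamma| <= B.
Proof.
have [K KP] := wsum_increment.
have [C [C0 CP]] := wcorr_bounded FP k.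
exists (1 + `|K| + 2 * C + `|gamma|); split.
  by have := normr_ge0 K; have := normr_ge0 gamma; lra.
move=> c x g xc; have h1 := KP c x g xc.
have h2 := CP _ (nf_reduced nfP (g * iota_ x)%g); have h3 := CP _ (nf_reduced nfP g).
have h4 := ler_norm K.
rewrite /= /corrected.
set s1 := wsum _ (nf (_ * _)%g) in h1 *; set s2 := wsum _ (nf g) in h1 *.
set c1 := wcorr _ _ (nf (_ * _)%g) in h2 *; set c2 := wcorr _ _ (nf g) in h3 *.
have -> : s1 + c1 - (s2 + c2) - gamma = (s1 - s2) + c1 - c2 - gamma by ring.
apply: le_trans (ler_normB _ _) _; apply: le_trans (lerD (ler_normB _ _) (lexx _)) _.
have := ler_normD (s1 - s2) c1; lra.
Qed.

Lemma corrected1 : f 1%g = 0.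
Proof. by rewrite /= (nf1 nfP) /corrected /wsum /wcorr big_nil addr0. Qed.

Section IID.
Context (d : measure_display) (Omega : measurableType d) (Pr : probability Omega R).
Variable X : nat -> Omega -> G.
Hypothesis iidX : iid_of_law mu Pr X.

Local Notation dev e n := (fun g => `|f g - n%:R * gamma| >= n%:R * e).

Lemma deviation_null (e : R) : 0 < e <= 1 ->
  Pr (lim_sup_set (fun n => hit H iota_ X n (dev e n))) = 0%E.
Proof.
move=> e01; have [B [B1 BP]] := corrected_increment.
have e0 : 0 < e by case/andP: e01.
have B0 : 0 < B := lt_le_trans ltr01 B1.
set r := expR (- (e ^+ 2 / (8 * B ^+ 2))).
have r01 : 0 < r < 1.
  by rewrite expR_gt0 expR_lt1 oppr_lt0 divr_gt0 ?mulr_gt0 ?exprn_gt0.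
apply: (@lim_sup_set_geometric _ _ _ _ _ 2 r) => //.
  by move=> n; exact: (hit_measurable _ _ iidX).
move=> n; apply: le_trans (hit_prob tiH nfP mP muE iidX n _) _; rewrite lee_fin.
have avgf := avg_corrected tiH nfP mP FP dP.
(* Lower deviations of [f] are upper deviations of [- f], whose mean increment is [- gamma]; the
   factor 2 in the bound counts both tails. *)
have avgNf g : avg (fun h => - f h) g = - f g + - gamma.
  have -> : avg (fun h => - f h) g = avg (fun h => -1 * f h) g.
    by apply: avg_ext => h; rewrite mulN1r.
  by rewrite avgZ avgf mulN1r opprD.
have up := avgn_tail mP avgf B1 BP n e01.
have BNP c x g : x \in H c -> `|(- f (g * iota_ x)%g) - (- f g) - - gamma| <= B.
  move=> xc; have -> : - f (g * iota_ x)%g - - f g - - gamma =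
      - (f (g * iota_ x)%g - f g - gamma) by ring.
  by rewrite normrN; exact: (BP _ _ _ xc).
have dn := avgn_tail mP avgNf B1 BNP n e01.
rewrite [2 * _]mulr_natl mulr2n; apply: le_trans (lerD up dn).
rewrite -avgnD; apply: avgn_le => // h.
rewrite corrected1 oppr0 subr0 -/r.
case: (leP (n%:R * e) `|_|) => [|_]; last by rewrite addr_ge0 ?ler0n.
rewrite ler_normr => /orP[h'|h'] /=.
  by rewrite addr0; move: h' => /= ->; rewrite lerDl.
have -> : - corrected F phi k (nf h) - n%:R * - gamma =
    - (corrected F phi k (nf h) - n%:R * gamma) by ring.
by move: h' => /= ->; rewrite lerDr.
Qed.

(** Outside a null set every step is a letter and, for each [j], the corrected functional deviates
    by [n / (j + 1)] only finitely often. Its bounded correction vanishes after division by [n]. *)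
Lemma additive_ae_cvg : {ae Pr, forall w,
  wsum phi (nf (walk X n w)) / n%:R @[n --> \oo] --> gamma}.
Proof.
have [C [C0 CP]] := wcorr_bounded FP k.
pose e (j : nat) : R := j.+1%:R^-1.
have e01 j : 0 < e j <= 1 by rewrite /e invr_gt0 ltr0n invf_le1 ?ltr0n // ler1n.
pose N := (\bigcup_j bad_step H iota_ X j) `|`
  (\bigcup_j lim_sup_set (fun n => hit H iota_ X n (dev (e j) n))).
apply: (@negligibleS _ _ _ _ N); last first.
  apply: negligibleU; apply: negligible_bigcup => j.
    apply/negligibleP; last exact: (bad_step0 tiH nfP mP muE iidX).
    by case: iidX => mX _ _; exact: mX.
  apply/negligibleP; last exact: deviation_null (e01 j).
  apply: bigcap_measurable => // i _; apply: bigcup_measurable => n _.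
  exact: (hit_measurable _ _ iidX).
move=> w /= ncv; apply: contrapT => nN; apply: ncv.
have good i : ~ bad_step H iota_ X i w by move=> b; apply: nN; left; exists i.
have dev_ev j : exists n0, forall n, (n0 <= n)%N ->
    `|f (walk X n w) - n%:R * gamma| < n%:R * e j.
  apply: contrapT => nex; apply: nN; right; exists j => // n _.
  apply: contrapT => nh; apply: nex; exists n => i ni.
  rewrite ltNge; apply/negP => di; apply: nh; exists i => //.
  exact: (walk_hit (E := dev (e j) i) good di).
have h1 : f (walk X n w) / n%:R @[n --> \oo] --> gamma.
  apply/cvgrPdist_le => eps eps0.
  have [j je] : exists j, e j <= eps.
    have [j _ jP] := near_infty_natSinv_lt (PosNum eps0).
    by exists j; apply: ltW; exact: (jP j (leqnn j)).
  have [n0 n0P] := dev_ev j; exists n0.+1 => // n /= nn.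
  have n_gt0 : (0 : R) < n%:R by rewrite ltr0n (leq_ltn_trans _ nn).
  have := n0P n (ltnW nn) => h.
  have nz : (n%:R : R) != 0 by rewrite gt_eqF.
  rewrite distrC; set a := corrected _ _ _ _ in h *.
  have -> : a / n%:R - gamma = (a - n%:R * gamma) / n%:R.
    by rewrite mulrBl [n%:R * gamma]mulrC mulfK.
  rewrite normrM (gtr0_norm (x := n%:R^-1)) ?invr_gt0 // ler_pdivrMr //.
  apply: le_trans (ltW h) _.
  by rewrite mulrC ler_wpM2r // ltW.
have h2 : (wsum phi (nf (walk X n w)) - f (walk X n w)) / n%:R @[n --> \oo] --> (0 : R).
  apply: (@cvg_bounded_div _ _ C) => n; rewrite mulr0 subr0 /= /corrected.
  by rewrite opprD addrA subrr sub0r normrN; exact/CP/(nf_reduced nfP).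
have h3 := cvgD h1 h2; rewrite addr0 in h3.
rewrite (_ : (fun n => wsum phi (nf (walk X n w)) / n%:R) = (fun n => f (walk X n w) / n%:R +
   (wsum phi (nf (walk X n w)) - f (walk X n w)) / n%:R)).
  exact: h3.
by apply/funext => n; rewrite -mulrDl [_ + (_ - _)]addrC subrK.
Qed.

End IID.

Lemma is_driftP (S : set G) : (forall g, (wordlen S g)%:R = wsum phi (nf g)) ->
  is_drift S mu gamma.
Proof.
move=> lenE d Omega Pr X iidX; have := additive_ae_cvg iidX.
apply: filterS => w h.
by rewrite (_ : (fun n => _) = (fun n => wsum phi (nf (walk X n w)) / n%:R)) //;
  apply/funext => n; rewrite lenE.
Qed.

Hypothesis iid_exists : exists (d : measure_display) (Omega : measurableType d)
  (Pr : probability Omega R) (X : nat -> Omega -> G), iid_of_law mu Pr X.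

(** [drift] selects some constant satisfying [is_drift]. Two such constants agree because both are
    almost sure limits on an actual space carrying the increments; without one, every constant would
    qualify vacuously. *)
Lemma driftE (S : set G) : (forall g, (wordlen S g)%:R = wsum phi (nf g)) ->
  drift S mu = gamma.
Proof.
move=> lenE; have dg := is_driftP lenE.
rewrite /drift; case: xgetP => [c cE dc|nd]; last by case: (nd gamma).
have [d [T [Pr [X iidX]]]] := iid_exists.
have a1 := dg _ _ _ _ iidX; have a2 := dc _ _ _ _ iidX.
have : (\forall w \ae Pr, c = gamma).
  by apply: filterS2 a1 a2 => w w1 w2; exact: (cvg_unique _ w2 w1).
rewrite /prop_near1 /= /almost_everywhere.
move=> [A [mA A0 sub]]; apply: contrapT => ne.
have AT : A = setT by apply/seteqP; split=> // w _; exact: (sub w ne).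
move: A0; rewrite AT probability_setT => /eqP.
by rewrite onee_eq0.
Qed.

End Drift.

(** * Independent sequences on the unit interval *)

Section Digits.
Variables (R : realType) (q : nat -> R) (K : nat).
Hypothesis q0 : forall i, 0 <= q i.
Hypothesis q1 : \sum_(i <- iota 0 K) q i = 1.

Definition cumul i := \sum_(j <- iota 0 i) q j.

Definition digit (t : R) := find (fun i => t < cumul i.+1) (iota 0 K).

(* The expanding map whose i-th branch has slope 1 / q i. *)
Definition expand (t : R) := (t - cumul (digit t)) / q (digit t).

Fixpoint code n t := if n is n'.+1 then digit t :: code n' (expand t) else [::].

Lemma cumulS i : cumul i.+1 = cumul i + q i.
Proof. by rewrite /cumul -addn1 iotaD big_cat /= big_seq1. Qed.

Lemma cumul_le i j : (i <= j)%N -> cumul i <= cumul j.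
Proof.
move=> /subnKC <-; elim: (j - i)%N => [|n IH]; first by rewrite addn0.
by rewrite addnS cumulS (le_trans IH) // lerDl.
Qed.

Lemma digit_lt t : t < 1 -> (digit t < K)%N.
Proof.
move=> t1; rewrite /digit -[X in (_ < X)%N](size_iota 0 K) -has_find.
have K0 : (0 < K)%N.
  by case: (K) q1 => //=; rewrite big_nil => /esym/eqP; rewrite oner_eq0.
apply/hasP; exists K.-1; first by rewrite mem_iota add0n prednK ?leqnn.
by rewrite prednK //; move: q1; rewrite /cumul => ->.
Qed.

Lemma digitE t i : 0 <= t < 1 -> (i < K)%N ->
  (digit t == i) = (cumul i <= t < cumul i.+1).
Proof.
move=> /andP[t0 t1] iK; have dK := digit_lt t1.
have up : t < cumul (digit t).+1.
  have := nth_find 0%N (a := fun i => t < cumul i.+1) (s := iota 0 K).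
  by rewrite has_find size_iota -/(digit t) dK nth_iota // add0n => ->.
have lo j : (j < digit t)%N -> cumul j.+1 <= t.
  move=> jd; have := before_find 0%N jd.
  by rewrite nth_iota ?add0n ?(ltn_trans jd) // => /negbT; rewrite -leNgt.
apply/eqP/andP => [<-|[ci ci1]].
  split=> //; case E : (digit t) => [|j]; first by rewrite /cumul big_nil.
  by apply: lo; rewrite E.
apply/eqP; rewrite eqn_leq; apply/andP; split; rewrite leqNgt; apply/negP => h.
  by have := lo _ h; rewrite leNgt ci1.
by have := lt_le_trans up (cumul_le h); rewrite ltNge ci.
Qed.

Fixpoint low s := if s is i :: s' then cumul i + q i * low s' else 0.
Definition width (s : seq nat) := \prod_(i <- s) q i.

Lemma width_ge0 s : 0 <= width s.
Proof. by apply: prodr_ge0. Qed.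

Lemma low_bound s : all (fun i => (i < K)%N) s -> 0 <= low s /\ low s + width s <= 1.
Proof.
elim: s => [|i s IH] /=; first by rewrite /width big_nil add0r.
case/andP=> iK /IH[l0 l1]; rewrite /width big_cons -/(width s).
split; first by rewrite addr_ge0 ?mulr_ge0 // /cumul sumr_ge0.
have ci : cumul i + q i <= 1.
  by rewrite -cumulS (le_trans (cumul_le iK)) // /cumul q1.
rewrite -addrA -mulrDr; apply: le_trans ci; rewrite lerD2l.
by rewrite -[X in _ <= X]mulr1 ler_wpM2l.
Qed.

(** On the branch of digit [i] the map [expand] is affine of slope [1 / q i], so the interval of [s]
    pulls back to an interval shrunk by [q i] and shifted by [cumul i]. *)
Lemma codeE s t : all (fun i => (i < K)%N) s -> 0 <= t < 1 ->
  (code (size s) t == s) = (low s <= t < low s + width s).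
Proof.
elim: s t => [|i s IH] t /=; first by move=> _ t01; rewrite /width big_nil add0r t01.
move=> /andP[iK sK] t01; rewrite eqseq_cons (digitE t01 iK).
have [l0 l1] := low_bound sK; have w0 := width_ge0 s.
rewrite /width big_cons -/(width s).
case: (boolP (cumul i <= t < cumul i.+1)) => /= [ti|ti]; last first.
  apply/esym/negbTE; apply: contra ti => /andP[a b]; apply/andP; split.
    by apply: le_trans a; rewrite lerDl mulr_ge0.
  rewrite cumulS; apply: lt_le_trans b _; rewrite -addrA -mulrDr lerD2l.
  by rewrite -[X in _ <= X]mulr1 ler_wpM2l.
have di : digit t = i by apply/eqP; rewrite digitE.
move: ti; rewrite cumulS => /andP[ti1 ti2].
(* A branch that contains a point has positive length, so the division in [expand] is a genuine one
   even though some weights may be 0. *)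
have qi : 0 < q i by have := q0 i; lra.
have ex : 0 <= expand t < 1.
  by rewrite /expand di divr_ge0 ?subr_ge0 //= ltr_pdivrMr // mul1r ltrBlDl.
rewrite (IH _ sK ex) /expand di ler_pdivlMr // ltr_pdivrMr //.
rewrite [_ * q i]mulrC [(low s + _) * _]mulrC.
by rewrite lerBrDl ltrBlDl mulrDr addrA.
Qed.

Lemma code_all n t : 0 <= t < 1 -> all (fun i => (i < K)%N) (code n t).
Proof.
elim: n t => //= n IH t t01; have dK : (digit t < K)%N.
  by apply: digit_lt; case/andP: t01.
rewrite dK /=; apply: IH.
have := digitE t01 dK; rewrite eqxx => /esym/andP[]; rewrite cumulS => t1 t2.
have qi : 0 < q (digit t) by have := q0 (digit t); lra.
by rewrite /expand divr_ge0 ?subr_ge0 //= ltr_pdivrMr // mul1r ltrBlDl.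
Qed.

Definition nth_digit n t := digit (iter n expand t).

Lemma codeS n t : code n.+1 t = rcons (code n t) (nth_digit n t).
Proof.
elim: n t => // n IH t.
rewrite -[LHS]/(digit t :: code n.+1 (expand t)) IH.
by rewrite -[code n.+1 t]/(digit t :: code n (expand t)) rcons_cons /nth_digit iterSr.
Qed.

Lemma nth_digit_lt n t : 0 <= t < 1 -> (nth_digit n t < K)%N.
Proof. by move=> /(code_all n.+1); rewrite codeS all_rcons => /andP[]. Qed.

Variable Pr : probability (measurableTypeR R) R.
Hypothesis PrE : forall a b : R, 0 <= a -> a <= b -> b <= 1 ->
  Pr `[a, b[%classic = (b - a)%:E.

Definition event u n (B : nat -> pred nat) : set R :=
  [set t | 0 <= t < 1 /\ code (size u) t = u /\
     forall k, (k < n)%N -> B k (nth_digit (size u + k) t)].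

(** Splitting according to the next digit moves the condition [B 0] into the prefix [u], with one
    condition fewer on the remaining digits; without conditions the event is an interval of length
    [width u]. *)
Lemma event_prob u n B : all (fun i => (i < K)%N) u ->
  measurable (event u n B) /\
  Pr (event u n B) =
  (width u * \prod_(k <- iota 0 n) \sum_(i <- iota 0 K | B k i) q i)%:E.
Proof.
elim: n u B => [|n IH] u B uK.
  have [l0 l1] := low_bound uK.
  have -> : event u 0 B = `[low u, low u + width u[%classic.
    apply/seteqP; split=> [t [t01 [/eqP cu _]]|t /=].
      by rewrite /= in_itv /= -codeE.
    rewrite in_itv /= => tu.
    have t01 : 0 <= t < 1.
      by case/andP: tu => a b; rewrite (le_trans l0 a) (lt_le_trans b l1).
    by split=> //; split=> //; apply/eqP; rewrite codeE.
  split; first exact: measurable_itv.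
  rewrite PrE ?lerDl ?width_ge0 //; congr (_%:E).
  by rewrite big_nil mulr1 addrAC subrr add0r.
pose B' k := B k.+1.
have evE : event u n.+1 B = \big[setU/set0]_(i <- iota 0 K | B 0%N i) event (rcons u i) n B'.
  rewrite -bigcup_seq_cond; apply/seteqP; split=> t.
    case=> t01 [cu Bt]; exists (nth_digit (size u) t).
      rewrite /= mem_iota add0n nth_digit_lt //=.
      by have := Bt 0%N isT; rewrite addn0 => ->.
    split=> //; split; first by rewrite size_rcons codeS cu.
    by move=> k kn; rewrite size_rcons addSnnS; exact: Bt.
  case=> i /= /andP[_ B0i] [t01 []]; rewrite size_rcons codeS => /eqP.
  rewrite eqseq_rcons => /andP[/eqP cu /eqP di] Bt.
  split=> //; split=> // -[_|k kn]; first by rewrite addn0 di.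
  by have := Bt k kn; rewrite addSnnS.
have mev i : (i < K)%N -> measurable (event (rcons u i) n B').
  by move=> iK; apply: (IH _ B' _).1; rewrite all_rcons iK.
split.
  rewrite evE big_seq_cond; apply: bigsetU_measurable => i /andP[].
  by rewrite mem_iota => /= iK _; exact: mev.
have sumP : forall s, uniq s -> all (fun i => (i < K)%N) s ->
    Pr (\big[setU/set0]_(i <- s | B 0%N i) event (rcons u i) n B') =
    (\sum_(i <- s | B 0%N i) width (rcons u i) *
        \prod_(k <- iota 0 n) \sum_(i <- iota 0 K | B' k i) q i)%:E.
  elim=> [|i s IHs] /=; first by rewrite !big_nil measure0.
  case/andP=> is_ us /andP[iK sK]; rewrite !big_cons; case: ifP => Bi; last exact: IHs.
  rewrite EFinD -IHs // -(IH _ B' _).2 ?all_rcons ?iK // measureU //.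
  - exact: mev.
  - rewrite big_seq_cond; apply: bigsetU_measurable => j /andP[js _].
    by apply: mev; exact: (allP sK).
  - apply/seteqP; split=> // t [[_ [ct _]]].
    rewrite -bigcup_seq_cond => -[j /= /andP[js _] [_ [ct' _]]].
    move: ct ct'; rewrite !size_rcons => -> /eqP; rewrite eqseq_rcons => /andP[_ /eqP ij].
    by move: is_; rewrite ij js.
rewrite evE sumP ?iota_uniq //; last by apply/allP => i; rewrite mem_iota.
congr (_%:E); rewrite -mulr_suml /=  big_cons mulrA; congr (_ * _).
  rewrite mulr_sumr; apply: eq_bigr => i _.
  by rewrite /width -cats1 big_cat big_seq1.
by rewrite -[in RHS]add1n iotaDl big_map.
Qed.

End Digits.

Lemma unit_interval_probability (R : realType) : exists Pr : probability (measurableTypeR R) R,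
  forall a b : R, 0 <= a -> a <= b -> b <= 1 -> Pr `[a, b[%classic = (b - a)%:E.
Proof.
exists (@uniform_prob R 0 1 ltr01 : probability (measurableTypeR R) R) => a b a0 ab b1.
change (\int[lebesgue_measure]_(x in `[a, b[%classic) (uniform_pdf 0 1 x)%:E = (b - a)%:E)%E.
rewrite (eq_integral (fun=> 1%:E)).
  rewrite integral_cst //= mul1e lebesgue_measure_itv /= lte_fin.
  by case: ltP => // ba; rewrite (@le_anti _ _ a b) ?ab // subrr.
move=> x; rewrite inE /= in_itv /= => /andP[ax xb].
by rewrite /uniform_pdf (le_trans a0 ax) (ltW (lt_le_trans xb b1)) subr0 invr1.
Qed.

Lemma iid_exists (R : realType) (G : groupType) (mu : G -> R) (s : seq G) :
  uniq s -> (forall g, 0 <= mu g) -> (forall g, g \notin s -> mu g = 0) ->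
  \sum_(g <- s) mu g = 1 ->
  exists (d : measure_display) (Omega : measurableType d)
    (Pr : probability Omega R) (X : nat -> Omega -> G), iid_of_law mu Pr X.
Proof.
move=> us mu0 mus mu1; have [Pr PrE] := unit_interval_probability R.
pose K := size s; pose q i := mu (nth 1%g s i).
have q0 i : 0 <= q i by exact: mu0.
have sumq (A : pred G) : \sum_(i <- iota 0 K | A (nth 1%g s i)) q i = \sum_(g <- s | A g) mu g.
  by rewrite [RHS](big_nth 1%g) /index_iota subn0.
have q1 : \sum_(i <- iota 0 K) q i = 1 by rewrite -mu1 -[RHS](sumq predT).
(* The measure lives on [[0, 1[]. The constant value elsewhere keeps all preimages measurable and
   concerns a null set. *)
pose X n t : G := if 0 <= t < 1 then nth 1%g s (nth_digit q K n t) else 1%g.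
(* Positions outside [J] carry no condition and contribute the total mass 1, so the product formula
   for [N] consecutive digits covers every finite family of indices. *)
pose B (J : pred nat) (A : nat -> set G) k i := J k ==> `[< A k (nth 1%g s i) >].
pose I01 : set R := [set t | 0 <= t < 1].
have I01E : I01 = `[0, 1[%classic by apply/seteqP; split=> t /=; rewrite in_itv.
have PrI : Pr (~` I01) = 0%E.
  by rewrite probability_setC I01E ?PrE // subr0 subee.
have evE (J : pred nat) A N : event q K [::] N (B J A) =
    [set t | I01 t /\ forall k, (k < N)%N -> J k -> A k (X k t)].
  apply/seteqP; split=> t [t01]; rewrite /X.
    case=> _ h; split=> // k kN Jk; rewrite t01.
    by have := h k kN; rewrite add0n /B Jk => /asboolP.
  move=> h; split=> //; split=> // k kN; rewrite add0n /B.
  by apply/implyP => Jk; apply/asboolP; have := h k kN Jk; rewrite t01.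
have evP J A N := event_prob q0 q1 PrE N (B J A) (u := [::]) isT.
have preE n A : X n @^-1` A = event q K [::] n.+1 (B (pred1 n) (fun=> A)) `|`
     (~` I01 `&` [set t | A 1%g]).
  rewrite evE; apply/seteqP; split=> t /=.
    rewrite /X; case: ifP => t01 At; last by right; split=> //; rewrite /setC /I01 /= t01.
    by left; split=> // k _ /eqP ->.
  case=> [[_ h]|[nt At]]; first exact: (h n).
  by rewrite /X; case: ifP => // t01; case: nt.
have mI : measurable I01 by rewrite I01E; exact: measurable_itv.
have mI1 A : measurable (~` I01 `&` [set t | A 1%g]).
  case: (pselect (A 1%g)) => h.
    rewrite (_ : [set t | _] = setT) ?setIT; first exact: measurableC.
    by apply/seteqP; split.
  by rewrite (_ : [set t | _] = set0) ?setI0 //; apply/seteqP; split.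
have mX n A : measurable (X n @^-1` A).
  rewrite preE; apply: measurableU; first exact: (evP _ _ _).1.
  exact: mI1.
have trunc (E : set R) : measurable E -> Pr E = Pr (E `&` I01).
  move=> mE; rewrite -[in LHS](setIT E) -(setvU I01) setIUr measureU.
  - rewrite [X in (X + _)%E](_ : _ = 0%E) ?add0e //.
    apply/eqP; rewrite -measure_le0 -PrI; apply: le_measure; rewrite ?inE.
    + by apply: measurableI => //; exact: measurableC.
    + exact: measurableC.
    + exact: subIsetr.
  - by apply: measurableI => //; exact: measurableC.
  - exact: measurableI.
  - by rewrite setIACA setICl setI0.
have Xprob n A : Pr (X n @^-1` A) = (\sum_(i <- iota 0 K | `[< A (nth 1%g s i) >]) q i)%:E.
  rewrite trunc //.
  have -> : X n @^-1` A `&` I01 = event q K [::] n.+1 (B (pred1 n) (fun=> A)).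
    rewrite evE; apply/seteqP; split=> t /=.
      by case=> At t01; split=> // k _ /eqP ->.
    by case=> t01 h; split=> //; exact: (h n).
  rewrite (evP _ _ _).2 /width big_nil mul1r; congr (_%:E).
  rewrite -addn1 iotaD big_cat /= big_seq1 add0n /B /= eqxx.
  rewrite big_seq big1 ?mul1r // => k; rewrite mem_iota add0n => /andP[_ kn].
  by rewrite ltn_eqF.
exists _, _, Pr, X; split=> // [n g|J A].
  rewrite Xprob; congr (_%:E).
  rewrite (eq_bigl (fun i => nth 1%g s i == g)); last first.
    by move=> i; apply/asboolP/eqP.
  rewrite (sumq (fun h => h == g)).
  have [gs|gs] := boolP (g \in s).
    rewrite (big_rem g gs) eqxx /= big_seq_cond big1 ?addr0 // => h /andP[hs /eqP hg].
    by move: hs; rewrite hg mem_rem_uniq // inE eqxx.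
  rewrite mus // big_seq_cond big1 // => h /andP[hs /eqP hg].
  by rewrite -hg hs in gs.
have [N JN] : exists N, forall k, k \in J -> (k < N)%N.
  by exists (\max_(k <- J) k).+1 => k kJ; rewrite ltnS leq_bigmax_seq.
have mcap : measurable (\bigcap_(k in [set` J]) X k @^-1` A k).
  by apply: fin_bigcap_measurable => // k _; exact: mX.
rewrite trunc //.
have -> : \bigcap_(k in [set` J]) X k @^-1` A k `&` I01 =
    event q K [::] N (B (mem J) A).
  rewrite evE; apply/seteqP; split=> t /=.
    by case=> h t01; split=> // k _ kJ; exact: h.
  by case=> t01 h; split=> // k kJ; apply: h => //; exact: JN.
rewrite (evP _ _ _).2 /width big_nil mul1r.
under [RHS]eq_bigr do rewrite Xprob.
rewrite prodEFin; congr (_%:E).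
rewrite (bigID (fun k => k \in J)) /= [X in _ * X]big1 ?mulr1; last first.
  move=> k kJ; rewrite -q1; apply: eq_bigl => i.
  by rewrite /B /= (negbTE kJ).
rewrite -big_filter; apply: etrans (perm_big _ _) _; last first.
  by apply: eq_big_seq => k kJ; apply: eq_bigl => i; rewrite /B /= kJ.
apply: uniq_perm; first exact/filter_uniq/(iota_uniq 0 N).
  exact: fset_uniq.
move=> k; rewrite mem_filter mem_iota add0n /=; case: (boolP (k \in J)) => //= kJ.
by rewrite JN.
Qed.

(** * Word length and volume *)

Section Length.
Variables (P : finGroupType) (H : bool -> {group P}).
Hypothesis tiH : forall x, x \in H true -> x \in H false -> x = 1%g.
Variables (G : groupType) (iota_ : P -> G) (nf : G -> seq P).
Hypothesis nfP : normal_form_map H iota_ nf.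
Variables (S : set G) (ell : P -> nat).

(** [ell_step] lets a generator raise the length of the last letter by at most one, which bounds
    word length from below; [ell_word] spells out each letter and bounds it from above. *)
Record letter_length : Prop := LetterLength {
  ell1 : ell 1%g = 0%N;
  ell_gt0 : forall c x, x \in H c -> x != 1%g -> (0 < ell x)%N;
  ell_step : forall s, S s -> exists c x, [/\ x \in H c, s = iota_ x &
    forall y, y \in H c -> (ell (y * x)%g <= (ell y).+1)%N];
  ell_word : forall c x, x \in H c -> is_word S (ell x) (iota_ x) }.

Hypothesis ellP : letter_length.

Definition wlen w := (\sum_(x <- w) ell x)%N.

Lemma wlen_push x w : wlen (push x w) = (ell x + wlen w)%N.
Proof.
rewrite /push; case: eqVneq => [->|_]; first by rewrite (ell1 ellP).
by rewrite /wlen big_cons.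
Qed.

Lemma wlen_step g s : S s -> (wlen (nf (g * s)%g) <= (wlen (nf g)).+1)%N.
Proof.
case/(ell_step ellP) => c [x [xc -> le]].
have [y [w [yc aw gE]]] := nf_split nfP c g.
rewrite (nf_push tiH nfP yc aw xc gE) gE !wlen_push -addSn leq_add2r.
exact: le.
Qed.

Lemma wlen_le_word n g : is_word S n g -> (wlen (nf g) <= n)%N.
Proof.
case=> s [<- Ss <-]; elim/last_ind: s Ss => [|s x IH] Ss.
  by rewrite big_nil (nf1 nfP) /wlen big_nil.
rewrite big_rcons /= size_rcons.
apply: leq_trans (wlen_step _ _) _; first by apply: Ss; rewrite mem_rcons mem_head.
by rewrite ltnS; apply: IH => y ys; apply: Ss; rewrite mem_rcons inE ys orbT.
Qed.

Lemma is_word_mul n1 n2 g1 g2 : is_word S n1 g1 -> is_word S n2 g2 ->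
  is_word S (n1 + n2) (g1 * g2)%g.
Proof.
case=> s1 [<- S1 <-] [s2 [<- S2 <-]]; exists (s1 ++ s2).
split; rewrite ?size_cat ?big_cat //.
by move=> x; rewrite mem_cat => /orP[/S1|/S2].
Qed.

Lemma is_word_wlen g : is_word S (wlen (nf g)) g.
Proof.
have [g' gE gw] : exists2 g', nf g' = nf g & is_word S (wlen (nf g)) g'.
  elim: (nf g) (nf_reduced nfP g) => [_|x w IH].
    exists 1%g; first exact: nf1 nfP.
    by exists [::]; rewrite /wlen !big_nil; split.
  move=> /(reduced_cons tiH)[rw xw [c xc]]; have [g' gE gw] := IH rw.
  exists (g' * iota_ x)%g; first by rewrite (nf_mul nfP _ xc) gE.
  by rewrite /wlen big_cons addnC; apply: is_word_mul => //; exact: ell_word ellP _ _ xc.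
by rewrite -{2}(nf_inj nfP gE).
Qed.

Lemma wordlenE g : wordlen S g = wlen (nf g).
Proof.
rewrite /wordlen; case: xgetP => [n nE [nw nmin]|/(_ (wlen (nf g)))].
  apply/eqP; rewrite eqn_leq; apply/andP; split; first exact/nmin/is_word_wlen.
  exact: wlen_le_word.
by case; split; [exact: is_word_wlen|move=> k; exact: wlen_le_word].
Qed.

End Length.

(** * Exponential growth of the balls *)

Section Volume.
Variables (R : realType) (P : finGroupType) (H : bool -> {group P}).
Hypothesis tiH : forall x, x \in H true -> x \in H false -> x = 1%g.
Variables (G : groupType) (iota_ : P -> G) (nf : G -> seq P).
Hypothesis nfP : normal_form_map H iota_ nf.
Variables (S : set G) (ell : P -> nat).
Hypothesis ellP : letter_length H iota_ S ell.
Variable t : R.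
Hypothesis t01 : 0 < t < 1.
Hypothesis tS : \prod_(c : bool) \sum_(x in H c | x != 1%g) t ^+ ell x = 1.

Local Notation W c := (\sum_(x in H c | x != 1%g) t ^+ ell x).
Local Notation wlen := (wlen ell).

Lemma t_gt0 : 0 < t. Proof. by case/andP: t01. Qed.

Lemma wprod_wlen w : wprod (fun x => t ^+ ell x) w = t ^+ wlen w.
Proof.
elim: w => [|x w IH]; first by rewrite /wprod /wlen !big_nil.
by rewrite /wprod big_cons -/(wprod _ w) IH /wlen big_cons exprD.
Qed.

Lemma size_le_wlen w : reduced H w -> (size w <= wlen w)%N.
Proof.
elim: w => //= x w IH rw; have [rw' _ [c xc]] := reduced_cons tiH rw.
have x1 : x != 1%g by case/reducedP: rw => d /= /and3P[].
by rewrite /wlen big_cons -add1n leq_add ?(ell_gt0 ellP xc) // IH.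
Qed.

Lemma many_words : exists kappa : bool -> R, (forall c, 0 < kappa c) /\
  forall n c, exists s : seq (seq P), [/\ uniq s,
    forall w, w \in s -> alt_word H c w /\ (wlen w <= n)%N &
    kappa c <= (size s)%:R * t ^+ n].
Proof.
have tge0 := ltW t_gt0; have t1 : t <= 1 by case/andP: t01 => _ /ltW.
pose M := (\sum_x ell x)%N.
have W0 c : 0 <= W c by apply: sumr_ge0 => x _; rewrite exprn_ge0.
have WM c : W c * W (~~ c) = 1.
  by move: tS; rewrite big_bool; case: c => //=; rewrite mulrC.
pose D := 2 + W true + W false.
have D0 : 0 < D by have := W0 true; have := W0 false; rewrite /D; lra.
exists (fun c => t ^+ M / D * (1 + W c)); split.
  by move=> c; rewrite !mulr_gt0 ?invr_gt0 ?exprn_gt0 ?t_gt0 //; have := W0 c; lra.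
move=> n; have [k] := ubnP n; elim: k n => // k IH n nk c.
have [nM|Mn] := ltnP n M.+1.
  exists [:: [::]]; split=> //; first by move=> w; rewrite inE => /eqP ->; rewrite /wlen big_nil.
  rewrite mul1r; apply: le_trans (_ : t ^+ M <= _); last first.
    by rewrite ler_wiXn2l // -ltnS.
  rewrite -mulrA ler_piMr ?exprn_ge0 // ler_pdivrMl // mulr1 /D.
  by have := W0 true; have := W0 false; case: (c); lra.
pose A := [seq x <- enum P | (x \in H c) && (x != 1%g)].
have lM x : (ell x <= M)%N by rewrite /M (bigD1 x) //= leq_addr.
have ex x : exists s : seq (seq P), x \in A -> [/\ uniq s,
    forall w, w \in s -> alt_word H (~~ c) w /\ (wlen w <= n - ell x)%N &
    t ^+ M / D * (1 + W (~~ c)) <= (size s)%:R * t ^+ (n - ell x)].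
  have [xA|_] := boolP (x \in A); last by exists [::].
  move: xA; rewrite mem_filter => /andP[/andP[xc x1] _].
  have lt : (n - ell x < k)%N.
    have := ell_gt0 ellP xc x1; have := lM x; move: nk Mn.
    rewrite ltnS => nk Mn l1 l2; apply: leq_trans nk.
    by rewrite ltn_subrL l2 (leq_trans _ Mn).
  by have [s sP] := IH _ lt (~~ c); exists s.
have [s sP] := choice ex.
exists [seq x :: w | x <- A, w <- s x]; split.
- apply: allpairs_uniq_dep; first by rewrite filter_uniq ?enum_uniq.
    by move=> x /sP[].
  by move=> [x w] [y v] _ _ /= [-> ->].
- move=> w /allpairsPdep[x [v [xA vs ->]]].
  have [_ /(_ _ vs)[av vn] _] := sP _ xA.
  move: (xA); rewrite mem_filter => /andP[/andP[xc x1] _].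
  split; first by rewrite /= xc x1.
  rewrite /wlen big_cons -leq_subRL ?(leq_trans (lM x)) // ltnW //.
- rewrite size_allpairs_dep sumnE big_map natr_sum mulr_suml.
  apply: le_trans (_ : \sum_(x <- A) t ^+ ell x * (t ^+ M / D * (1 + W (~~ c))) <= _).
    rewrite -mulr_suml big_filter big_enum_cond /=.
    move: (WM c) => uv; rewrite le_eqVlt; apply/orP; left; apply/eqP.
    move: uv; set u := W c; set v := W (~~ c) => uv.
    by rewrite [RHS]mulrCA [u * _]mulrDr mulr1 uv [u + 1]addrC.
  rewrite big_seq [X in _ <= X]big_seq; apply: ler_sum => x xA.
  have [_ _ le] := sP _ xA.
  have -> : t ^+ n = t ^+ ell x * t ^+ (n - ell x).
    by rewrite -exprD subnKC // (leq_trans (lM x)) // ltnW.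
  by rewrite [X in _ <= X]mulrCA ler_wpM2l ?exprn_ge0.
Qed.

Local Notation ball n := [set g : G | (wordlen S g <= n)%N].

Lemma ball_finite n : finite_set (ball n).
Proof.
apply: (@sub_finite_set _ _ (nf @^-1` [set` words H true n ++ words H false n])).
  move=> g /=; rewrite (wordlenE tiH nfP ellP) => gn; rewrite mem_cat.
  have rg := nf_reduced nfP g; have sn := leq_trans (size_le_wlen rg) gn.
  by case/orP: rg => ag; rewrite (mem_words ag sn) ?orbT.
by apply: finite_preimage => // x y _ _; exact: nf_inj nfP x y.
Qed.

(** The size of the ball of radius [n] times [t ^+ n] lies between a positive constant and a linear
    function of [n]. *)
Lemma volumeE : volume R S = - ln t.
Proof.
apply/cvg_lim => //.
have [C [C0 CP]] := sum_reduced_le (H := H) (F := fun x => t ^+ ell x)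
  (fun x => exprn_gt0 _ t_gt0) tS.
have [a [a0 aP]] := ln_linear_over_n C0.
have [kappa [k0 kP]] := many_words.
have lo : (ln (kappa true) + n%:R * - ln t) / n%:R @[n --> \oo] --> - ln t.
  apply: (@cvg_bounded_div _ _ `|ln (kappa true)|) => n.
  by rewrite addrK.
have hi : - ln t + a n @[n --> \oo] --> - ln t.
  by rewrite -[X in _ --> X]addr0; apply: cvgD => //; exact: cvg_cst.
apply: squeeze_cvgr lo hi; exists 1%N => // n /= n1.
have n0 : (0 : R) < n%:R by rewrite ltr0n.
set b := #|` _|.
have lower : kappa true <= b%:R * t ^+ n.
  have [s [us sP /le_trans]] := kP n true; apply.
  rewrite ler_wpM2r ?exprn_ge0 ?(ltW t_gt0) // ler_nat.
  have [h hP] : exists h : seq P -> G, forall w, w \in s -> nf (h w) = w.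
    have [h hP] : exists h : seq P -> G, forall w, reduced H w -> nf (h w) = w.
      have ex w : exists g, reduced H w -> nf g = w.
        have [rw|_] := boolP (reduced H w); last by exists 1%g.
        by have [g gE] := nf_surj nfP rw; exists g.
      by have [h hP] := choice ex; exists h.
    by exists h => w /sP[/reduced_alt_word rw _]; exact: hP.
  rewrite -(size_map h); apply: uniq_leq_size.
    by rewrite map_inj_in_uniq // => w v /hP wE /hP vE e; rewrite -wE e vE.
  move=> g /mapP[w ws ->]; rewrite in_fset_set ?inE /=; last exact: ball_finite.
  by rewrite (wordlenE tiH nfP ellP) (hP _ ws); case: (sP _ ws).
have upper : b%:R * t ^+ n <= C * n.+1%:R.
  have inb g : g \in fset_set (ball n) -> (wlen (nf g) <= n)%N.
    rewrite in_fset_set ?inE /=; last exact: ball_finite.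
    by rewrite (wordlenE tiH nfP ellP).
  apply: le_trans (_ : \sum_(g <- fset_set (ball n)) t ^+ wlen (nf g) <= _).
    rewrite /b mulr_natl -iter_addr_0 -count_predT -big_const_seq big_seq [X in _ <= X]big_seq.
    apply: ler_sum => g /inb gn.
    by rewrite ler_wiXn2l ?(ltW t_gt0) //; case/andP: t01 => _ /ltW.
  under eq_bigr do rewrite -wprod_wlen.
  have := CP n [seq nf g | g <- fset_set (ball n)]; rewrite big_map; apply.
    by rewrite map_inj_uniq ?fset_uniq //; exact: nf_inj nfP.
  move=> w /mapP[g gb ->]; have rg := nf_reduced nfP g; split=> //.
  exact: leq_trans (size_le_wlen rg) (inb g gb).
have b0 : (0 : R) < b%:R.
  by rewrite -(pmulr_lgt0 _ (exprn_gt0 n t_gt0)) (lt_le_trans (k0 true)).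
have lnbt : ln (b%:R * t ^+ n) = ln b%:R + n%:R * ln t.
  by rewrite lnM ?posrE ?exprn_gt0 ?t_gt0 // lnXn ?t_gt0 // mulr_natl.
have := lower; rewrite -ler_ln ?posrE ?mulr_gt0 ?exprn_gt0 ?t_gt0 // lnbt => l1.
have := upper; rewrite -ler_ln ?posrE ?mulr_gt0 ?exprn_gt0 ?t_gt0 // lnbt => l2.
apply/andP; split; first by rewrite ler_pM2r ?invr_gt0 //; lra.
apply: le_trans (_ : - ln t + ln (C * n.+1%:R) / n%:R <= _); last by rewrite lerD2l aP.
rewrite ler_pdivrMr // mulrDl divfK ?gt_eqF //; lra.
Qed.

End Volume.

(** * Assembling two factors *)

Section FactorData.
Variables (R : realType) (A : finGroupType).

(* M is the probability that a step into the other factor is eventually undone. *)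
Record factor_green (m F : A -> R) (M : R) : Prop := FactorGreen {
  fg1 : F 1%g = 1;
  fg_gt0 : forall x, 0 < F x;
  fg_lt1 : forall x, x != 1%g -> F x < 1;
  fg_harmonic : forall y, y != 1%g ->
    \sum_x m x * F (y * x)%g + M * F y = F y }.

Record factor_drift (m phi k : A -> R) (M : R) : Prop := FactorDrift {
  fd_phi1 : phi 1%g = 0;
  fd_k1 : k 1%g = 0;
  fd_eq : forall y,
    \sum_x m x * (phi (y * x)%g + k (y * x)%g) - (\sum_x m x) * phi y -
      (1 - M) * k y = \sum_x m x * (phi x + k x) }.

Record factor_weights (m : A -> R) : Prop := FactorWeights {
  fw_ge0 : forall x, 0 <= m x;
  fw_one : m 1%g = 0;
  fw_sym : forall x, m x^-1%g = m x }.

Record factor_length (G : groupType) (i : A -> G) (S : set G) (ell : A -> nat) : Prop :=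
  FactorLength {
  fl1 : ell 1%g = 0%N;
  fl_gt0 : forall x, x != 1%g -> (0 < ell x)%N;
  fl_word : forall x, is_word S (ell x) (i x) }.

End FactorData.

Section Assemble.
Variables (R : realType) (A B : finGroupType).
Local Notation P := (A * B)%type.
Local Notation H := (@free_factor A B).

Definition lift2 (T : Type) (u : A -> T) (v : B -> T) (x : P) : T :=
  if x.2 == 1%g then u x.1 else v x.2.

Lemma lift2l T (u : A -> T) (v : B -> T) a : lift2 u v (a, 1%g) = u a.
Proof. by rewrite /lift2 eqxx. Qed.

Lemma lift2r T (u : A -> T) (v : B -> T) b : u 1%g = v 1%g ->
  lift2 u v (1%g, b) = v b.
Proof. by rewrite /lift2 /=; case: eqVneq => // ->. Qed.

Lemma sum_factor (c : bool) (Q : pred P) (u : P -> R) :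
  \sum_(x in H c | Q x) u x =
  if c then \sum_(a | Q (a, 1%g)) u (a, 1%g) else \sum_(b | Q (1%g, b)) u (1%g, b).
Proof.
case: c.
  rewrite (reindex_onto (fun a : A => (a, 1%g) : P) fst) /=; last first.
    by move=> [a b] /andP[]; rewrite factorT /= => /eqP ->.
  by apply: eq_bigl => a; rewrite factorT /= !eqxx andbT.
rewrite (reindex_onto (fun b : B => (1%g, b) : P) snd) /=; last first.
  by move=> [a b] /andP[]; rewrite factorF /= => /eqP ->.
by apply: eq_bigl => b; rewrite factorF /= !eqxx andbT.
Qed.

Lemma sum_factorT (u : P -> R) : \sum_(x in H true) u x = \sum_a u (a, 1%g).
Proof. by have := sum_factor true predT u; under eq_bigl do rewrite andbT. Qed.

Lemma sum_factorF (u : P -> R) : \sum_(x in H false) u x = \sum_b u (1%g, b).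
Proof. by have := sum_factor false predT u; under eq_bigl do rewrite andbT. Qed.

Lemma mulPl (a a' : A) : (((a, 1%g) : P) * (a', 1%g))%g = (a * a', 1)%g.
Proof. by rewrite -[LHS]/((a * a')%g, (1 * 1)%g) mulg1. Qed.

Lemma mulPr (b b' : B) : (((1%g, b) : P) * (1%g, b'))%g = (1, b * b')%g.
Proof. by rewrite -[LHS]/((1 * 1)%g, (b * b')%g) mulg1. Qed.

Variables (mA FA : A -> R) (mB FB : B -> R).
Hypothesis wA : factor_weights mA.
Hypothesis wB : factor_weights mB.
Hypothesis wAB : \sum_a mA a + \sum_b mB b = 1.

Let m := lift2 mA mB.
Let mr b : m (1%g, b) = mB b.
Proof. by apply: lift2r; rewrite (fw_one wA) (fw_one wB). Qed.

Lemma lift_weights : step_weights H m.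
Proof.
split.
- by case=> a b; rewrite /m /lift2 /=; case: ifP => _; rewrite ?(fw_ge0 wA) ?(fw_ge0 wB).
- by rewrite /m lift2l (fw_one wA).
- case=> a b; rewrite /m /lift2 /= invg_eq1.
  by case: ifP => _; rewrite ?(fw_sym wA) ?(fw_sym wB).
- rewrite big_bool /= sum_factorT sum_factorF -wAB; congr (_ + _).
    by apply: eq_bigr => a _; rewrite /m lift2l.
  by apply: eq_bigr => b _; rewrite mr.
Qed.

Hypothesis gA : factor_green mA FA (\sum_b mB b * FB b).
Hypothesis gB : factor_green mB FB (\sum_a mA a * FA a).
Hypothesis gAB1 : \sum_a mA a * FA a + \sum_b mB b * FB b <= 1.
Hypothesis gAB : (\sum_(a | a != 1%g) FA a) * (\sum_(b | b != 1%g) FB b) = 1.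

Let F := lift2 FA FB.
Let Fr b : F (1%g, b) = FB b.
Proof. by apply: lift2r; rewrite (fg1 gA) (fg1 gB). Qed.

Lemma pair_neq1l (a : A) : ((a, 1%g) != (1%g : P)) = (a != 1%g).
Proof. by congr (~~ _); apply/eqP/eqP => [[->]|->]. Qed.

Lemma pair_neq1r (b : B) : ((1%g, b) != (1%g : P)) = (b != 1%g).
Proof. by congr (~~ _); apply/eqP/eqP => [[->]|->]. Qed.

Let MT : \sum_(x in H true) m x * F x = \sum_a mA a * FA a.
Proof. by rewrite sum_factorT; apply: eq_bigr => a _; rewrite /m /F !lift2l. Qed.
Let MF : \sum_(x in H false) m x * F x = \sum_b mB b * FB b.
Proof. by rewrite sum_factorF; apply: eq_bigr => b _; rewrite mr Fr. Qed.

Lemma lift_green : green H m F.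
Proof.
split.
- by rewrite /F lift2l (fg1 gA).
- by case=> a b; rewrite /F /lift2 /=; case: ifP => _; rewrite ?(fg_gt0 gA) ?(fg_gt0 gB).
- case=> [] [a b]; rewrite ?factorT ?factorF /= => /eqP ->.
    by rewrite pair_neq1l /F lift2l => /(fg_lt1 gA).
  by rewrite pair_neq1r Fr => /(fg_lt1 gB).
- by rewrite big_bool /= MT MF.
- case=> [] [a b]; rewrite ?factorT ?factorF => /eqP /= ->.
    rewrite pair_neq1l MF => /(fg_harmonic gA) h; rewrite /F lift2l -[RHS]h; congr (_ + _).
    by rewrite sum_factorT; apply: eq_bigr => x _; rewrite mulPl /m !lift2l.
  rewrite pair_neq1r MT => /(fg_harmonic gB) h; rewrite Fr -[RHS]h; congr (_ + _).
  by rewrite sum_factorF; apply: eq_bigr => x _; rewrite mulPr mr Fr.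
- rewrite big_bool /= -gAB.
  rewrite (sum_factor true (fun x => x != 1%g)) (sum_factor false (fun x => x != 1%g)).
  congr (_ * _).
    by apply: eq_big => [a|a _]; [exact: pair_neq1l|rewrite /F lift2l].
  by apply: eq_big => [b|b _]; [exact: pair_neq1r|rewrite Fr].
Qed.

Lemma lift_drift phiA kA phiB kB :
  factor_drift mA phiA kA (\sum_b mB b * FB b) ->
  factor_drift mB phiB kB (\sum_a mA a * FA a) ->
  additive_drift H m F (lift2 phiA phiB) (lift2 kA kB)
    (\sum_a mA a * (phiA a + kA a) + \sum_b mB b * (phiB b + kB b)).
Proof.
move=> dA dB.
have pr b : lift2 phiA phiB (1%g, b) = phiB b.
  by apply: lift2r; rewrite (fd_phi1 dA) (fd_phi1 dB).
have kr b : lift2 kA kB (1%g, b) = kB b.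
  by apply: lift2r; rewrite (fd_k1 dA) (fd_k1 dB).
split.
- by rewrite lift2l (fd_phi1 dA).
- by rewrite lift2l (fd_k1 dA).
- case=> [] [a b]; rewrite ?factorT ?factorF => /eqP /= ->.
    rewrite MF !sum_factorT !lift2l.
    under eq_bigr do rewrite mulPl /m !lift2l.
    under [X in _ - X * _ - _]eq_bigr do rewrite /m lift2l.
    by under [RHS]eq_bigr do rewrite /m !lift2l; exact: fd_eq dA a.
  rewrite MT !sum_factorF pr kr.
  under eq_bigr do rewrite mulPr mr pr kr.
  under [X in _ - X * _ - _]eq_bigr do rewrite mr.
  by under [RHS]eq_bigr do rewrite mr pr kr; exact: fd_eq dB b.
- rewrite big_bool /= sum_factorT sum_factorF; congr (_ + _).
    by apply: eq_bigr => a _; rewrite /m !lift2l.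
  by apply: eq_bigr => b _; rewrite mr pr kr.
Qed.

Variables (G : groupType) (i : A -> G) (j : B -> G).
Hypothesis free : is_free_product i j.
Local Notation iota_ := (letter_val i j).

Lemma letter_vall a : iota_ (a, 1%g) = i a.
Proof. by case: free => [_ [j1 _] _]; rewrite /letter_val /= j1 mulg1. Qed.

Lemma letter_valr b : iota_ (1%g, b) = j b.
Proof. by case: free => [[i1 _] _ _]; rewrite /letter_val /= i1 mul1g. Qed.

Lemma free_normal_form : exists nf : G -> seq P, normal_form_map H iota_ nf.
Proof.
have [nf [n1 nr ne ns nm]] := normal_form_exists free; exists nf; split=> //.
  by move=> g h e; rewrite -(ne g) e ne.
by move=> w rw; exists (evalw i j w); exact: ns.
Qed.

Section Length.
Variables (S : set G) (ellA : A -> nat) (ellB : B -> nat).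
Hypothesis lA : factor_length i S ellA.
Hypothesis lB : factor_length j S ellB.
Hypothesis Ssub : forall s, S s ->
  (exists a, s = i a /\ forall y, (ellA (y * a)%g <= (ellA y).+1)%N) \/
  (exists b, s = j b /\ forall y, (ellB (y * b)%g <= (ellB y).+1)%N).

Let ell := lift2 ellA ellB.
Let ellr b : ell (1%g, b) = ellB b.
Proof. by apply: lift2r; rewrite (fl1 lA) (fl1 lB). Qed.

Lemma lift_length : letter_length H iota_ S ell.
Proof.
split.
- by rewrite /ell lift2l (fl1 lA).
- case=> [] [a b]; rewrite ?factorT ?factorF => /eqP /= ->.
    by rewrite pair_neq1l /ell lift2l; exact: fl_gt0 lA a.
  by rewrite pair_neq1r ellr; exact: fl_gt0 lB b.
- move=> s /Ssub[[a [-> h]]|[b [-> h]]].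
    exists true, (a, 1%g); rewrite factorT eqxx letter_vall; split=> //.
    move=> [y z]; rewrite factorT => /eqP /= ->.
    by rewrite mulPl /ell !lift2l.
  exists false, (1%g, b); rewrite factorF eqxx letter_valr; split=> //.
  move=> [y z]; rewrite factorF => /eqP /= ->.
  by rewrite mulPr !ellr.
- case=> [] [a b]; rewrite ?factorT ?factorF => /eqP /= ->.
    by rewrite letter_vall /ell lift2l; exact: fl_word lA a.
  by rewrite letter_valr ellr; exact: fl_word lB b.
Qed.

Lemma free_volume (t : R) : 0 < t < 1 ->
  (\sum_(a | a != 1%g) t ^+ ellA a) * (\sum_(b | b != 1%g) t ^+ ellB b) = 1 ->
  volume R S = - ln t.
Proof.
move=> t01 tS; have [nf nfP] := free_normal_form.
apply: (volumeE (@factor_ti A B) nfP lift_length t01).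
rewrite big_bool /= -tS.
rewrite (sum_factor true (fun x => x != 1%g)) (sum_factor false (fun x => x != 1%g)).
congr (_ * _).
  by apply: eq_big => [a|a _]; [exact: pair_neq1l|rewrite /ell lift2l].
by apply: eq_big => [b|b _]; [exact: pair_neq1r|rewrite ellr].
Qed.

Variable mu : G -> R.
Hypothesis muE : forall g, mu g =
  \sum_a mA a * (g == i a)%:R + \sum_b mB b * (g == j b)%:R.

Let muP g : mu g = \sum_(c : bool) \sum_(x in H c) m x * (g == iota_ x)%:R.
Proof.
rewrite muE big_bool /= sum_factorT sum_factorF; congr (_ + _).
  by apply: eq_bigr => a _; rewrite /m lift2l letter_vall.
by apply: eq_bigr => b _; rewrite mr letter_valr.
Qed.

Lemma step_law_iid : exists (d : measure_display) (Omega : measurableType d)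
  (Pr : probability Omega R) (X : nat -> Omega -> G), iid_of_law mu Pr X.
Proof.
have [nf nfP] := free_normal_form; have mP := lift_weights.
have ti := @factor_ti A B.
apply: (@iid_exists _ _ _ [seq iota_ x | x <- letters H]).
- rewrite map_inj_in_uniq ?letters_uniq // => x y.
  by rewrite !mem_letters; exact: (iota_inj nfP).
- move=> g; rewrite muP; apply: sumr_ge0 => c _; apply: sumr_ge0 => x _.
  by rewrite mulr_ge0 ?(step_ge0 mP).
- move=> g gl; rewrite muP (sum_letters ti mP) big_seq big1 // => x xl.
  case: eqVneq => [gx|]; rewrite ?mulr0 //.
  by rewrite gx map_f in gl.
- rewrite big_map -(sum_letters1 ti mP) big_seq [RHS]big_seq; apply: eq_bigr => x.
  by rewrite mem_letters => xl; apply: (mu_letter ti nfP mP muP).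
Qed.

Lemma free_entropy kA kB :
  factor_drift mA (fun a => - ln (FA a)) kA (\sum_b mB b * FB b) ->
  factor_drift mB (fun b => - ln (FB b)) kB (\sum_a mA a * FA a) ->
  entropy mu = \sum_a mA a * (- ln (FA a) + kA a) + \sum_b mB b * (- ln (FB b) + kB b).
Proof.
move=> dA dB; have [nf nfP] := free_normal_form.
apply: (entropyE (@factor_ti A B) nfP lift_weights muP lift_green (k := lift2 kA kB)).
have := lift_drift dA dB; congr additive_drift.
by apply/funext => x; rewrite /F /lift2; case: ifP.
Qed.

Lemma free_drift kA kB :
  factor_drift mA (fun a => (ellA a)%:R) kA (\sum_b mB b * FB b) ->
  factor_drift mB (fun b => (ellB b)%:R) kB (\sum_a mA a * FA a) ->
  drift S mu = \sum_a mA a * ((ellA a)%:R + kA a) + \sum_b mB b * ((ellB b)%:R + kB b).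
Proof.
move=> dA dB; have [nf nfP] := free_normal_form.
apply: (driftE (@factor_ti A B) nfP lift_weights muP lift_green (lift_drift dA dB) step_law_iid).
move=> g; rewrite (wordlenE (@factor_ti A B) nfP lift_length) /wlen natr_sum.
by apply: eq_bigr => x _; rewrite /ell /lift2; case: ifP.
Qed.

End Length.
End Assemble.

(** * Cyclic factors *)

Definition tab (T : Type) n (d : T) (l : seq T) (x : 'Z_n) : T := nth d l x.

Lemma is_word1 (G : groupType) (S : set G) (s : G) : S s -> is_word S 1 s.
Proof.
move=> Ss; exists [:: s]; split=> //; last by rewrite big_seq1.
by move=> x; rewrite inE => /eqP ->.
Qed.

Lemma is_word0 (G : groupType) (S : set G) : is_word S 0 1%g.
Proof. by exists [::]; split=> //; rewrite big_nil. Qed.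

Section Z2.
Definition z20 : 'Z_2 := @Ordinal 2 0 isT.
Definition z21 : 'Z_2 := @Ordinal 2 1 isT.

Lemma Z2_ind (Q : 'Z_2 -> Prop) : Q z20 -> Q z21 -> forall y, Q y.
Proof.
move=> q0 q1 [[|[|//]] h].
  by rewrite (_ : Ordinal h = z20) //; exact: val_inj.
by rewrite (_ : Ordinal h = z21) //; exact: val_inj.
Qed.

Lemma mulZ2 : (z20 * z20 = z20)%g * (z20 * z21 = z21)%g *
  (z21 * z20 = z21)%g * (z21 * z21 = z20)%g * (z20^-1 = z20)%g * (z21^-1 = z21)%g
  * (1%g = z20).
Proof. by do !split; apply: val_inj. Qed.

Variable R : realType.

Lemma sum_Z2 (u : 'Z_2 -> R) : \sum_x u x = u z20 + u z21.
Proof.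
rewrite !big_ord_recl big_ord0 addr0.
by congr (u _ + u _); apply: val_inj.
Qed.

Lemma sum1_Z2 (u : 'Z_2 -> R) : \sum_(x | x != 1%g) u x = u z21.
Proof. by rewrite big_mkcond sum_Z2 /= add0r. Qed.

Variables (w xi M : R).
Hypothesis xi01 : 0 < xi < 1.
Hypothesis wE : w = xi * (1 - M).
Hypothesis w0 : 0 <= w.

Definition stepZ2 : 'Z_2 -> R := tab 0 [:: 0; w].
(** By [wE], [xi = w / (1 - M)] is the probability that the walk, possibly after excursions into the
    other factor that return, moves again inside the coset. With two points this is already the
    hitting probability. *)
Definition hitZ2 : 'Z_2 -> R := tab 0 [:: 1; xi].

Lemma Z2_weights : factor_weights stepZ2.
Proof.
split; first by apply: Z2_ind.
  by rewrite mulZ2.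
by apply: Z2_ind; rewrite mulZ2.
Qed.

Lemma Z2_green : factor_green stepZ2 hitZ2 M.
Proof.
case/andP: xi01 => x0 x1; split.
- by rewrite mulZ2.
- by apply: Z2_ind; rewrite /hitZ2 /tab /=.
- by apply: Z2_ind => //; rewrite /hitZ2 /tab /=.
- apply: Z2_ind => // _; rewrite sum_Z2 !mulZ2 /stepZ2 /hitZ2 /tab /= wE; ring.
Qed.

Lemma Z2_green_sum : \sum_x stepZ2 x * hitZ2 x = w * xi.
Proof. by rewrite sum_Z2 /stepZ2 /hitZ2 /tab /= mul0r add0r. Qed.

Lemma Z2_drift (phi : 'Z_2 -> R) : phi z20 = 0 -> exists k,
  factor_drift stepZ2 phi k M /\
  \sum_x stepZ2 x * (phi x + k x) = w * (1 - xi) / (1 + xi) * phi z21.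
Proof.
move=> p0; case/andP: xi01 => x0 x1; have d : 1 + xi != 0 by rewrite gt_eqF; lra.
(* The solution of [fd_eq] at [z21]; the factor [1 - M] cancels after substituting [wE]. *)
exists (tab 0 [:: 0; - 2 * xi * phi z21 / (1 + xi)]); split.
  split; rewrite ?mulZ2 //; apply: Z2_ind; rewrite !sum_Z2 !mulZ2 p0 /stepZ2 /tab /= wE; field=> //.
rewrite sum_Z2 p0 /stepZ2 /tab /=; field=> //.
Qed.

Lemma Z2_length (G : groupType) (i : 'Z_2 -> G) (S : set G) :
  monoid.monoid_morphism i -> S (i z21) -> factor_length i S (tab 0%N [:: 0; 1]%N).
Proof.
move=> [i1 iM] S1; split; first by rewrite mulZ2.
  by apply: Z2_ind.
apply: Z2_ind; rewrite /tab /=; last exact: is_word1.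
by rewrite -(_ : 1%g = z20) ?i1 ?mulZ2 //; exact: is_word0.
Qed.

Lemma Z2_generator (u : 'Z_2) : generator [set: 'Z_2]%SET u -> u = z21.
Proof.
move=> /eqP gu; move: gu; move: u; apply: Z2_ind => //.
have -> : z20 = 1%g by rewrite mulZ2.
rewrite cycle1 => h; have : z21 \in [set: 'Z_2]%SET by rewrite inE.
by rewrite h inE => /eqP.
Qed.

Lemma Z2_step (x y : 'Z_2) : x = z21 ->
  (tab 0 [:: 0; 1] (y * x)%g <= (tab 0 [:: 0; 1] y).+1)%N.
Proof. by move=> ->; move: y; apply: Z2_ind; rewrite mulZ2. Qed.

End Z2.

Section Z3.
Definition z30 : 'Z_3 := @Ordinal 3 0 isT.
Definition z31 : 'Z_3 := @Ordinal 3 1 isT.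
Definition z32 : 'Z_3 := @Ordinal 3 2 isT.

Lemma Z3_ind (Q : 'Z_3 -> Prop) : Q z30 -> Q z31 -> Q z32 -> forall y, Q y.
Proof.
move=> q0 q1 q2 [[|[|[|//]]] h].
- by rewrite (_ : Ordinal h = z30) //; exact: val_inj.
- by rewrite (_ : Ordinal h = z31) //; exact: val_inj.
- by rewrite (_ : Ordinal h = z32) //; exact: val_inj.
Qed.

Lemma mulZ3 : (z30 * z30 = z30)%g * (z30 * z31 = z31)%g * (z30 * z32 = z32)%g *
  (z31 * z30 = z31)%g * (z31 * z31 = z32)%g * (z31 * z32 = z30)%g *
  (z32 * z30 = z32)%g * (z32 * z31 = z30)%g * (z32 * z32 = z31)%g *
  (z30^-1 = z30)%g * (z31^-1 = z32)%g * (z32^-1 = z31)%g * (1%g = z30).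
Proof. by do !split; apply: val_inj. Qed.

Variable R : realType.

Lemma sum_Z3 (u : 'Z_3 -> R) : \sum_x u x = u z30 + u z31 + u z32.
Proof.
rewrite !big_ord_recl big_ord0 addr0 addrA.
by congr (u _ + u _ + u _); apply: val_inj.
Qed.

Lemma sum1_Z3 (u : 'Z_3 -> R) : \sum_(x | x != 1%g) u x = u z31 + u z32.
Proof. by rewrite big_mkcond sum_Z3 /= add0r. Qed.

Variables (w xi M : R).
Hypothesis xi01 : 0 < xi < 1.
Hypothesis wE : 2 * w = xi * (1 - M).
Hypothesis w0 : 0 <= w.

Definition stepZ3 : 'Z_3 -> R := tab 0 [:: 0; w; w].
(** On the triangle, with survival probability [xi] per step, the common value solves
    [f = xi (1 + f) / 2]. *)
Definition hitZ3 : 'Z_3 -> R := tab 0 [:: 1; xi / (2 - xi); xi / (2 - xi)].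

Lemma Z3_weights : factor_weights stepZ3.
Proof.
split; first by apply: Z3_ind.
  by rewrite mulZ3.
by apply: Z3_ind; rewrite mulZ3.
Qed.

Let wE' : w = xi * (1 - M) / 2.
Proof. by rewrite -wE mulrC mulKf. Qed.

Lemma Z3_green : factor_green stepZ3 hitZ3 M.
Proof.
case/andP: xi01 => x0 x1; have d : 0 < 2 - xi by lra.
have d' : 2 - xi != 0 by rewrite gt_eqF.
have f0 : 0 < xi / (2 - xi) by rewrite divr_gt0.
have f1 : xi / (2 - xi) < 1 by rewrite ltr_pdivrMr // mul1r; lra.
split.
- by rewrite mulZ3.
- by apply: Z3_ind; rewrite /hitZ3 /tab /=.
- by apply: Z3_ind => //; rewrite /hitZ3 /tab /=.
- by apply: Z3_ind => // _; rewrite sum_Z3 !mulZ3 /stepZ3 /hitZ3 /tab /= wE'; field.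
Qed.

Lemma Z3_green_sum : \sum_x stepZ3 x * hitZ3 x = 2 * w * (xi / (2 - xi)).
Proof. by rewrite sum_Z3 /stepZ3 /hitZ3 /tab /=; ring. Qed.

Lemma Z3_drift (phi : 'Z_3 -> R) : phi z30 = 0 -> phi z32 = phi z31 -> exists k,
  factor_drift stepZ3 phi k M /\
  \sum_x stepZ3 x * (phi x + k x) = 2 * w * (1 - xi) / (2 + xi) * (2 * phi z31).
Proof.
move=> p0 p2; case/andP: xi01 => x0 x1; have d : 2 + xi != 0 by rewrite gt_eqF; lra.
pose k1 := - 3 * xi * phi z31 / (2 + xi).
exists (tab 0 [:: 0; k1; k1]); split.
  by split; rewrite ?mulZ3 //; apply: Z3_ind;
     rewrite !sum_Z3 !mulZ3 p0 p2 /stepZ3 /tab /= wE' /k1; field.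
by rewrite sum_Z3 p0 p2 /stepZ3 /tab /= /k1; field.
Qed.

Lemma Z3_length (G : groupType) (i : 'Z_3 -> G) (S : set G) :
  monoid.monoid_morphism i -> S (i z31) -> S (i z32) ->
  factor_length i S (tab 0%N [:: 0; 1; 1]%N).
Proof.
move=> [i1 iM] S1 S2; split; first by rewrite mulZ3.
  by apply: Z3_ind.
apply: Z3_ind; rewrite /tab /=; [|exact: is_word1|exact: is_word1].
by rewrite -(_ : 1%g = z30) ?i1 ?mulZ3 //; exact: is_word0.
Qed.

Lemma Z3_generator (u : 'Z_3) : generator [set: 'Z_3]%SET u -> u = z31 \/ u = z32.
Proof.
move=> /eqP gu; move: gu; move: u; apply: Z3_ind; [|by left|by right].
have -> : z30 = 1%g by rewrite mulZ3.
rewrite cycle1 => h; have : z31 \in [set: 'Z_3]%SET by rewrite inE.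
by rewrite h inE => /eqP.
Qed.

Lemma Z3_step (x y : 'Z_3) : x = z31 \/ x = z32 ->
  (tab 0 [:: 0; 1; 1] (y * x)%g <= (tab 0 [:: 0; 1; 1] y).+1)%N.
Proof. by case=> ->; move: y; apply: Z3_ind; rewrite mulZ3. Qed.

End Z3.

Section Z4.
Definition z40 : 'Z_4 := @Ordinal 4 0 isT.
Definition z41 : 'Z_4 := @Ordinal 4 1 isT.
Definition z42 : 'Z_4 := @Ordinal 4 2 isT.
Definition z43 : 'Z_4 := @Ordinal 4 3 isT.

Lemma Z4_ind (Q : 'Z_4 -> Prop) : Q z40 -> Q z41 -> Q z42 -> Q z43 -> forall y, Q y.
Proof.
move=> q0 q1 q2 q3 [[|[|[|[|//]]]] h].
- by rewrite (_ : Ordinal h = z40) //; exact: val_inj.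
- by rewrite (_ : Ordinal h = z41) //; exact: val_inj.
- by rewrite (_ : Ordinal h = z42) //; exact: val_inj.
- by rewrite (_ : Ordinal h = z43) //; exact: val_inj.
Qed.

Lemma mulZ4 : (z40 * z40 = z40)%g * (z40 * z41 = z41)%g * (z40 * z42 = z42)%g * (z40 * z43 = z43)%g *
  (z41 * z40 = z41)%g * (z41 * z41 = z42)%g * (z41 * z42 = z43)%g * (z41 * z43 = z40)%g *
  (z42 * z40 = z42)%g * (z42 * z41 = z43)%g * (z42 * z42 = z40)%g * (z42 * z43 = z41)%g *
  (z43 * z40 = z43)%g * (z43 * z41 = z40)%g * (z43 * z42 = z41)%g * (z43 * z43 = z42)%g *
  (z40^-1 = z40)%g * (z41^-1 = z43)%g * (z42^-1 = z42)%g * (z43^-1 = z41)%g * (1%g = z40).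
Proof. by do !split; apply: val_inj. Qed.

Variable R : realType.

Lemma sum_Z4 (u : 'Z_4 -> R) : \sum_x u x = u z40 + u z41 + u z42 + u z43.
Proof.
rewrite !big_ord_recl big_ord0 addr0 !addrA.
by congr (u _ + u _ + u _ + u _); apply: val_inj.
Qed.

Lemma sum1_Z4 (u : 'Z_4 -> R) : \sum_(x | x != 1%g) u x = u z41 + u z42 + u z43.
Proof. by rewrite big_mkcond sum_Z4 /= add0r. Qed.

Variables (w xi M : R).
Hypothesis xi01 : 0 < xi < 1.
Hypothesis wE : 2 * w = xi * (1 - M).
Hypothesis w0 : 0 <= w.

Definition stepZ4 : 'Z_4 -> R := tab 0 [:: 0; w; 0; w].
(** On the 4-cycle, with survival probability [xi] per step, the values at distance 1 and 2 solve
    [f1 = xi (1 + f2) / 2] and [f2 = xi f1]. *)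
Definition hitZ4 : 'Z_4 -> R :=
  tab 0 [:: 1; xi / (2 - xi ^+ 2); xi ^+ 2 / (2 - xi ^+ 2); xi / (2 - xi ^+ 2)].

Lemma Z4_weights : factor_weights stepZ4.
Proof.
split; first by apply: Z4_ind.
  by rewrite mulZ4.
by apply: Z4_ind; rewrite mulZ4.
Qed.

Let wE' : w = xi * (1 - M) / 2.
Proof. by rewrite -wE mulrC mulKf. Qed.

Lemma Z4_green : factor_green stepZ4 hitZ4 M.
Proof.
case/andP: xi01 => x0 x1; have xx : xi ^+ 2 < xi by rewrite expr2 gtr_pMr.
have d : 0 < 2 - xi ^+ 2 by lra.
have d' : 2 - xi ^+ 2 != 0 by rewrite gt_eqF.
have q0 : 0 < xi ^+ 2 by rewrite exprn_gt0.
have f0 : 0 < xi / (2 - xi ^+ 2) by rewrite divr_gt0.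
have f1 : xi / (2 - xi ^+ 2) < 1 by rewrite ltr_pdivrMr // mul1r; lra.
have g0 : 0 < xi ^+ 2 / (2 - xi ^+ 2) by rewrite divr_gt0.
have g1 : xi ^+ 2 / (2 - xi ^+ 2) < 1 by rewrite ltr_pdivrMr // mul1r; lra.
split.
- by rewrite mulZ4.
- by apply: Z4_ind; rewrite /hitZ4 /tab /=.
- by apply: Z4_ind => //; rewrite /hitZ4 /tab /=.
- by apply: Z4_ind => // _; rewrite sum_Z4 !mulZ4 /stepZ4 /hitZ4 /tab /= wE'; field.
Qed.

Lemma Z4_green_sum : \sum_x stepZ4 x * hitZ4 x = 2 * w * (xi / (2 - xi ^+ 2)).
Proof. by rewrite sum_Z4 /stepZ4 /hitZ4 /tab /=; ring. Qed.

Lemma Z4_drift (phi : 'Z_4 -> R) : phi z40 = 0 -> phi z43 = phi z41 -> exists k,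
  factor_drift stepZ4 phi k M /\
  \sum_x stepZ4 x * (phi x + k x) =
    w * (1 - xi) / (1 + xi) * (2 * phi z41 + xi * phi z42).
Proof.
move=> p0 p3; case/andP: xi01 => x0 x1; have d : 1 + xi != 0 by rewrite gt_eqF; lra.
(* By symmetry [k] agrees on the two generators, so [fd_eq] has two unknowns. At [z42] it gives
   [- xi * phi z42] directly, and then [k1] follows from [z41]. *)
pose k1 := (xi * (1 - xi) * phi z42 / 2 - 2 * xi * phi z41) / (1 + xi).
exists (tab 0 [:: 0; k1; - xi * phi z42; k1]); split.
  by split; rewrite ?mulZ4 //; apply: Z4_ind;
     rewrite !sum_Z4 !mulZ4 p0 p3 /stepZ4 /tab /= wE' /k1; field.
by rewrite sum_Z4 p0 p3 /stepZ4 /tab /= /k1; field.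
Qed.

Lemma Z4_length (G : groupType) (i : 'Z_4 -> G) (S : set G) :
  monoid.monoid_morphism i -> S (i z41) -> S (i z43) ->
  factor_length i S (tab 0%N [:: 0; 1; 2; 1]%N).
Proof.
move=> [i1 iM] S1 S3; split; first by rewrite mulZ4.
  by apply: Z4_ind.
apply: Z4_ind; rewrite /tab /=; [|exact: is_word1| |exact: is_word1].
  by rewrite -(_ : 1%g = z40) ?i1 ?mulZ4 //; exact: is_word0.
have -> : z42 = (z41 * z41)%g by rewrite mulZ4.
by rewrite iM -[2%N]addn1; apply: is_word_mul; exact: is_word1.
Qed.

Lemma Z4_generator (u : 'Z_4) : generator [set: 'Z_4]%SET u -> u = z41 \/ u = z43.
Proof.
move=> /eqP gu; move: gu; move: u; apply: Z4_ind; [|by left| |by right].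
  have -> : z40 = 1%g by rewrite mulZ4.
  rewrite cycle1 => h; have : z41 \in [set: 'Z_4]%SET by rewrite inE.
  by rewrite h inE => /eqP.
move=> h; have : z41 \in [set: 'Z_4]%SET by rewrite inE.
rewrite h => /cycleP[n]; have [k [|] ->] : exists k : nat, n = k.*2 \/ n = k.*2.+1.
- by exists n./2; rewrite -[n in n = _]odd_double_half -[n in _ \/ n = _]odd_double_half; case: odd; [right|left].
- by rewrite -mul2n expgM expgS expg1 mulZ4 -(_ : 1%g = z40) ?expg1n ?mulZ4.
- by rewrite expgS -mul2n expgM expgS expg1 !mulZ4 -(_ : 1%g = z40) ?expg1n ?mulg1 ?mulZ4.
Qed.

Lemma Z4_step (x y : 'Z_4) : x = z41 \/ x = z43 ->
  (tab 0 [:: 0; 1; 2; 1] (y * x)%g <= (tab 0 [:: 0; 1; 2; 1] y).+1)%N.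
Proof. by case=> ->; move: y; apply: Z4_ind; rewrite mulZ4. Qed.

End Z4.

(** * Symmetric laws *)

Section Laws.
Variables (R : realType) (A B : finGroupType) (G : groupType).
Variables (i : A -> G) (j : B -> G).
Hypothesis free : is_free_product i j.
Local Notation H := (@free_factor A B).
Local Notation iota_ := (letter_val i j).

Let iM x y : i (x * y)%g = (i x * i y)%g.
Proof. by case: free => [[_ h] _ _]; exact: h. Qed.
Let i1 : i 1%g = 1%g.
Proof. by case: free => [[h _] _ _]; exact: h. Qed.
Let jM x y : j (x * y)%g = (j x * j y)%g.
Proof. by case: free => [_ [_ h] _]; exact: h. Qed.
Let j1 : j 1%g = 1%g.
Proof. by case: free => [_ [h _] _]; exact: h. Qed.

Lemma free_iV x : i x^-1%g = (i x)^-1%g.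
Proof. by rewrite -[LHS]mul1g -(mulVg (i x)) -mulgA -iM mulgV i1 mulg1. Qed.

Lemma free_jV x : j x^-1%g = (j x)^-1%g.
Proof. by rewrite -[LHS]mul1g -(mulVg (j x)) -mulgA -jM mulgV j1 mulg1. Qed.

Lemma nf_iE nf : normal_form_map H iota_ nf -> forall a, nf (i a) = push ((a, 1%g) : A * B) [::].
Proof.
move=> nfP a; rewrite -(letter_vall free); apply: (nf_iota nfP (c := true)).
by rewrite factorT.
Qed.

Lemma nf_jE nf : normal_form_map H iota_ nf -> forall b, nf (j b) = push ((1%g, b) : A * B) [::].
Proof.
move=> nfP b; rewrite -(letter_valr free); apply: (nf_iota nfP (c := false)).
by rewrite factorF.
Qed.

Lemma free_ij a b : i a = j b -> a = 1%g.
Proof.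
have [nf nfP] := free_normal_form free; move/(congr1 nf).
rewrite (nf_iE nfP) (nf_jE nfP) /push; case: eqVneq => [[->] //|_].
by case: eqVneq => // _ [->].
Qed.

Lemma free_i_inj : injective i.
Proof.
move=> x y e; have h : i (x * y^-1)%g = j 1%g by rewrite iM free_iV e mulgV j1.
by apply/eqP; rewrite eq_mulgV1 (free_ij h).
Qed.

Lemma free_j_inj : injective j.
Proof.
move=> x y e; have h : j (x * y^-1)%g = 1%g by rewrite jM free_jV e mulgV.
have [nf nfP] := free_normal_form free.
move: (congr1 nf h); rewrite (nf_jE nfP) (nf1 nfP) /push; case: eqVneq => // -[xy] _.
by apply/eqP; rewrite eq_mulgV1 xy.
Qed.

Variables (u : A) (v : B).
Hypothesis u1 : u != 1%g.
Hypothesis v1 : v != 1%g.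

Definition gens : set G := [set i u; (i u)^-1%g; j v; (j v)^-1%g].

(** A disjunction instead of a sum of two point masses, so that an involution receives [w] once. *)
Definition step_weight (D : finGroupType) (x : D) (w : R) (y : D) : R :=
  if (y == x) || (y == x^-1%g) then w else 0.

Local Notation mA w := (step_weight u w).
Local Notation mB w := (step_weight v w).

Definition step_law (w w' : R) (g : G) : R :=
  \sum_a mA w a * (g == i a)%:R + \sum_b mB w' b * (g == j b)%:R.

Lemma step_law_i w w' a : a != 1%g -> step_law w w' (i a) = mA w a.
Proof.
move=> a1; rewrite /step_law (bigD1 a) //= eqxx mulr1 big1 ?addr0.
  rewrite big1 ?addr0 // => b _; case: eqVneq => [/free_ij e|]; rewrite ?mulr0 //.
  by rewrite e eqxx in a1.
move=> a' na; case: eqVneq => [/free_i_inj e|]; rewrite ?mulr0 //.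
by rewrite e eqxx in na.
Qed.

Lemma step_law_j w w' b : b != 1%g -> step_law w w' (j b) = mB w' b.
Proof.
move=> b1; rewrite /step_law big1 ?add0r.
  rewrite (bigD1 b) //= eqxx mulr1 big1 ?addr0 // => b' nb.
  case: eqVneq => [/free_j_inj e|]; rewrite ?mulr0 //.
  by rewrite e eqxx in nb.
move=> a _; case: eqVneq => [/esym e|]; rewrite ?mulr0 //.
move: b1; have a1 := free_ij e; rewrite a1 i1 -j1 in e.
by rewrite -(free_j_inj e) eqxx.
Qed.

Lemma step_law_out w w' g : ~ gens g -> step_law w w' g = 0.
Proof.
move=> gS; rewrite /step_law !big1 ?addr0 // => x _; rewrite /step_weight;
  case: ifP; rewrite ?mul0r // => xx; case: eqVneq; rewrite ?mulr0 // => gx;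
  case: gS; rewrite gx /gens /=; case/orP: xx => /eqP ->; rewrite ?free_iV ?free_jV.
- by left; right.
- by right.
- by left; left; left.
- by left; left; right.
Qed.

Lemma gensP g : gens g -> (exists2 a, (a == u) || (a == u^-1%g) & g = i a) \/
   (exists2 b, (b == v) || (b == v^-1%g) & g = j b).
Proof.
case=> [[[->|->]|->]|->]; [left; exists u|left; exists u^-1%g|right; exists v|
  right; exists v^-1%g]; by rewrite ?eqxx ?orbT ?free_iV ?free_jV.
Qed.

Lemma step_neq1 (D : finGroupType) (x y : D) : x != 1%g ->
  (y == x) || (y == x^-1%g) -> y != 1%g.
Proof. by move=> x1 /orP[] /eqP ->; rewrite ?invg_eq1. Qed.

Lemma step_law_fsum w w' :
  \sum_(s \in gens) step_law w w' s = \sum_a mA w a + \sum_b mB w' b.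
Proof.
rewrite (fsbig_widen _ [set: G]) //; last first.
  by move=> g [_ gS] /=; exact: step_law_out.
pose m := lift2 (mA w) (mB w').
have mr b : m (1%g, b) = mB w' b.
  apply: lift2r; rewrite /step_weight eq_sym (negbTE u1) eq_sym invg_eq1 (negbTE u1).
  by rewrite eq_sym (negbTE v1) eq_sym invg_eq1 (negbTE v1).
have E g : step_law w w' g = \sum_(c : bool) \sum_(x in H c) m x * (g == iota_ x)%:R.
  rewrite big_bool /= sum_factorT sum_factorF; congr (_ + _).
    by apply: eq_bigr => a _; rewrite /m lift2l letter_vall.
  by apply: eq_bigr => b _; rewrite mr letter_valr.
have := fsum_step E (fun=> 1); rewrite big_bool /= sum_factorT sum_factorF => h.
transitivity (\sum_(g \in [set: G]) step_law w w' g * 1).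
  by apply: eq_fsbigr => g _; rewrite mulr1.
rewrite h; congr (_ + _).
  by apply: eq_bigr => a _; rewrite /m lift2l mulr1.
by apply: eq_bigr => b _; rewrite mr mulr1.
Qed.

(** Symmetry leaves one weight per factor. Both are positive because the support generates [G]:
    otherwise it would lie in the image of a single factor, which misses the generator of the
    other. *)
Lemma symmetric_law_step mu : symmetric_laws R gens mu -> exists w w',
  [/\ 0 < w, 0 < w', mu = step_law w w' &
      \sum_a mA w a + \sum_b mB w' b = 1].
Proof.
case=> mu0 muS mu1 sym gen; exists (mu (i u)), (mu (j v)).
have gu : gens (i u) by left; left; left.
have gv : gens (j v) by left; right.
have E : mu = step_law (mu (i u)) (mu (j v)).
  apply/funext => g; have [gS|gS] := pselect (gens g); last first.
    by rewrite (muS _ gS) step_law_out.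
  case/gensP: (gS) => [[a au ->]|[b bv ->]].
    rewrite step_law_i ?(step_neq1 u1 au) // /step_weight au.
    by case/orP: au => /eqP -> //; rewrite free_iV -sym.
  rewrite step_law_j ?(step_neq1 v1 bv) // /step_weight bv.
  by case/orP: bv => /eqP -> //; rewrite free_jV -sym.
split=> //.
- rewrite lt_def mu0 andbT; apply/negP => /eqP z.
  have : range j = setT.
    apply: gen; first by exists 1%g.
      by move=> _ _ [x _ <-] [y _ <-]; exists (x * y^-1)%g; rewrite // jM free_jV.
    move=> g /= mg; have [gS|/muS e] := pselect (gens g); last by rewrite e eqxx in mg.
    case/gensP: gS mg => [[a au ->]|[b _ ->]]; last by exists b.
    by rewrite E step_law_i ?(step_neq1 u1 au) // /step_weight au z eqxx.
  move/seteqP => [_ /(_ (i u) I)[b _ /esym/free_ij e]].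
  by have := u1; rewrite e eqxx.
- rewrite lt_def mu0 andbT; apply/negP => /eqP z.
  have : range i = setT.
    apply: gen; first by exists 1%g.
      by move=> _ _ [x _ <-] [y _ <-]; exists (x * y^-1)%g; rewrite // iM free_iV.
    move=> g /= mg; have [gS|/muS e] := pselect (gens g); last by rewrite e eqxx in mg.
    case/gensP: gS mg => [[a _ ->]|[b bv ->]]; first by exists a.
    by rewrite E step_law_j ?(step_neq1 v1 bv) // /step_weight bv z eqxx.
  move/seteqP => [_ /(_ (j v) I)[a _ e]].
  have a1 := free_ij e; rewrite a1 i1 -j1 in e.
  by have := v1; rewrite -(free_j_inj e) eqxx.
- by rewrite -step_law_fsum -mu1; apply: eq_fsbigr => g _; rewrite -E.
Qed.

Lemma step_law_symmetric w w' : 0 < w -> 0 < w' ->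
  (forall g, exists n, is_word gens n g) ->
  \sum_a mA w a + \sum_b mB w' b = 1 -> symmetric_laws R gens (step_law w w').
Proof.
move=> w0 w0' words sum1.
have pos g : gens g -> 0 < step_law w w' g.
  case/gensP=> [[a au ->]|[b bv ->]].
    by rewrite step_law_i ?(step_neq1 u1 au) // /step_weight au.
  by rewrite step_law_j ?(step_neq1 v1 bv) // /step_weight bv.
split.
- move=> g; have [/pos/ltW//|/step_law_out ->//] := pselect (gens g).
- exact: step_law_out.
- by rewrite step_law_fsum.
- move=> s /gensP[[a au ->]|[b bv ->]].
    rewrite -free_iV !step_law_i ?invg_eq1 ?(step_neq1 u1 au) // /step_weight.
    by rewrite au !(can2_eq invgK invgK) ?invgK orbC au.
  rewrite -free_jV !step_law_j ?invg_eq1 ?(step_neq1 v1 bv) // /step_weight.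
  by rewrite bv !(can2_eq invgK invgK) ?invgK orbC bv.
- move=> K K1 Kdiv KS; apply/seteqP; split=> // g _.
  have Kinv x : K x -> K x^-1%g by move=> Kx; rewrite -[x^-1%g]mul1g; exact: Kdiv.
  have Kmul x y : K x -> K y -> K (x * y)%g.
    by move=> Kx /Kinv Ky; rewrite -[y]invgK; exact: Kdiv.
  have [n [s [_ Ss <-]]] := words g.
  elim: s Ss => [|x s IH] Ss; first by rewrite big_nil.
  rewrite big_cons; apply: Kmul; last by apply: IH => y ys; apply: Ss; rewrite inE ys orbT.
  apply: KS; have /pos : gens x by apply: Ss; rewrite mem_head.
  by rewrite /= => /lt0r_neq0.
Qed.

End Laws.

(** * Entropy and drift in the three groups *)

Section StepWeights.
Variable R : realType.

Lemma Z2_step_weight (w : R) : step_weight z21 w = stepZ2 w.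
Proof. by apply/funext; apply: Z2_ind. Qed.

Lemma Z3_step_weight (u : 'Z_3) (w : R) : u = z31 \/ u = z32 -> step_weight u w = stepZ3 w.
Proof. by case=> ->; apply/funext; apply: Z3_ind. Qed.

Lemma Z4_step_weight (u : 'Z_4) (w : R) : u = z41 \/ u = z43 -> step_weight u w = stepZ4 w.
Proof. by case=> ->; apply/funext; apply: Z4_ind. Qed.

Lemma Z4_F_sum (t : R) : t ^+ 2 < 2 ->
  \sum_(b | b != 1%g) hitZ4 t b = (2 * t + t ^+ 2) / (2 - t ^+ 2).
Proof.
move=> t2; rewrite sum1_Z4 /hitZ4 /tab /=; field.
by rewrite gt_eqF // subr_gt0.
Qed.

Lemma sqr_lt_self (t : R) : 0 < t < 1 -> t ^+ 2 < t.
Proof. by case/andP=> t0 t1; rewrite expr2 gtr_pMr. Qed.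

End StepWeights.

Section Gens.
Variables (G : groupType).

Lemma Z4_gens (A : finGroupType) (i : A -> G) (j : 'Z_4 -> G) (u : A) (v : 'Z_4) :
  is_free_product i j -> v = z41 \/ v = z43 ->
  gens i j u v (j z41) /\ gens i j u v (j z43).
Proof.
move=> free; rewrite /gens.
have e : (z41^-1 = z43)%g /\ (z43^-1 = z41)%g by rewrite !mulZ4.
by case=> ->; rewrite -!(free_jV free) ?e.1 ?e.2; split; [left; right|right|right|left; right].
Qed.

Lemma Z4_gensl (B : finGroupType) (i : 'Z_4 -> G) (j : B -> G) (u : 'Z_4) (v : B) :
  is_free_product i j -> u = z41 \/ u = z43 ->
  gens i j u v (i z41) /\ gens i j u v (i z43).
Proof.
move=> free; rewrite /gens.
have e : (z41^-1 = z43)%g /\ (z43^-1 = z41)%g by rewrite !mulZ4.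
by case=> ->; rewrite -!(free_iV free) ?e.1 ?e.2; split;
  [left; left; left|left; left; right|left; left; right|left; left; left].
Qed.

Lemma Z3_gensl (B : finGroupType) (i : 'Z_3 -> G) (j : B -> G) (u : 'Z_3) (v : B) :
  is_free_product i j -> u = z31 \/ u = z32 ->
  gens i j u v (i z31) /\ gens i j u v (i z32).
Proof.
move=> free; rewrite /gens.
have e : (z31^-1 = z32)%g /\ (z32^-1 = z31)%g by rewrite !mulZ3.
by case=> ->; rewrite -!(free_iV free) ?e.1 ?e.2; split;
  [left; left; left|left; left; right|left; left; right|left; left; left].
Qed.

Definition ell2 : 'Z_2 -> nat := tab 0%N [:: 0; 1]%N.
Definition ell3 : 'Z_3 -> nat := tab 0%N [:: 0; 1; 1]%N.
Definition ell4 : 'Z_4 -> nat := tab 0%N [:: 0; 1; 2; 1]%N.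

Lemma Z4_inv_gen (v : 'Z_4) : v = z41 \/ v = z43 -> (v^-1)%g = z41 \/ (v^-1)%g = z43.
Proof. by case=> ->; rewrite mulZ4; [right|left]. Qed.

Lemma Z3_inv_gen (v : 'Z_3) : v = z31 \/ v = z32 -> (v^-1)%g = z31 \/ (v^-1)%g = z32.
Proof. by case=> ->; rewrite mulZ3; [right|left]. Qed.

Lemma gens_step (A : finGroupType) (i : A -> G) (j : 'Z_4 -> G) (u : A) (v : 'Z_4)
    (ellA : A -> nat) (good : A -> Prop) :
  is_free_product i j -> v = z41 \/ v = z43 -> good u -> good u^-1%g ->
  (forall x, good x -> forall y, (ellA (y * x)%g <= (ellA y).+1)%N) ->
  forall s, gens i j u v s ->
  (exists a, s = i a /\ forall y, (ellA (y * a)%g <= (ellA y).+1)%N) \/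
  (exists b, s = j b /\ forall y, (ell4 (y * b)%g <= (ell4 y).+1)%N).
Proof.
move=> free vg gu gu' step s; case=> [[[->|->]|->]|->].
- by left; exists u; split=> //; exact: step.
- by left; exists u^-1%g; rewrite (free_iV free); split=> //; exact: step.
- by right; exists v; split=> // y; exact: Z4_step.
- right; exists v^-1%g; rewrite (free_jV free); split=> // y.
  by apply: Z4_step; exact: Z4_inv_gen.
Qed.

End Gens.

(** * Entropy and drift when the second factor is Z/4 *)

Section Rates.
Variables (R : realType) (G : groupType) (A : finGroupType).
Variables (i : A -> G) (j : 'Z_4 -> G) (u : A) (v : 'Z_4).
Hypothesis free : is_free_product i j.
Hypothesis vg : v = z41 \/ v = z43.
Variables (good : A -> Prop) (ellA : A -> nat).
Hypothesis gu : good u.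
Hypothesis gu' : good u^-1%g.
Hypothesis stepA : forall x, good x -> forall y, (ellA (y * x)%g <= (ellA y).+1)%N.
Local Notation S := (gens i j u v).
Hypothesis lA : factor_length i S ellA.

Let lB : factor_length j S ell4.
Proof.
have [g1 g3] := Z4_gens u free vg.
by apply: Z4_length g1 g3; case: free.
Qed.

Lemma gens_words g : exists n, is_word S n g.
Proof.
have [nf nfP] := free_normal_form free.
have := is_word_wlen (@factor_ti _ _) nfP
  (lift_length free lA lB (gens_step free vg gu gu' stepA)) g.
by move=> h; eexists; exact: h.
Qed.

Lemma gens_volume (r : R) : 0 < r < 1 ->
  (\sum_(a | a != 1%g) r ^+ ellA a) * (2 * r + r ^+ 2) = 1 -> volume R S = - ln r.
Proof.
move=> r01 e; apply: (free_volume free lA lB (gens_step free vg gu gu' stepA) r01).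
by rewrite sum1_Z4 /ell4 /tab /= expr1 -e; congr (_ * _); ring.
Qed.

Variables (w w' : R) (FA : A -> R) (x t : R).
Local Notation mA := (step_weight u w).
Local Notation y := (t / (2 - t ^+ 2)).
Hypothesis w0 : 0 < w.
Hypothesis w0' : 0 < w'.
Hypothesis wA : factor_weights mA.
Hypothesis wAB : \sum_a mA a + 2 * w' = 1.
Hypothesis t01 : 0 < t < 1.
Hypothesis gA : factor_green mA FA (2 * w' * y).
Hypothesis xE : \sum_a mA a * FA a = x.
Hypothesis tE : 2 * w' = t * (1 - x).
Hypothesis FS : (\sum_(a | a != 1%g) FA a) * (2 * t + t ^+ 2) = 2 - t ^+ 2.

Let t2 : t ^+ 2 < 2.
Proof. by have := sqr_lt_self t01; case/andP: t01 => _ t1; lra. Qed.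
Let d2 : 0 < 2 - t ^+ 2. Proof. by rewrite subr_gt0. Qed.
Let y01 : 0 < y < 1.
Proof.
have := sqr_lt_self t01; case/andP: (t01) => t0 t1 tt.
by rewrite divr_gt0 //= ltr_pdivrMr // mul1r; lra.
Qed.
Let gB : factor_green (step_weight v w') (hitZ4 t) x.
Proof. by rewrite Z4_step_weight //; apply: Z4_green. Qed.
Let yE : \sum_b step_weight v w' b * hitZ4 t b = 2 * w' * y.
Proof. by rewrite Z4_step_weight // Z4_green_sum. Qed.
Let wB : factor_weights (step_weight v w').
Proof. by rewrite Z4_step_weight //; apply: Z4_weights; exact: ltW. Qed.
Let sumB : \sum_b step_weight v w' b = 2 * w'.
Proof. by rewrite Z4_step_weight // sum_Z4 /stepZ4 /tab /=; ring. Qed.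
Let sumAB : \sum_a mA a + \sum_b step_weight v w' b = 1.
Proof. by rewrite sumB. Qed.
Let x_le : x <= \sum_a mA a.
Proof.
rewrite -xE; apply: ler_sum => a _; rewrite -[X in _ <= X]mulr1.
rewrite ler_wpM2l ?(fw_ge0 wA) //; have [->|a1] := eqVneq a 1%g.
  by rewrite (fg1 gA).
by rewrite ltW // (fg_lt1 gA).
Qed.
Let le1 : \sum_a mA a * FA a + \sum_b step_weight v w' b * hitZ4 t b <= 1.
Proof.
rewrite yE xE -[X in _ <= X]wAB; apply: lerD; first exact: x_le.
rewrite -[X in _ <= X]mulr1; apply: ler_wpM2l; first by rewrite mulr_ge0 // ltW.
by case/andP: y01 => _ /ltW.
Qed.
Let prod1 : (\sum_(a | a != 1%g) FA a) * (\sum_(b | b != 1%g) hitZ4 t b) = 1.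
Proof. by rewrite Z4_F_sum // mulrA FS mulfV // gt_eqF. Qed.

Let gA' : factor_green mA FA (\sum_b step_weight v w' b * hitZ4 t b).
Proof. by rewrite yE. Qed.
Let gB' : factor_green (step_weight v w') (hitZ4 t) (\sum_a mA a * FA a).
Proof. by rewrite xE. Qed.

Local Notation rB := (w' * (1 - t) / (1 + t)).

Lemma gens_entropy kA :
  factor_drift mA (fun a => - ln (FA a)) kA (2 * w' * y) ->
  entropy (step_law i j u v w w') = \sum_a mA a * (- ln (FA a) + kA a) +
    rB * (2 * - ln y + t * - ln (t ^+ 2 / (2 - t ^+ 2))).
Proof.
move=> dA.
have [|kB [dB eB]] := Z4_drift t01 tE (phi := fun b => - ln (hitZ4 t b)) _ erefl.
  by rewrite /hitZ4 /tab /= ln1 oppr0.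
have := free_entropy wA wB sumAB gA' gB' le1 prod1 free (mu := step_law i j u v w w')
   (fun g => erefl) (kA := kA) (kB := kB).
rewrite yE xE => ->; [|exact: dA|]; last by rewrite Z4_step_weight.
congr (_ + _).
by rewrite Z4_step_weight // eB /hitZ4 /tab.
Qed.

Lemma gens_drift kA :
  factor_drift mA (fun a => (ellA a)%:R) kA (2 * w' * y) ->
  drift S (step_law i j u v w w') = \sum_a mA a * ((ellA a)%:R + kA a) +
    rB * (2 + 2 * t).
Proof.
move=> dA.
have [|kB [dB eB]] := Z4_drift t01 tE (phi := fun b => (ell4 b)%:R) _ erefl; first by [].
have := free_drift wA wB sumAB gA' gB' le1 prod1 free lA lB
   (gens_step free vg gu gu' stepA) (mu := step_law i j u v w w')
   (fun g => erefl) (kA := kA) (kB := kB).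
rewrite yE xE => ->; [|exact: dA|]; last by rewrite Z4_step_weight.
congr (_ + _).
rewrite Z4_step_weight // eB /ell4 /tab /=; congr (_ * _); ring.
Qed.

End Rates.

(** * The hitting parameters *)

Section HittingParameters.
Variable R : realType.
Implicit Types s t w : R.

Lemma quadratic_root (a b c : R) : c < 0 -> 0 < a + b + c ->
  exists2 t, 0 < t < 1 & a * t ^+ 2 + b * t + c = 0.
Proof.
move=> c0 abc; pose p : {poly R} := a *: 'X^2 + b *: 'X + c%:P.
have pE x : p.[x] = a * x ^+ 2 + b * x + c by rewrite /p !hornerE.
have h0 : p.[0] < 0 by rewrite pE expr0n /= !mulr0 !add0r.
have h1 : 0 < p.[1] by rewrite pE expr1n !mulr1.
have [|t /andP[t0 t1] /rootP rt] := @poly_ivt _ p 0 1 ler01.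
  by rewrite !ltW.
exists t; last by rewrite -pE.
rewrite !lt_neqAle t0 t1 !andbT; apply/andP; split; apply/eqP => e.
  by move: h0; rewrite [X in p.[X] < _]e rt ltxx.
by rewrite -e rt ltxx in h1.
Qed.

Definition eta t := (2 + t) * ln (2 + t) - t * ln t.

Lemma lnD_split t : 0 < t < 1 ->
  let D := 2 - t ^+ 2 in
  [/\ ln (t / D) = ln t - ln D, ln (t ^+ 2 / D) = 2 * ln t - ln D &
      ln (2 * t + t ^+ 2) = ln t + ln (2 + t)].
Proof.
case/andP=> t0 t1 D; have D0 : 0 < D.
  by rewrite subr_gt0; apply: lt_trans (_ : t < _); [rewrite expr2 gtr_pMr|lra].
split; rewrite ?ln_div ?posrE ?exprn_gt0 //.
  by rewrite lnXn // mulr_natl.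
by rewrite (_ : _ + _ = t * (2 + t)) ?lnM ?posrE //; [lra|ring].
Qed.

(** * Parameters for Z/2 * Z/4 *)

Section Case1.
Variables (t w w' : R).
Hypothesis t01 : 0 < t < 1.
Hypothesis ww' : w + 2 * w' = 1.
Hypothesis te : (1 + w) * t ^+ 2 + (1 + w) * t - 2 = 0.
Hypothesis w1 : 0 < w < 1.
Let s := (2 - t ^+ 2) / (2 * t + t ^+ 2).
Let t0 : 0 < t. Proof. by case/andP: t01. Qed.
Let D0 : 0 < 2 - t ^+ 2.
Proof. by have := sqr_lt_self t01; case/andP: t01 => _; lra. Qed.
Let S0 : 0 < 2 * t + t ^+ 2.
Proof. by rewrite addr_gt0 ?mulr_gt0 ?exprn_gt0 // t0. Qed.
Let wE : w = (2 - t - t ^+ 2) / (t + t ^+ 2).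
Proof.
have h : 0 < t + t ^+ 2 by rewrite addr_gt0 ?exprn_gt0 // t0.
apply: (mulIf (lt0r_neq0 h)); rewrite divfK ?lt0r_neq0 //; move: te; lra.
Qed.
Let w'eta : w' = (1 - w) / 2.
Proof. by have := ww'; lra. Qed.
Let nz : [/\ t != 0, 1 + t != 0, 2 + t != 0, 2 - t ^+ 2 != 0 & 2 * t + t ^+ 2 != 0].
Proof. by split; rewrite lt0r_neq0 //; have := t0; lra. Qed.

Lemma case1_s01 : 0 < s < 1.
Proof.
rewrite /s divr_gt0 //= ltr_pdivrMr // mul1r.
have h : 0 < t + t ^+ 2 by rewrite addr_gt0 ?exprn_gt0 // t0.
case/andP: w1 => _; rewrite wE ltr_pdivrMr // mul1r; lra.
Qed.

(** [s] is the value that [green_sum] forces for a given [t]. Both remaining equations then reduce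
    to the quadratic [te], here in the form [wE]. *)
Lemma case1_eqs : [/\ w = s * (1 - 2 * w' * (t / (2 - t ^+ 2))),
  2 * w' = t * (1 - w * s) & s * (2 * t + t ^+ 2) = 2 - t ^+ 2].
Proof.
have [n1 n2 n3 n4 n5] := nz.
have n6 : t + t ^+ 2 != 0 by rewrite (_ : _ + _ = t * (1 + t)) ?mulf_neq0 //; ring.
split; last by rewrite /s divfK.
  by rewrite w'eta wE /s; field; rewrite ?n6 ?n5 ?n4 ?n1.
by rewrite w'eta wE /s; field; rewrite ?n6 ?n5 ?n4 ?n1.
Qed.

Lemma case1_rates : let k := w' * (1 - t) / (1 + t) in
  [/\ 0 < k, w * (1 - s) / (1 + s) * (- ln s) +
    k * (2 * - ln (t / (2 - t ^+ 2)) + t * - ln (t ^+ 2 / (2 - t ^+ 2))) = k * eta t &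
    w * (1 - s) / (1 + s) + k * (2 + 2 * t) = k * (4 + 3 * t)].
Proof.
have [n1 n2 n3 n4 n5] := nz; move=> k.
have n6 : t + t ^+ 2 != 0 by rewrite (_ : _ + _ = t * (1 + t)) ?mulf_neq0 //; ring.
have [e1 e2 e3] := lnD_split t01.
have k0 : 0 < k.
  rewrite /k w'eta !mulr_gt0 ?invr_gt0 //; try by have := t0; case/andP: (t01); case/andP: (w1); lra.
(* Each side is the rate at which the letters of one factor accumulate; they agree because letters
   alternate. *)
have kA : w * (1 - s) / (1 + s) = k * (2 + t).
  rewrite /k w'eta wE /s; field; rewrite ?n6 ?n5 ?n2 /=.
  by rewrite (_ : 2 * t + t ^+ 2 + (2 - t ^+ 2) = 2 * (1 + t)) ?mulf_neq0 //; ring.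
split=> //; last by rewrite kA; ring.
(* After this substitution all terms in [ln (2 - t ^+ 2)] cancel and [eta t] is left. *)
have ls : ln s = ln (2 - t ^+ 2) - (ln t + ln (2 + t)).
  by rewrite -e3 -ln_div ?posrE.
rewrite kA ls e1 e2 /eta; ring.
Qed.

End Case1.
End HittingParameters.

(** * Parameters for Z/3 * Z/4 *)

Section Case2.
Variable R : realType.
Variables (t w w' : R).
Hypothesis t01 : 0 < t < 1.
Hypothesis ww' : 2 * w + 2 * w' = 1.
Hypothesis te : (2 + 2 * w) * t ^+ 2 + (2 + 4 * w) * t + (4 * w - 4) = 0.
Hypothesis w1 : 0 < w < 2^-1.
Let s := 2 * (2 - t ^+ 2) / (2 + 4 * t + t ^+ 2).
Let t0 : 0 < t. Proof. by case/andP: t01. Qed.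
Let tt0 : 0 < t ^+ 2. Proof. by rewrite exprn_gt0. Qed.
Let D0 : 0 < 2 - t ^+ 2.
Proof. by have := sqr_lt_self t01; case/andP: t01 => _; lra. Qed.
Let S0 : 0 < 2 * t + t ^+ 2.
Proof. by have := t0; have := tt0; lra. Qed.
Let B0 : 0 < 2 + 4 * t + t ^+ 2.
Proof. by have := t0; have := tt0; lra. Qed.
Let C0 : 0 < 2 + 2 * t + t ^+ 2.
Proof. by have := t0; have := tt0; lra. Qed.

Lemma case2_weight : w = (2 - t - t ^+ 2) / (2 + 2 * t + t ^+ 2).
Proof.
apply: (mulIf (lt0r_neq0 C0)); rewrite divfK ?lt0r_neq0 //; move: te; lra.
Qed.
Let wE := case2_weight.
Let w'eta : w' = 2^-1 - w.
Proof. by have := ww'; lra. Qed.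
Let nz : [/\ t != 0, 1 + t != 0, 2 + t != 0, 2 - t ^+ 2 != 0 & 2 * t + t ^+ 2 != 0].
Proof. by split; rewrite lt0r_neq0 //; have := t0; lra. Qed.
Let nB : 2 + 4 * t + t ^+ 2 != 0. Proof. by rewrite lt0r_neq0. Qed.
Let nC : 2 + 2 * t + t ^+ 2 != 0. Proof. by rewrite lt0r_neq0. Qed.

Lemma case2_s01 : 0 < s < 1.
Proof.
rewrite /s divr_gt0 ?mulr_gt0 //= ltr_pdivrMr // mul1r.
case/andP: w1 => _; rewrite wE ltr_pdivrMr //; lra.
Qed.

Let sE : s / (2 - s) = (2 - t ^+ 2) / (2 * (2 * t + t ^+ 2)).
Proof.
have [n1 n2 n3 n4 n5] := nz.
have n6 : 2 - s != 0 by case/andP: case2_s01 => _ h; rewrite lt0r_neq0 //; lra.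
apply: (mulIf n6); rewrite divfK // /s; field.
by rewrite n5 nB.
Qed.

Lemma case2_eqs : [/\ 2 * w = s * (1 - 2 * w' * (t / (2 - t ^+ 2))),
  2 * w' = t * (1 - 2 * w * (s / (2 - s))) &
  (s / (2 - s) + s / (2 - s)) * (2 * t + t ^+ 2) = 2 - t ^+ 2].
Proof.
have [n1 n2 n3 n4 n5] := nz.
split; last by rewrite sE; field.
  by rewrite w'eta wE /s; field; rewrite ?nB ?nC ?n4.
by rewrite w'eta wE sE; field; rewrite ?nC ?n5.
Qed.

Lemma case2_rates : let k := w' * (1 - t) / (1 + t) in
  [/\ 0 < k, 2 * w * (1 - s) / (2 + s) * (2 * - ln (s / (2 - s))) +
    k * (2 * - ln (t / (2 - t ^+ 2)) + t * - ln (t ^+ 2 / (2 - t ^+ 2))) =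
    k * ((2 + t) * ln 2 + eta t) &
    2 * w * (1 - s) / (2 + s) * 2 + k * (2 + 2 * t) = k * (4 + 3 * t)].
Proof.
have [n1 n2 n3 n4 n5] := nz; move=> k.
have [e1 e2 e3] := lnD_split t01.
have k0 : 0 < k.
  have h1 := t0; case/andP: (t01) => _ h2; case/andP: (w1) => _ h3.
  by rewrite /k w'eta !mulr_gt0 ?invr_gt0 ?subr_gt0 // addr_gt0.
have n7 : 2 + s != 0 by case/andP: case2_s01 => h _; rewrite lt0r_neq0 //; lra.
(* Again the equality of the letter rates of the two factors. *)
have kA : 2 * w * (1 - s) / (2 + s) * 2 = k * (2 + t).
  have -> : 2 * w * (1 - s) / (2 + s) * 2 = 4 * w * (1 - s) / (2 + s) by ring.
  apply: (mulIf n7); rewrite divfK // /k w'eta wE /s; field.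
  by rewrite ?nB ?nC ?n2.
have ls : ln (s / (2 - s)) = ln (2 - t ^+ 2) - (ln 2 + (ln t + ln (2 + t))).
  by rewrite sE -e3 ln_div ?posrE ?mulr_gt0 // lnM ?posrE.
split=> //; last by rewrite kA; ring.
rewrite mulrA kA ls e1 e2 /eta; ring.
Qed.

End Case2.

(** * Parameters for Z/4 * Z/4 *)

Section Case3.
Variable R : realType.

(** The first equation is solved for [t] as a function of [s]; the intermediate value theorem in [s]
    then solves the second. *)
Lemma case3_exists (w w' : R) : 0 < w -> 0 < w' -> exists s t : R,
  [/\ 0 < s < 1, 0 < t < 1,
      (2 * s + s ^+ 2) * (1 + t) = (2 - t ^+ 2) * (1 + s) &
      w * (1 - s) * (2 + s) * (1 + t) = w' * (1 - t) * (2 + t) * (1 + s)].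
Proof.
move=> w0 w0'.
(* The discriminant of the first equation, [(1 + s) t^2 + (2 s + s^2) t + s^2 - 2 = 0], as a
   quadratic in [t]. *)
pose q (s : R) := s ^+ 4 + 8 * s + 8.
pose D s := Num.sqrt (q s).
(* [h s / (4 (1 + s))] is the difference of the two sides of the second equation at the root [t]. At
   [s = 0] the root is [sqrt 2 > 1] and makes the right side negative; at [s = 1] the left side is 0
   and the root is below 1. *)
pose h s := 2 * w * (1 - s) * (2 + s) * (D s + 2 - s ^+ 2) -
  w' * (2 + 4 * s + s ^+ 2 - D s) * (4 + 2 * s - s ^+ 2 + D s).
have ch : continuous h.
  have cpow (n : nat) : continuous (fun s : R => s ^+ n) by exact: exprn_continuous.
  have cc (a : R) : continuous (fun _ : R => a) by move=> x; exact: cvg_cst.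
  have cid : continuous (fun s : R => s) by move=> x; exact: cvg_id.
  have cD : continuous D.
    move=> x; apply: continuous_comp; last exact: sqrt_continuous.
    by apply: cvgD; last exact: cc; apply: cvgD; [exact: cpow|apply: cvgM; [exact: cc|exact: cid]].
  have cm (a b : R -> R) : continuous a -> continuous b -> continuous (fun s => a s * b s : R).
    by move=> ca cb x; apply: cvgM; [exact: ca|exact: cb].
  have cp (a b : R -> R) : continuous a -> continuous b -> continuous (fun s => a s + b s : R).
    by move=> ca cb x; apply: cvgD; [exact: ca|exact: cb].
  have cn (a : R -> R) : continuous a -> continuous (fun s => - a s : R).
    by move=> ca x; apply: cvgN; exact: ca.
  have c1 := cm _ _ (cm _ _ (cm _ _ (cc (2 * w)) (cp _ _ (cc 1) (cn _ cid)))
    (cp _ _ (cc 2) cid)) (cp _ _ (cp _ _ cD (cc 2)) (cn _ (cpow 2))).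
  have c2 := cm _ _ (cm _ _ (cc w') (cp _ _ (cp _ _ (cp _ _ (cc 2)
    (cm _ _ (cc 4) cid)) (cpow 2)) (cn _ cD)))
    (cp _ _ (cp _ _ (cp _ _ (cc 4) (cm _ _ (cc 2) cid)) (cn _ (cpow 2))) cD).
  exact: (cp _ _ c1 (cn _ c2)).
have D0 : D 0 = 2 * Num.sqrt 2.
  rewrite /D /q expr0n /= mulr0 !add0r (_ : 8 = 2 ^+ 2 * 2); last by ring.
  by rewrite sqrtrM ?sqr_ge0 // sqrtr_sqr ger0_norm.
have s2 : (1 : R) < Num.sqrt 2.
  by rewrite -[X in X < _]sqrtr1 ltr_sqrt //; lra.
have s22 : Num.sqrt 2 ^+ 2 = 2 :> R by rewrite sqr_sqrtr.
have h0 : 0 < h 0.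
  rewrite /h D0 expr0n /= !mulr0 !addr0 !subr0.
  have a1 : 0 < w * (Num.sqrt 2 + 1) by rewrite mulr_gt0 //; lra.
  have a2 : 0 <= w' * ((Num.sqrt 2 - 1) * (2 + Num.sqrt 2)).
    by rewrite mulr_ge0 ?ltW // mulr_gt0 //; lra.
  nra.
have D1 : D 1 ^+ 2 = 17 by rewrite sqr_sqrtr /q ?expr1n; [ring|lra].
have D1p : 4 < D 1.
  have : (4 : R) ^+ 2 < D 1 ^+ 2 by rewrite D1; lra.
  by rewrite ltr_pXn2r ?nnegrE ?sqrtr_ge0.
have D1p' : D 1 < 5.
  have : D 1 ^+ 2 < (5 : R) ^+ 2 by rewrite D1; lra.
  by rewrite ltr_pXn2r ?nnegrE ?sqrtr_ge0.
have h1 : h 1 < 0.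
  rewrite /h subrr !(mulr0, mul0r) sub0r oppr_lt0 !expr1n.
  by rewrite !mulr_gt0 //; lra.
have [||s sI hs] := @IVT R h 0 1 0 ler01.
- exact: continuous_subspaceT.
- by rewrite ge_min le_max (ltW h0) (ltW h1) orbT.
move: sI; rewrite in_itv /= => /andP[s0 s1].
have sn0 : s != 0 by apply/eqP => e; have : 0 < h s; [rewrite e|rewrite hs ltxx].
have sn1 : s != 1 by apply/eqP => e; have : h s < 0; [rewrite e|rewrite hs ltxx].
have {sn0}s0 : 0 < s by rewrite lt_def sn0.
have {sn1}s1 : s < 1 by rewrite lt_neqAle sn1.
have q0 : 0 <= q s by rewrite /q !addr_ge0 ?exprn_ge0 ?mulr_ge0 // ltW.
have DD : D s ^+ 2 = s ^+ 4 + 8 * s + 8 by rewrite sqr_sqrtr.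
have ss : s ^+ 2 < s by rewrite expr2 gtr_pMr.
have Dlow : 2 * s + s ^+ 2 < D s.
  rewrite -(ltr_pXn2r (n := 2)) ?nnegrE ?sqrtr_ge0 //; last first.
    by rewrite addr_ge0 ?mulr_ge0 ?exprn_ge0 ?ltW.
  rewrite DD -subr_gt0.
  have -> : s ^+ 4 + 8 * s + 8 - (2 * s + s ^+ 2) ^+ 2 = 4 * (1 + s) * (2 - s ^+ 2) by ring.
  by rewrite !mulr_gt0 //; lra.
pose t := (D s - 2 * s - s ^+ 2) / (2 * (1 + s)).
have n1 : 1 + s != 0 by rewrite lt0r_neq0 //; lra.
have t0 : 0 < t by rewrite /t divr_gt0 //; lra.
have curve : (2 * s + s ^+ 2) * (1 + t) = (2 - t ^+ 2) * (1 + s).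
  apply/eqP; rewrite -subr_eq0; apply/eqP.
  have -> : (2 * s + s ^+ 2) * (1 + t) - (2 - t ^+ 2) * (1 + s) =
     (D s ^+ 2 - (s ^+ 4 + 8 * s + 8)) / (4 * (1 + s)).
    by rewrite /t; field.
  by rewrite DD subrr mul0r.
have eqn : w * (1 - s) * (2 + s) * (1 + t) = w' * (1 - t) * (2 + t) * (1 + s).
  apply/eqP; rewrite -subr_eq0; apply/eqP.
  have -> : w * (1 - s) * (2 + s) * (1 + t) - w' * (1 - t) * (2 + t) * (1 + s) =
     h s / (4 * (1 + s)) by rewrite /t /h; field.
  by rewrite hs mul0r.
exists s, t; split=> //; first by rewrite s0.
(* [t < 1] is read off the second equation, whose left side is positive. *)
rewrite t0 /=; have : 0 < w' * (1 - t) * (2 + t) * (1 + s).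
  by rewrite -eqn !mulr_gt0 //; lra.
have p1 : 0 < 1 + s by lra.
have p2 : 0 < 2 + t by lra.
by rewrite (pmulr_lgt0 _ p1) (pmulr_lgt0 _ p2) (pmulr_rgt0 _ w0') subr_gt0.
Qed.

Section Rates.
Variables (s t w w' : R).
Hypothesis s01 : 0 < s < 1.
Hypothesis t01 : 0 < t < 1.
Hypothesis ww' : 2 * w + 2 * w' = 1.
Hypothesis w0' : 0 < w'.
Hypothesis curve : (2 * s + s ^+ 2) * (1 + t) = (2 - t ^+ 2) * (1 + s).
Hypothesis eqn : w * (1 - s) * (2 + s) * (1 + t) = w' * (1 - t) * (2 + t) * (1 + s).
Let s0 : 0 < s. Proof. by case/andP: s01. Qed.
Let t0 : 0 < t. Proof. by case/andP: t01. Qed.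
Let Ds : 0 < 2 - s ^+ 2.
Proof. by have := sqr_lt_self s01; case/andP: s01 => _; lra. Qed.
Let Dt : 0 < 2 - t ^+ 2.
Proof. by have := sqr_lt_self t01; case/andP: t01 => _; lra. Qed.
Let n1s : 1 + s != 0. Proof. by rewrite lt0r_neq0 //; have := s0; lra. Qed.
Let n1t : 1 + t != 0. Proof. by rewrite lt0r_neq0 //; have := t0; lra. Qed.

(** Expanded, [curve] is the symmetric relation [(s + t)^2 + s t (s + t) = 2]. The product condition
    of [green_sum] expands to the same relation. *)
Let curve' : (2 * t + t ^+ 2) * (1 + s) = (2 - s ^+ 2) * (1 + t).
Proof. move: curve; lra. Qed.

Let prod : (2 * s + s ^+ 2) * (2 * t + t ^+ 2) = (2 - s ^+ 2) * (2 - t ^+ 2).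
Proof.
apply: (mulIf n1s); apply: (mulIf n1t).
have -> : (2 * s + s ^+ 2) * (2 * t + t ^+ 2) * (1 + s) * (1 + t) =
  ((2 * s + s ^+ 2) * (1 + t)) * ((2 * t + t ^+ 2) * (1 + s)) by ring.
by rewrite curve curve'; ring.
Qed.

Lemma case3_eqs : [/\ 2 * w = s * (1 - 2 * w' * (t / (2 - t ^+ 2))),
  2 * w' = t * (1 - 2 * w * (s / (2 - s ^+ 2))) &
  (s / (2 - s ^+ 2) + s ^+ 2 / (2 - s ^+ 2) + s / (2 - s ^+ 2)) * (2 * t + t ^+ 2) = 2 - t ^+ 2].
Proof.
have ns := lt0r_neq0 Ds; have nt := lt0r_neq0 Dt.
have w'eta : w' = 2^-1 - w by have := ww'; lra.
have wE : w = 2^-1 - w' by have := ww'; lra.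
(* The first equation made homogeneous in the weights by means of [2 w + 2 w' = 1], with
   [2 - t - t^2 = (1 - t) (2 + t)]. *)
have k1 : w * (1 - s) * (2 - t ^+ 2) = s * w' * (1 - t) * (2 + t).
  apply: (mulIf n1s).
  have -> : w * (1 - s) * (2 - t ^+ 2) * (1 + s) =
    w * (1 - s) * ((2 - t ^+ 2) * (1 + s)) by ring.
  rewrite -curve.
  have -> : w * (1 - s) * ((2 * s + s ^+ 2) * (1 + t)) =
    s * (w * (1 - s) * (2 + s) * (1 + t)) by ring.
  by rewrite eqn; ring.
have k2 : w' * (1 - t) * (2 - s ^+ 2) = t * w * (1 - s) * (2 + s).
  apply: (mulIf n1t).
  have -> : w' * (1 - t) * (2 - s ^+ 2) * (1 + t) =
    w' * (1 - t) * ((2 - s ^+ 2) * (1 + t)) by ring.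
  rewrite -curve'.
  have -> : w' * (1 - t) * ((2 * t + t ^+ 2) * (1 + s)) =
    t * (w' * (1 - t) * (2 + t) * (1 + s)) by ring.
  by rewrite -eqn; ring.
split.
- apply: (mulIf nt).
  have -> : s * (1 - 2 * w' * (t / (2 - t ^+ 2))) * (2 - t ^+ 2) =
    s * (2 - t ^+ 2 - 2 * w' * t) by field.
  by move: k1; rewrite w'eta; lra.
- apply: (mulIf ns).
  have -> : t * (1 - 2 * w * (s / (2 - s ^+ 2))) * (2 - s ^+ 2) =
    t * (2 - s ^+ 2 - 2 * w * s) by field.
  by move: k2; rewrite w'eta; lra.
- apply: (mulIf ns); rewrite [RHS]mulrC -prod; field=> //.
Qed.

Lemma case3_rates : let kA := w * (1 - s) / (1 + s) in let k := w' * (1 - t) / (1 + t) in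
  [/\ 0 < k, kA * (2 + s) = k * (2 + t) &
    kA * (2 * - ln (s / (2 - s ^+ 2)) + s * - ln (s ^+ 2 / (2 - s ^+ 2))) +
    k * (2 * - ln (t / (2 - t ^+ 2)) + t * - ln (t ^+ 2 / (2 - t ^+ 2))) =
    kA * eta s + k * eta t].
Proof.
move=> kA k.
have k0 : 0 < k.
  have h1 := t0; case/andP: (t01) => _ h2.
  by rewrite /k !mulr_gt0 ?invr_gt0 ?subr_gt0 // addr_gt0.
(* This is the meaning of [eqn]: the two factors produce letters at equal rates. *)
have kk : kA * (2 + s) = k * (2 + t).
  apply: (mulIf n1s); apply: (mulIf n1t); rewrite /kA /k.
  have -> : w * (1 - s) / (1 + s) * (2 + s) * (1 + s) * (1 + t) =
    w * (1 - s) * (2 + s) * (1 + t) by field.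
  by rewrite eqn; field.
split=> //.
have [e1 e2 e3] := lnD_split t01; have [f1 f2 f3] := lnD_split s01.
have Ss : 0 < 2 * s + s ^+ 2 by rewrite addr_gt0 ?mulr_gt0 ?exprn_gt0.
have St : 0 < 2 * t + t ^+ 2 by rewrite addr_gt0 ?mulr_gt0 ?exprn_gt0.
have lp : ln (2 - s ^+ 2) = ln s + ln (2 + s) + (ln t + ln (2 + t)) - ln (2 - t ^+ 2).
  rewrite -e3 -f3 -lnM ?posrE // prod lnM ?posrE //; ring.
rewrite e1 e2 f1 f2 lp /eta.
have -> : kA = k * (2 + t) / (2 + s).
  by rewrite -kk mulfK // lt0r_neq0 //; have := s0; lra.
by field; rewrite lt0r_neq0 //; have := s0; lra.
Qed.

End Rates.
End Case3.

(** * Entropy inequalities *)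

Section Inequalities.
Variable R : realType.

Lemma ln_lt_sub1 (x : R) : 0 < x -> x != 1 -> ln x < x - 1.
Proof.
move=> x0 x1; have : ln x != 0 by rewrite ln_eq0.
by move/expR_gt1Dx; rewrite lnK ?posrE // ltrBrDl.
Qed.

Lemma ln_ge_1subV (x : R) : 0 < x -> 1 - x^-1 <= ln x.
Proof.
move=> x0; have := @ln_le_sub1 R x^-1; rewrite invr_gt0 lnV ?posrE // => /(_ x0); lra.
Qed.

(** * Tangents of the concave function [eta] *)

Section Gibbs.
Variables t r : R.
Hypothesis t0 : 0 < t.
Hypothesis r0 : 0 < r.
Let l := (2 + t) / (2 + r).
Let t2 : 0 < 2 + t. Proof. by have := t0; lra. Qed.
Let r2 : 0 < 2 + r. Proof. by have := r0; lra. Qed.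
Let l0 : 0 < l. Proof. by rewrite divr_gt0. Qed.

Let gap : (2 + t) * ln (2 + r) - t * ln r - eta t = - t * ln (r * l / t) - 2 * ln l.
Proof.
have e1 : ln l = ln (2 + t) - ln (2 + r) by rewrite /l ln_div ?posrE.
have e2 : ln (r * l / t) = ln r + ln l - ln t.
  by rewrite -lnM ?posrE // -ln_div ?posrE //; exact: mulr_gt0.
rewrite /eta e2 e1; ring.
Qed.

Let split0 : t * (r * l / t - 1) + 2 * (l - 1) = 0.
Proof. by rewrite /l; field; rewrite !lt0r_neq0. Qed.

(** The right side is the tangent of [eta] at [r]. In [gap] the two logarithms have weights [t] and
    2, and by [split0] their linear bounds cancel exactly. *)
Lemma eta_le : eta t <= (2 + t) * ln (2 + r) - t * ln r.
Proof.
rewrite -subr_ge0 gap.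
have h1 := ln_le_sub1 l0.
have p : 0 < r * l / t by rewrite divr_gt0 // mulr_gt0.
have h2 := ler_wpM2l (ltW t0) (ln_le_sub1 p).
by have := split0; lra.
Qed.

Lemma eta_lt : t != r -> eta t < (2 + t) * ln (2 + r) - t * ln r.
Proof.
move=> tr; rewrite -subr_gt0 gap.
have l1 : l != 1.
  apply: contra tr => /eqP e; have : l * (2 + r) = 2 + t by rewrite divfK ?lt0r_neq0.
  by rewrite e mul1r => /addrI ->.
have h1 := ln_lt_sub1 l0 l1.
have p : 0 < r * l / t by rewrite divr_gt0 // mulr_gt0.
have h2 := ler_wpM2l (ltW t0) (ln_le_sub1 p).
by have := split0; lra.
Qed.

End Gibbs.

(** The tangent at [t] lies above [eta] and has slope [ln (2 + t) - ln t >= 0]. *)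
Lemma eta_increasing (r t : R) : 0 < r -> r <= t -> eta r <= eta t.
Proof.
move=> r0 rt; have t0 := lt_le_trans r0 rt.
apply: le_trans (eta_le r0 t0) _; rewrite -subr_ge0 /eta.
have -> : (2 + t) * ln (2 + t) - t * ln t - ((2 + r) * ln (2 + t) - r * ln t) =
  (t - r) * (ln (2 + t) - ln t) by ring.
rewrite mulr_ge0 ?subr_ge0 // ler_ln ?posrE //; lra.
Qed.

(** * The Lagrange function and its maximum *)

Section Golden.
Variable phi : R.
Hypothesis phi_gt1 : 1 < phi.
Hypothesis phi_sqr : phi ^+ 2 = phi + 1.
Let x0 := phi - 1.
Let lphi := ln phi.
(** [c] is the value of [eta x / (2 + 2 x)] at [x0], the expected maximum of entropy over drift;
    [lam] is the multiplier for which the derivative of [D] vanishes at [x0]. *)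
Let c := (2 + phi) / 2 * lphi.
Let lam := (phi - 1) / (2 + phi) * lphi.

Let phi_lt2 : phi < 2.
Proof.
rewrite -(ltr_pXn2r (n := 2)) ?nnegrE //; have := phi_gt1; have := phi_sqr; nra.
Qed.
Let phi0 : 0 < phi. Proof. by have := phi_gt1; lra. Qed.
Let x0_gt0 : 0 < x0. Proof. by rewrite subr_gt0. Qed.
Let x0V : x0 = phi^-1.
Proof.
apply: (mulIf (lt0r_neq0 phi0)); rewrite mulVf ?lt0r_neq0 // /x0.
by have := phi_sqr; lra.
Qed.
Let lphi_gt0 : 0 < lphi. Proof. exact: ln_gt0. Qed.
Let lphi_lt1 : lphi < 1.
Proof. by have := ln_le_sub1 phi0; have := phi_lt2; rewrite -/lphi; lra. Qed.
(** On []0, 1]] the logarithms in [dD] have slope [- 2 / (x (2 + x)) <= - 2 / 3], while the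
    multiplier term has slope at most [2 lam]. Below one third the logarithms win, and [dD] changes
    sign only at [x0]. *)
Let lam_lt : lam < 3^-1.
Proof.
have p2 : 0 < 2 + phi by have := phi0; lra.
rewrite /lam mulrAC ltr_pdivrMr //.
have h : (phi - 1) * lphi < 1.
  rewrite -[X in _ < X]mulr1; apply: ltr_pM => //; [exact: ltW|exact: ltW|].
  by have := phi_lt2; lra.
by have := phi_gt1; lra.
Qed.
Let lam_ge0 : 0 <= lam.
Proof.
by rewrite /lam mulr_ge0 ?ltW // divr_gt0 //; have := phi0; lra.
Qed.

Let D (x : R) := eta x - c * (2 + 2 * x) - lam * ((1 + x)^-1 + 2 - (1 + x) ^+ 2).
Let dD (x : R) := ln (2 + x) - ln x - 2 * c + lam * ((1 + x) ^- 2 + 2 * (1 + x)).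

Let lnx0 : ln x0 = - lphi. Proof. by rewrite x0V lnV ?posrE. Qed.
Let ln2x0 : ln (2 + x0) = 2 * lphi.
Proof.
have -> : 2 + x0 = phi ^+ 2 by rewrite phi_sqr /x0; ring.
by rewrite lnXn // mulr_natl.
Qed.

Lemma golden_D0 : D x0 = 0.
Proof.
rewrite /D /eta lnx0 ln2x0 /c.
have -> : 1 + x0 = phi by rewrite /x0; ring.
have -> : phi^-1 + 2 - phi ^+ 2 = 0 by rewrite -x0V /x0 phi_sqr; ring.
have -> : (2 + x0) * (2 * lphi) - x0 * - lphi - (2 + phi) / 2 * lphi * (2 + 2 * x0) - lam * 0 =
  lphi * (phi + 1 - phi ^+ 2) by rewrite /x0; field.
by rewrite phi_sqr subrr mulr0.
Qed.

Let dD0 : dD x0 = 0.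
Proof.
rewrite /dD lnx0 ln2x0 /c /lam.
have -> : 1 + x0 = phi by rewrite /x0; ring.
have -> : phi ^- 2 = 2 - phi.
  have p2 : phi ^+ 2 != 0 by rewrite lt0r_neq0 // exprn_gt0.
  apply: (mulIf p2); rewrite mulVf //.
  have -> : (2 - phi) * phi ^+ 2 = 1 + (phi + 1 - phi ^+ 2) * (phi - 1) by ring.
  by rewrite phi_sqr subrr mul0r addr0.
field; rewrite lt0r_neq0 //; have := phi0; lra.
Qed.

Let wdiff (x y : R) : 0 < x -> x < y ->
  ((1 + y) ^- 2 + 2 * (1 + y)) - ((1 + x) ^- 2 + 2 * (1 + x)) <= 2 * (y - x).
Proof.
move=> x_gt0 xy; have : (1 + y) ^- 2 <= (1 + x) ^- 2; last by lra.
rewrite lef_pV2 ?posrE ?exprn_gt0 //; try lra.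
by rewrite lerXn2r ?nnegrE //; lra.
Qed.

Let dD_ge0 x : 0 < x < x0 -> 0 <= dD x.
Proof.
case/andP=> x_gt0 xx0; rewrite -[X in X <= _]dD0 /dD.
have w := ler_wpM2l lam_ge0 (wdiff x_gt0 xx0).
have y0 : 0 < (2 + x) * x0 / (x * (2 + x0)).
  by rewrite divr_gt0 ?mulr_gt0 //; have := x0_gt0; lra.
have := ln_ge_1subV y0.
rewrite ln_div ?posrE ?mulr_gt0 //; try by have := x0_gt0; lra.
rewrite !lnM ?posrE //; try by have := x0_gt0; lra.
have -> : 1 - ((2 + x) * x0 / (x * (2 + x0)))^-1 = 2 * (x0 - x) / (x0 * (2 + x)).
  by field; rewrite !lt0r_neq0 //; have := x0_gt0; lra.
have : lam * (2 * (x0 - x)) <= 2 * (x0 - x) / (x0 * (2 + x)).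
  rewrite mulrC ler_wpM2l //; first by lra.
  apply: le_trans (ltW lam_lt) _.
  have p1 : 0 < x0 * (2 + x) by rewrite mulr_gt0 //; lra.
  rewrite lef_pV2 ?posrE //.
  have x01 : x0 < 1 by have := phi_lt2; rewrite /x0; lra.
  have : x0 * (2 + x) <= 1 * (2 + x) by rewrite ler_wpM2r //; lra.
  by lra.
by lra.
Qed.

Let dD_le0 x : x0 < x <= 1 -> dD x <= 0.
Proof.
case/andP=> xx0 x1; rewrite -[X in _ <= X]dD0 /dD.
have x_gt0 := lt_trans x0_gt0 xx0.
have w := ler_wpM2l lam_ge0 (wdiff x0_gt0 xx0).
have y0 : 0 < (2 + x) * x0 / (x * (2 + x0)).
  by rewrite divr_gt0 ?mulr_gt0 //; have := x0_gt0; lra.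
have := ln_le_sub1 y0.
rewrite ln_div ?posrE ?mulr_gt0 //; try by have := x0_gt0; lra.
rewrite !lnM ?posrE //; try by have := x0_gt0; lra.
have -> : (2 + x) * x0 / (x * (2 + x0)) - 1 = - (2 * (x - x0) / (x * (2 + x0))).
  by field; rewrite !lt0r_neq0 //; have := x0_gt0; lra.
have : lam * (2 * (x - x0)) <= 2 * (x - x0) / (x * (2 + x0)).
  rewrite mulrC ler_wpM2l //; first by lra.
  apply: le_trans (ltW lam_lt) _.
  have p1 : 0 < x * (2 + x0) by rewrite mulr_gt0 //; have := x0_gt0; lra.
  rewrite lef_pV2 ?posrE //.
  have x01 : x0 < 1 by have := phi_lt2; rewrite /x0; lra.
  have : x * (2 + x0) <= 1 * (2 + x0) by rewrite ler_wpM2r //; have := x0_gt0; lra.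
  by lra.
by lra.
Qed.

Let D_derive (x : R) : 0 < x -> is_derive x 1 D (dD x).
Proof.
move=> x_gt0; have p2 : 0 < 2 + x by lra.
have p1 : 0 < 1 + x by lra.
have dA (f g : R -> R) a b : is_derive x (1 : R) f a -> is_derive x (1 : R) g b ->
    is_derive x (1 : R) (fun y => f y + g y) (a + b) by move=> ??; exact: is_deriveD.
have dN (f : R -> R) a : is_derive x (1 : R) f a ->
    is_derive x (1 : R) (fun y => - f y) (- a) by move=> ?; exact: is_deriveN.
have dM (f g : R -> R) a b : is_derive x (1 : R) f a -> is_derive x (1 : R) g b ->
    is_derive x (1 : R) (fun y => f y * g y) (f x *: b + g x *: a).
  by move=> ??; exact: is_deriveM.
have dC (a : R) : is_derive x (1 : R) (fun _ => a) 0 by exact: is_derive_cst.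
have dI : is_derive x (1 : R) (fun y : R => y) 1 by exact: is_derive_id.
have dl := is_derive1_ln x_gt0.
have d2 := dA _ _ _ _ (dC 2) dI; have d1 := dA _ _ _ _ (dC 1) dI.
have dl2 : is_derive x (1 : R) (fun y : R => ln (2 + y)) ((2 + x)^-1 * (0 + 1)).
  exact: (@is_derive1_comp _ (@ln R) (fun y : R => 2 + y) x _ _ (is_derive1_ln p2) d2).
have dv := is_deriveV (f := fun y : R => 1 + y) (lt0r_neq0 p1) d1.
have dE := dA _ _ _ _ (dM _ _ _ _ d2 dl2) (dN _ _ (dM _ _ _ _ dI dl)).
have dc := dN _ _ (dM _ _ _ _ (dC c) (dA _ _ _ _ (dC 2) (dM _ _ _ _ (dC 2) dI))).
have dq := dN _ _ (dM _ _ _ _ (dC lam) (dA _ _ _ _ (dA _ _ _ _ dv (dC 2))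
  (dN _ _ (dM _ _ _ _ d1 d1)))).
apply: (is_derive_eq (dA _ _ _ _ (dA _ _ _ _ dE dc) dq)).
rewrite /dD /GRing.scale /=; field.
by rewrite !lt0r_neq0.
Qed.

Lemma golden_D_le0 (x : R) : 0 < x < 1 -> D x <= 0.
Proof.
case/andP=> x_gt0 x1; rewrite -golden_D0.
have cont a b : 0 < a -> {within `[a, b], continuous D}.
  move=> a0; apply: derivable_within_continuous => y; rewrite in_itv /= => /andP[ay _].
  by apply: ex_derive; apply: D_derive; exact: lt_le_trans ay.
have [xx|xx|->] := ltgtP x x0; last by [].
  have der y : y \in `]x, x0[ -> is_derive y 1 D (dD y).
    by rewrite in_itv /= => /andP[h _]; apply: D_derive; exact: lt_trans h.
  have [y yI e] := MVT xx der (cont _ _ x_gt0).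
  rewrite -subr_ge0 e; apply: mulr_ge0; last by rewrite subr_ge0 ltW.
  by apply: dD_ge0; move: yI; rewrite in_itv /= => /andP[h ->]; rewrite (lt_trans x_gt0 h).
have der y : y \in `]x0, x[ -> is_derive y 1 D (dD y).
  by rewrite in_itv /= => /andP[h _]; apply: D_derive; exact: lt_trans h.
have [y yI e] := MVT xx der (cont _ _ x0_gt0).
rewrite -subr_le0 e; apply: mulr_le0_ge0; last by rewrite subr_ge0 ltW.
by apply: dD_le0; move: yI; rewrite in_itv /= => /andP[-> h]; rewrite ltW // (lt_trans h).
Qed.

End Golden.
End Inequalities.

(** * Comparing powers of the two quadratic units *)

Module FloatPower.
Import NArith.
Import mathcomp.algebra_tactics.ring mathcomp.algebra_tactics.lra.

(* (m, e) stands for m * 2 ^ e / 2 ^ 40; the mantissa keeps about 41 bits. *)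
Definition float : Type := N * N.
Definition p40 : N := N.of_nat 40.
Definition p80 : N := N.of_nat 80.
(** A product of two significands carries the scale [2 ^ 80]; the bits beyond it go to the exponent,
    which keeps the mantissas short. *)
Definition excess (m : N) : N := N.sub (N.log2 m) p80.

Definition mul_up (a b : float) : float :=
  let m := N.mul a.1 b.1 in let d := excess m in
  (N.succ (N.div m (N.pow 2 (N.add p40 d))), N.add (N.add a.2 b.2) d).
Definition mul_down (a b : float) : float :=
  let m := N.mul a.1 b.1 in let d := excess m in
  (N.div m (N.pow 2 (N.add p40 d)), N.add (N.add a.2 b.2) d).

Section Pow.
Variable mul : float -> float -> float.
Fixpoint fpow (a : float) (p : positive) : float :=
  match p with
  | xH => a
  | xO q => let r := fpow a q in mul r r
  | xI q => let r := fpow a q in mul (mul r r) a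
  end.
End Pow.

Section Correct.
Variable R : realType.
Definition nr (n : N) : R := (N.to_nat n)%:R.
Definition T : R := 2 ^+ 40.

Lemma nrM a b : nr (N.mul a b) = nr a * nr b.
Proof. by rewrite /nr Nnat.N2Nat.inj_mul multE -natrM. Qed.
Lemma nrD a b : nr (N.add a b) = nr a + nr b.
Proof. by rewrite /nr Nnat.N2Nat.inj_add plusE -natrD. Qed.
Lemma nr_ge0 a : 0 <= nr a. Proof. exact: ler0n. Qed.
Lemma nr_pow a : nr (N.pow 2 a) = 2 ^+ N.to_nat a.
Proof.
elim/N.peano_ind: a => [|a IH]; first by rewrite expr0.
by rewrite N.pow_succ_r' nrM IH Nnat.N2Nat.inj_succ exprS.
Qed.
Lemma nr_le a b : N.leb a b = true -> nr a <= nr b.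
Proof.
move=> /N.leb_le h; rewrite /nr ler_nat; apply/ssrnat.leP.
by apply/PeanoNat.Nat.compare_le_iff; rewrite -Nnat.N2Nat.inj_compare; exact: h.
Qed.

Definition value (a : float) : R := nr a.1 * 2 ^+ N.to_nat a.2.

Lemma div_bounds m s :
  nr (N.div m (N.pow 2 s)) * 2 ^+ N.to_nat s <= nr m <=
  nr (N.succ (N.div m (N.pow 2 s))) * 2 ^+ N.to_nat s.
Proof.
have n0 : N.pow 2 s <> N0 by apply: N.pow_nonzero.
rewrite -nr_pow -!nrM; apply/andP; split; apply: nr_le; apply/N.leb_le.
  by rewrite N.mul_comm; apply: N.Div0.mul_div_le.
by rewrite N.mul_comm; apply: N.lt_le_incl; apply: N.mul_succ_div_gt.
Qed.

Lemma to_nat_excess d : 2 ^+ N.to_nat (N.add p40 d) = T * 2 ^+ N.to_nat d.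
Proof. by rewrite Nnat.N2Nat.inj_add plusE exprD /p40 Nnat.Nat2N.id. Qed.

Lemma T_gt0 : 0 < T. Proof. by rewrite /T exprn_gt0. Qed.

Lemma mul_upP a b (x y : R) : 0 <= x -> 0 <= y -> x * T <= value a -> y * T <= value b ->
  x * y * T <= value (mul_up a b).
Proof.
move=> x0 y0 xa yb; have t0 := T_gt0; have t0' := ltW t0.
rewrite -(ler_pM2r t0) /value /mul_up; cbn [fst snd].
set d := excess _; set m := N.mul _ _.
rewrite !Nnat.N2Nat.inj_add !plusE !exprD.
have /andP[_ h] := div_bounds m (N.add p40 d); rewrite to_nat_excess in h.
apply: le_trans (_ : value a * value b <= _).
  have -> : x * y * T * T = (x * T) * (y * T) :> R by ring.
  by apply: ler_pM => //; apply: mulr_ge0.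
rewrite /value.
have -> : nr a.1 * 2 ^+ N.to_nat a.2 * (nr b.1 * 2 ^+ N.to_nat b.2) =
  nr m * (2 ^+ N.to_nat a.2 * 2 ^+ N.to_nat b.2) :> R by rewrite nrM mulrACA.
apply: le_trans (ler_wpM2r _ h) _; first by rewrite mulr_ge0 ?exprn_ge0.
set q := nr _; rewrite le_eqVlt; apply/orP; left; apply/eqP; ring.
Qed.

Lemma mul_downP a b (x y : R) : 0 <= x -> 0 <= y -> value a <= x * T -> value b <= y * T ->
  value (mul_down a b) <= x * y * T.
Proof.
move=> x0 y0 xa yb; have t0 := T_gt0; have t0' := ltW t0.
rewrite -(ler_pM2r t0) /value /mul_down; cbn [fst snd].
set d := excess _; set m := N.mul _ _.
rewrite !Nnat.N2Nat.inj_add !plusE !exprD.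
have /andP[h _] := div_bounds m (N.add p40 d); rewrite to_nat_excess in h.
apply: le_trans (_ : value a * value b <= _); last first.
  have -> : x * y * T * T = (x * T) * (y * T) :> R by ring.
  by apply: ler_pM => //; rewrite mulr_ge0 ?nr_ge0 ?exprn_ge0.
rewrite /value.
have -> : nr a.1 * 2 ^+ N.to_nat a.2 * (nr b.1 * 2 ^+ N.to_nat b.2) =
  nr m * (2 ^+ N.to_nat a.2 * 2 ^+ N.to_nat b.2) :> R by rewrite nrM mulrACA.
apply: le_trans (ler_wpM2r _ h); last by rewrite mulr_ge0 ?exprn_ge0.
set q := nr _; rewrite le_eqVlt; apply/orP; left; apply/eqP; ring.
Qed.

Lemma to_nat_xO p : Pos.to_nat (xO p) = addn (Pos.to_nat p) (Pos.to_nat p).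
Proof. by rewrite Pnat.Pos2Nat.inj_xO multE mul2n addnn. Qed.

Lemma to_nat_xI p : Pos.to_nat (xI p) = S (addn (Pos.to_nat p) (Pos.to_nat p)).
Proof. by rewrite Pnat.Pos2Nat.inj_xI multE mul2n addnn. Qed.

Lemma fpow_up a (x : R) p : 0 <= x -> x * T <= value a ->
  x ^+ Pos.to_nat p * T <= value (fpow mul_up a p).
Proof.
move=> x0 xa; elim: p => [p IH|p IH|]; last by rewrite expr1.
  rewrite to_nat_xI exprSr exprD /=.
  by apply: mul_upP => //; [rewrite mulr_ge0 ?exprn_ge0|apply: mul_upP; rewrite ?exprn_ge0].
by rewrite to_nat_xO exprD /=; apply: mul_upP; rewrite ?exprn_ge0.
Qed.

Lemma fpow_down a (x : R) p : 0 <= x -> value a <= x * T ->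
  value (fpow mul_down a p) <= x ^+ Pos.to_nat p * T.
Proof.
move=> x0 xa; elim: p => [p IH|p IH|]; last by rewrite expr1.
  rewrite to_nat_xI exprSr exprD /=.
  by apply: mul_downP => //; [rewrite mulr_ge0 ?exprn_ge0|apply: mul_downP; rewrite ?exprn_ge0].
by rewrite to_nat_xO exprD /=; apply: mul_downP; rewrite ?exprn_ge0.
Qed.

Lemma sqrt_le_nr (n a b : N) : N.leb (N.mul n (N.mul b b)) (N.mul a a) = true ->
  Num.sqrt (nr n) * nr b <= nr a.
Proof.
move/nr_le; rewrite !nrM => h.
rewrite -(ler_pXn2r (n := 2)) ?nnegrE ?mulr_ge0 ?sqrtr_ge0 ?nr_ge0 //.
by rewrite exprMn sqr_sqrtr ?nr_ge0 // !expr2.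
Qed.

Lemma sqrt_ge_nr (n a b : N) : N.leb (N.mul a a) (N.mul n (N.mul b b)) = true ->
  nr a <= Num.sqrt (nr n) * nr b.
Proof.
move/nr_le; rewrite !nrM => h.
rewrite -(ler_pXn2r (n := 2)) ?nnegrE ?mulr_ge0 ?sqrtr_ge0 ?nr_ge0 //.
by rewrite exprMn sqr_sqrtr ?nr_ge0 // !expr2.
Qed.

(* The significands of 1 + sqrt 2 and (1 + sqrt 5) / 2, rounded down. *)
Definition silver_n : N := N.add (N.pow 2 p40) (N.sqrt (N.pow 2 (N.succ p80))).
Definition golden_n : N :=
  N.add (N.pow 2 (N.pred p40)) (N.sqrt (N.mul (N.of_nat 5) (N.pow 2 (N.of_nat 78)))).

Lemma nr2 : nr 2 = 2. Proof. by []. Qed.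
Lemma nr5 : nr (N.of_nat 5) = 5. Proof. by []. Qed.

Lemma TE : T = nr (N.pow 2 p40).
Proof.
have e : N.to_nat p40 = 40 by [].
by rewrite nr_pow e.
Qed.
Lemma T2E : T = 2 * nr (N.pow 2 (N.pred p40)).
Proof.
have e : N.to_nat (N.pred p40) = 39 by [].
by rewrite nr_pow e /T exprS.
Qed.

Lemma half_expand (r a : R) : (2^-1 + r / 2) * (2 * a) = a + r * a.
Proof. by field. Qed.

Lemma silver_down : value (silver_n, N0) <= (1 + Num.sqrt 2) * T.
Proof.
rewrite /value; cbn [fst snd]; rewrite expr0 mulr1 /silver_n nrD mulrDl mul1r TE lerD2l -nr2.
by apply: sqrt_ge_nr; vm_compute.
Qed.

Lemma silver_up : (1 + Num.sqrt 2) * T <= value (N.succ silver_n, N0).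
Proof.
rewrite /value; cbn [fst snd]; rewrite expr0 mulr1 /silver_n -N.add_succ_r nrD mulrDl mul1r TE lerD2l -nr2.
by apply: sqrt_le_nr; vm_compute.
Qed.

Lemma golden_down : value (golden_n, N0) <= (2^-1 + Num.sqrt 5 / 2) * T.
Proof.
rewrite /value; cbn [fst snd]; rewrite expr0 mulr1 /golden_n nrD T2E.
rewrite half_expand lerD2l -nr5.
by apply: sqrt_ge_nr; vm_compute.
Qed.

Lemma golden_up : (2^-1 + Num.sqrt 5 / 2) * T <= value (N.succ golden_n, N0).
Proof.
rewrite /value; cbn [fst snd]; rewrite expr0 mulr1 /golden_n -N.add_succ_r nrD T2E.
rewrite half_expand lerD2l -nr5.
by apply: sqrt_le_nr; vm_compute.
Qed.

Lemma value_le a b : N.eqb a.2 b.2 && N.leb a.1 b.1 = true -> value a <= value b.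
Proof.
case/andP=> /N.eqb_eq e /nr_le h; rewrite /value e.
by rewrite ler_wpM2r ?exprn_ge0.
Qed.

(** One power is rounded up and the other down at every multiplication. Equality of the exponents is
    part of the test, so comparing mantissas decides. *)
Lemma nat_pow_le (x y : R) a b p q : 0 <= x -> 0 <= y ->
  x * T <= value a -> value b <= y * T ->
  (N.eqb (fpow mul_up a p).2 (fpow mul_down b q).2 &&
     N.leb (fpow mul_up a p).1 (fpow mul_down b q).1) = true ->
  x ^+ Pos.to_nat p <= y ^+ Pos.to_nat q.
Proof.
move=> x0 y0 xa yb h; rewrite -(ler_pM2r T_gt0).
apply: le_trans (fpow_up p x0 xa) _; apply: le_trans (fpow_down q y0 yb).
exact: value_le.
Qed.

Let silver_ge0 : (0 : R) <= 1 + Num.sqrt 2. Proof. by rewrite addr_ge0. Qed.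
Let golden_ge0 : (0 : R) <= 2^-1 + Num.sqrt 5 / 2.
Proof. by rewrite addr_ge0 ?divr_ge0. Qed.

(** [10497 / 19226] approximates the ratio of the two logarithms from below to within [10 ^ -9].
    Such precision is called for: [Q] exceeds [0.987686] by less than [2 * 10 ^ -8]. *)
Lemma silver_le_golden : (1 + Num.sqrt 2) ^+ Pos.to_nat 10497%positive <=
  (2^-1 + Num.sqrt 5 / 2) ^+ Pos.to_nat 19226%positive :> R.
Proof.
by apply: (nat_pow_le silver_ge0 golden_ge0 silver_up golden_down); vm_compute.
Qed.

(** The upper bound [0.987687] leaves more room, so the coarser fraction [1134 / 2077] suffices. *)
Lemma golden_le_silver : (2^-1 + Num.sqrt 5 / 2) ^+ Pos.to_nat 2077%positive <=
  (1 + Num.sqrt 2) ^+ Pos.to_nat 1134%positive :> R.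
Proof.
by apply: (nat_pow_le golden_ge0 silver_ge0 golden_up silver_down); vm_compute.
Qed.

Lemma ln_of_pow_le (x y : R) p q : 0 < x -> 0 < y ->
  x ^+ Pos.to_nat p <= y ^+ Pos.to_nat q ->
  nr (Npos p) * ln x <= nr (Npos q) * ln y.
Proof.
move=> x0 y0; rewrite -ler_ln ?posrE ?exprn_gt0 // !lnXn // /nr.
by rewrite !mulr_natl.
Qed.

Lemma nr1000 : nr 1000 = 10 ^+ 3.
Proof. by rewrite (_ : 1000 = 10 * (10 * 10))%N // !nrM (_ : nr 10 = 10) // -expr2 -exprS. Qed.

Lemma nr10497 : nr 10497 = 10 * 10 ^+ 3 + 497.
Proof. by rewrite (_ : 10497 = 10 * 1000 + 497)%N // nrD nrM nr1000. Qed.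

Lemma nr19226 : nr 19226 = 19 * 10 ^+ 3 + 226.
Proof. by rewrite (_ : 19226 = 19 * 1000 + 226)%N // nrD nrM nr1000. Qed.

Lemma nr2077 : nr 2077 = 2 * 10 ^+ 3 + 77.
Proof. by rewrite (_ : 2077 = 2 * 1000 + 77)%N // nrD nrM nr1000. Qed.

Lemma nr1134 : nr 1134 = 10 ^+ 3 + 134.
Proof. by rewrite (_ : 1134 = 1000 + 134)%N // nrD nr1000. Qed.

End Correct.
End FloatPower.

Section LogRatio.
Variable R : realType.
Import FloatPower.
Local Notation s5 := (Num.sqrt 5 : R).
Local Notation golden := (2^-1 + s5 / 2).
Local Notation silver := (1 + Num.sqrt 2 : R).

Lemma sqrt5_bounds :
  2236 / 10 ^+ 3 + 67 / 10 ^+ 6 + 977 / 10 ^+ 9 <= s5 <= 2236 / 10 ^+ 3 + 68 / 10 ^+ 6.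
Proof.
have s0 : 0 <= s5 by exact: sqrtr_ge0.
have ss : s5 ^+ 2 = 5 by apply: sqr_sqrtr; lra.
set a := _ + _ / 10 ^+ 9; set b := _ + 68 / _.
have a0 : 0 <= a by rewrite /a; lra.
have b0 : 0 <= b by rewrite /b; lra.
apply/andP; split; rewrite -(ler_pXn2r (n := 2)) ?nnegrE // ss /a /b; lra.
Qed.

Lemma log_ratio_bounds :
  987 / 10 ^+ 3 + 686 / 10 ^+ 6 <= (5 + s5) / 4 * (ln golden / ln silver)
    < 987 / 10 ^+ 3 + 687 / 10 ^+ 6.
Proof.
have /andP[l5 u5] := sqrt5_bounds.
have s2 : 0 < Num.sqrt 2 :> R by rewrite sqrtr_gt0.
have g0 : 0 < golden by lra.
have sv0 : 0 < silver by lra.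
have lnS : 0 < ln silver by apply: ln_gt0; lra.
have lo := ln_of_pow_le sv0 g0 (@silver_le_golden R).
have up := ln_of_pow_le g0 sv0 (@golden_le_silver R).
rewrite nr10497 nr19226 in lo; rewrite nr2077 nr1134 in up.
set L := ln golden in lo up *; set M := ln silver in lnS lo up *.
rewrite mulrA ler_pdivlMr // ltr_pdivrMr //.
have L0 : 0 < L by apply: ln_gt0; lra.
(* Bounding the product of [s5] and [L] beforehand leaves inequalities that are linear in [L], [M]
   and this product. *)
have h1 : 0 <= (s5 - (2236 / 10 ^+ 3 + 67 / 10 ^+ 6 + 977 / 10 ^+ 9)) * L.
  by apply: mulr_ge0; [rewrite subr_ge0|exact: ltW].
have h2 : 0 <= (2236 / 10 ^+ 3 + 68 / 10 ^+ 6 - s5) * L.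
  by apply: mulr_ge0; [rewrite subr_ge0|exact: ltW].
apply/andP; split; lra.
Qed.

End LogRatio.

(** * The three free products *)

Lemma sup_eq_max (R : realType) (E : set R) (x : R) :
  E x -> (forall y, E y -> y <= x) -> sup E = x.
Proof.
move=> Ex ub; apply/eqP; rewrite eq_le; apply/andP; split.
  by apply: ge_sup; [exists x|].
by apply: ub_le_sup => //; exists x.
Qed.

(** * Z/2 * Z/4: the supremum 1 is not attained *)

Section Z2Z4.
Variables (R : realType) (G : groupType) (i : 'Z_2 -> G) (j : 'Z_4 -> G) (v : 'Z_4).
Hypothesis free : is_free_product i j.
Hypothesis vg : v = z41 \/ v = z43.
Local Notation u := z21.
Local Notation S := (gens i j u v).

Let u1 : u != 1%g. Proof. by []. Qed.
Let v1 : v != 1%g. Proof. by case: vg => ->. Qed.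
Let gu : u = z21. Proof. by []. Qed.
Let gu' : (u^-1)%g = z21. Proof. by rewrite mulZ2. Qed.
Let stepA x : x = z21 -> forall y, (ell2 (y * x)%g <= (ell2 y).+1)%N.
Proof. by move=> h y; exact: Z2_step. Qed.
Let lA : factor_length i S ell2.
Proof. by apply: Z2_length; [case: free|left; left; left]. Qed.
Let sumB (w : R) : \sum_b step_weight v w b = 2 * w.
Proof. by rewrite Z4_step_weight // sum_Z4 /stepZ4 /tab /=; ring. Qed.
Let sumA (w : R) : \sum_a step_weight u w a = w.
Proof. by rewrite Z2_step_weight sum_Z2 /stepZ2 /tab /= add0r. Qed.

Lemma Z2Z4_volume (r : R) : 0 < r < 1 -> r ^+ 2 + r - 1 = 0 -> volume R S = - ln r.
Proof.
move=> r01 e; apply: (gens_volume free vg gu gu' stepA lA r01).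
rewrite sum1_Z2 /ell2 /tab /= expr1.
have -> : r * (2 * r + r ^+ 2) = (r ^+ 2 + r - 1) * (r + 1) + 1 by ring.
by rewrite e mul0r add0r.
Qed.

Lemma Z2Z4_rates (w w' t : R) : 0 < w < 1 -> w + 2 * w' = 1 -> 0 < t < 1 ->
  (1 + w) * t ^+ 2 + (1 + w) * t - 2 = 0 ->
  exists2 k, 0 < k & entropy (step_law i j u v w w') = k * eta t /\
    drift S (step_law i j u v w w') = k * (4 + 3 * t).
Proof.
move=> w01 ww t01 te.
have [w0 w1] := andP w01; have w0' : 0 < w' by lra.
have s01 := case1_s01 t01 te w01.
have [e1 e2 e3] := case1_eqs t01 ww te.
have [k0 eE eD] := case1_rates t01 ww te w01.
set s := (_ / _) in s01 e1 e2 e3 eE eD.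
set y := (t / _) in e1 eE; set M := 2 * w' * y.
have wA : factor_weights (step_weight u w) by rewrite Z2_step_weight; exact/Z2_weights/ltW.
have wAB : \sum_a step_weight u w a + 2 * w' = 1 by rewrite sumA.
have gA : factor_green (step_weight u w) (hitZ2 s) M.
  by rewrite Z2_step_weight; exact: Z2_green.
have xE : \sum_a step_weight u w a * hitZ2 s a = w * s.
  by rewrite Z2_step_weight Z2_green_sum.
have FS : (\sum_(a | a != 1%g) hitZ2 s a) * (2 * t + t ^+ 2) = 2 - t ^+ 2.
  by rewrite sum1_Z2 /hitZ2 /tab.
have [|k1 [d1 r1]] := Z2_drift s01 e1 (phi := fun a => - ln (hitZ2 s a)).
  by rewrite /hitZ2 /tab /= ln1 oppr0.
have [//|k2 [d2 r2]] := Z2_drift s01 e1 (phi := fun a => (ell2 a)%:R).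
rewrite -Z2_step_weight in d1 r1 d2 r2.
exists (w' * (1 - t) / (1 + t)) => //; split.
  by rewrite (gens_entropy free vg w0' wA wAB t01 gA xE e2 FS d1) r1 -eE.
rewrite (gens_drift free vg gu gu' stepA lA w0' wA wAB t01 gA xE e2 FS d2) r2 -eD.
by rewrite /ell2 /tab /= mulr1.
Qed.

Variable r : R.
Hypothesis r01 : 0 < r < 1.
Hypothesis rE : r ^+ 2 + r - 1 = 0.

Let ln2r : ln (2 + r) = - 2 * ln r.
Proof.
have r0 : 0 < r by case/andP: r01.
have -> : 2 + r = r ^- 2.
  have n2 : r ^+ 2 != 0 by rewrite lt0r_neq0 ?exprn_gt0.
  apply: (mulIf n2); rewrite mulVf //.
  have -> : (2 + r) * r ^+ 2 = (r ^+ 2 + r - 1) * (r + 1) + 1 by ring.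
  by rewrite rE mul0r add0r.
by rewrite lnV ?posrE ?exprn_gt0 // lnXn // mulNr mulr_natl.
Qed.

Let v0 : 0 < - ln r. Proof. by rewrite oppr_gt0; exact: ln_lt0. Qed.

(** The equation of [r] gives [ln (2 + r) = - 2 ln r], which turns the tangent of [eta] at [r] into
    drift times volume, up to the common factor [k] of the rates. *)
Lemma Z2Z4_eta_lt (t : R) : 0 < t -> t != r -> eta t < (4 + 3 * t) * - ln r.
Proof.
move=> t0 tr; have r0 : 0 < r by case/andP: r01.
by have := eta_lt t0 r0 tr; rewrite ln2r; lra.
Qed.

Lemma Z2Z4_eta_ge (t : R) : r <= t -> (4 + 3 * r) * - ln r <= eta t.
Proof.
move=> rt; have r0 : 0 < r by case/andP: r01.
by apply: le_trans (eta_increasing r0 rt); rewrite /eta ln2r; lra.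
Qed.

Lemma Z2Z4_ratio mu : symmetric_laws R S mu ->
  entropy mu / (drift S mu * volume R S) < 1.
Proof.
case/(symmetric_law_step free u1 v1) => w [w' [w0 w0' -> ]].
rewrite sumA sumB => ww; have w01 : 0 < w < 1 by apply/andP; split; lra.
have [||t t01 te] := @quadratic_root R (1 + w) (1 + w) (-2); try lra.
have [k k0 [-> ->]] := Z2Z4_rates w01 ww t01 te.
have t0 : 0 < t by case/andP: t01.
rewrite (Z2Z4_volume r01 rE) ltr_pdivrMr ?mul1r; last first.
  by rewrite !mulr_gt0 //; lra.
rewrite -mulrA ltr_pM2l //; apply: Z2Z4_eta_lt => //.
(* As [r ^+ 2 + r = 1], the equation [te] at [t = r] would force [w = 1], leaving no mass for the
   factor Z/4. *)
apply/eqP => tr; move: te; rewrite tr => te.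
have : w * (r ^+ 2 + r) = 2 - (r ^+ 2 + r) by lra.
have -> : r ^+ 2 + r = 1 by have := rE; lra.
lra.
Qed.

(** Every [t] in []r, 1[] is the parameter of a law, found by solving [te] for [w]. As [eta]
    increases, the ratio stays above a bound that tends to 1 when [t] decreases to [r]. *)
Lemma Z2Z4_witness (t : R) : r < t < 1 -> exists2 mu, symmetric_laws R S mu &
  (4 + 3 * r) / (4 + 3 * t) <= entropy mu / (drift S mu * volume R S).
Proof.
case/andP=> rt t1; have r0 : 0 < r by case/andP: r01.
have t0 := lt_trans r0 rt; have t01 : 0 < t < 1 by rewrite t0.
have tt : 0 < t + t ^+ 2 by rewrite addr_gt0 ?exprn_gt0.
have tt2 : t + t ^+ 2 < 2 by have := sqr_lt_self t01; lra.
have rr : r ^+ 2 < t ^+ 2 by rewrite ltr_pXn2r ?nnegrE ?ltW.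
have tt1 : 1 < t + t ^+ 2 by have := rE; lra.
pose w := (2 - t - t ^+ 2) / (t + t ^+ 2); pose w' := (1 - w) / 2.
have w01 : 0 < w < 1.
  by rewrite /w divr_gt0 ?ltr_pdivrMr //=; lra.
have w0 : 0 < w by case/andP: w01.
have w0' : 0 < w' by rewrite /w' divr_gt0 // subr_gt0; case/andP: w01.
have ww : w + 2 * w' = 1 by rewrite /w'; lra.
have te : (1 + w) * t ^+ 2 + (1 + w) * t - 2 = 0.
  by rewrite /w; field; rewrite lt0r_neq0.
have [k k0 [eE eD]] := Z2Z4_rates w01 ww t01 te.
exists (step_law i j u v w w').
  apply: step_law_symmetric => //; last by rewrite sumA sumB.
  exact: (gens_words free vg gu gu' stepA lA).
rewrite eE eD (Z2Z4_volume r01 rE).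
have p1 : 0 < 4 + 3 * t by lra.
rewrite ler_pdivrMr // mulrAC ler_pdivlMr; last by rewrite !mulr_gt0.
have := ler_wpM2l (ltW (mulr_gt0 k0 p1)) (Z2Z4_eta_ge (ltW rt)).
lra.
Qed.

Lemma Z2Z4_extremal : extremal R S.
Proof.
rewrite /extremal /Qratio; set X := [set _ | _ in _].
have r0 : 0 < r by case/andP: r01.
have r1 : r < 1 by case/andP: r01.
have ub : ubound X 1 by move=> _ [mu muS <-]; apply/ltW/Z2Z4_ratio.
have wit t : r < t < 1 -> (4 + 3 * r) / (4 + 3 * t) <= sup X.
  move=> rt; have [mu muS le] := Z2Z4_witness rt; apply: le_trans le _.
  by apply: ub_le_sup; [exists 1|exists mu].
have sup_le : sup X <= 1.
  have [mu muS _] := Z2Z4_witness (t := (r + 1) / 2) ltac:(apply/andP; split; lra).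
  by apply: ge_sup => //; eexists; exists mu.
apply/eqP; rewrite eq_le sup_le /= leNgt; apply/negP => q1.
have q0 : 0 < sup X.
  apply: lt_le_trans (wit ((r + 1) / 2) _); last by apply/andP; split; lra.
  by rewrite divr_gt0 //; lra.
set q := sup X in q0 q1 sup_le wit.
have d1 : 0 < (1 - r) * (1 - q) by rewrite mulr_gt0 // subr_gt0.
have d2 : 0 < q * (1 - q) by rewrite mulr_gt0 // subr_gt0.
have d3 : (1 - r) * (1 - q) < 1 - r by rewrite gtr_pMr ?subr_gt0 //; lra.
have d4 : (1 - r) * (1 - q) < 1 - q by rewrite gtr_pMl ?subr_gt0 //; lra.
have d5 : q * ((1 - r) * (1 - q)) <= (1 - r) * (1 - q).
  by rewrite -[X in _ <= X]mul1r ler_pM2r // ltW.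
(* For a supremum [q < 1], this choice of [t] would give [4 + 3 r <= 3 q (1 - r) < 3]. *)
have := wit (r + (1 - r) * (1 - q)) ltac:(apply/andP; split; lra).
rewrite ler_pdivrMr; last by lra.
have d6 : 0 < r * (1 - q) by rewrite mulr_gt0 // subr_gt0.
lra.
Qed.

End Z2Z4.

(** * Z/3 * Z/4: a unique optimal law *)

Section Z3Z4.
Variables (R : realType) (G : groupType) (i : 'Z_3 -> G) (j : 'Z_4 -> G).
Variables (u : 'Z_3) (v : 'Z_4).
Hypothesis free : is_free_product i j.
Hypothesis ug : u = z31 \/ u = z32.
Hypothesis vg : v = z41 \/ v = z43.
Local Notation S := (gens i j u v).
Local Notation good := (fun x => x = z31 \/ x = z32).

Let u1 : u != 1%g. Proof. by case: ug => ->. Qed.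
Let v1 : v != 1%g. Proof. by case: vg => ->. Qed.
Let gu' : good (u^-1)%g. Proof. exact: Z3_inv_gen. Qed.
Let stepA x : good x -> forall y, (ell3 (y * x)%g <= (ell3 y).+1)%N.
Proof. by move=> h y; exact: Z3_step. Qed.
Let lA : factor_length i S ell3.
Proof.
have [g1 g2] := Z3_gensl v free ug.
by apply: Z3_length g1 g2; case: free.
Qed.
Let sumB (w : R) : \sum_b step_weight v w b = 2 * w.
Proof. by rewrite Z4_step_weight // sum_Z4 /stepZ4 /tab /=; ring. Qed.
Let sumA (w : R) : \sum_a step_weight u w a = 2 * w.
Proof. by rewrite Z3_step_weight // sum_Z3 /stepZ3 /tab /=; ring. Qed.

Variable r : R.
Hypothesis r01 : 0 < r < 1.
Hypothesis rE : 2 * r ^+ 3 + 4 * r ^+ 2 = 1.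

Lemma Z3Z4_volume : volume R S = - ln r.
Proof.
apply: (gens_volume free vg ug gu' stepA lA r01).
rewrite sum1_Z3 /ell3 /tab /= expr1 -[RHS]rE; ring.
Qed.

Lemma Z3Z4_rates (w w' t : R) : 0 < w < 2^-1 -> 2 * w + 2 * w' = 1 -> 0 < t < 1 ->
  (2 + 2 * w) * t ^+ 2 + (2 + 4 * w) * t + (4 * w - 4) = 0 ->
  exists2 k, 0 < k & entropy (step_law i j u v w w') = k * ((2 + t) * ln 2 + eta t) /\
    drift S (step_law i j u v w w') = k * (4 + 3 * t).
Proof.
move=> w01 ww t01 te.
have [w0 w1] := andP w01; have w0' : 0 < w' by lra.
have s01 := case2_s01 t01 te w01.
have [e1 e2 e3] := case2_eqs t01 ww te w01.
have [k0 eE eD] := case2_rates t01 ww te w01.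
set s := (2 * (2 - t ^+ 2) / _) in s01 e1 e2 e3 eE eD.
set y := (t / _) in e1 eE; set M := 2 * w' * y.
have wA : factor_weights (step_weight u w).
  by rewrite Z3_step_weight //; exact/Z3_weights/ltW.
have wAB : \sum_a step_weight u w a + 2 * w' = 1 by rewrite sumA.
have gA : factor_green (step_weight u w) (hitZ3 s) M.
  by rewrite Z3_step_weight //; exact: Z3_green.
have xE : \sum_a step_weight u w a * hitZ3 s a = 2 * w * (s / (2 - s)).
  by rewrite Z3_step_weight // Z3_green_sum.
have FS : (\sum_(a | a != 1%g) hitZ3 s a) * (2 * t + t ^+ 2) = 2 - t ^+ 2.
  by rewrite sum1_Z3 /hitZ3 /tab.
have [||k1 [d1 r1]] := Z3_drift s01 e1 (phi := fun a => - ln (hitZ3 s a)) => //.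
  by rewrite /hitZ3 /tab /= ln1 oppr0.
have [//|//|k2 [d2 r2]] := Z3_drift s01 e1 (phi := fun a => (ell3 a)%:R).
rewrite -(Z3_step_weight _ ug) in d1 r1 d2 r2.
exists (w' * (1 - t) / (1 + t)) => //; split.
  by rewrite (gens_entropy free vg w0' wA wAB t01 gA xE e2 FS d1) r1 -eE.
rewrite (gens_drift free vg ug gu' stepA lA w0' wA wAB t01 gA xE e2 FS d2) r2 -eD.
by rewrite /ell3 /tab /= mulr1.
Qed.

Let r0 : 0 < r. Proof. by case/andP: r01. Qed.

Let ln2r : ln (2 + r) = - 2 * ln r - ln 2.
Proof.
have e : ln (2 + r) + 2 * ln r + ln 2 = 0.
  have -> : 2 * ln r = ln (r ^+ 2) by rewrite lnXn // mulr_natl.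
  rewrite -lnM ?posrE ?exprn_gt0 ?addr_gt0 //.
  rewrite -lnM ?posrE ?mulr_gt0 ?exprn_gt0 ?addr_gt0 //.
  rewrite (_ : (2 + r) * r ^+ 2 * 2 = 1) ?ln1 // -[RHS]rE; ring.
lra.
Qed.

Let v0 : 0 < - ln r. Proof. by rewrite oppr_gt0; exact: ln_lt0. Qed.

Lemma Z3Z4_eta_lt (t : R) : 0 < t -> t != r -> (2 + t) * ln 2 + eta t < (4 + 3 * t) * - ln r.
Proof. by move=> t0 tr; have := eta_lt t0 r0 tr; rewrite ln2r; lra. Qed.

Lemma Z3Z4_eta_eq : (2 + r) * ln 2 + eta r = (4 + 3 * r) * - ln r.
Proof. by rewrite /eta ln2r; ring. Qed.

Lemma Z3Z4_law mu : symmetric_laws R S mu -> exists w w' t,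
  [/\ mu = step_law i j u v w w', 0 < w < 2^-1, 2 * w + 2 * w' = 1, 0 < t < 1 &
  (2 + 2 * w) * t ^+ 2 + (2 + 4 * w) * t + (4 * w - 4) = 0].
Proof.
case/(symmetric_law_step free u1 v1) => w [w' [w0 w0' -> ]].
rewrite sumA sumB => ww; have w01 : 0 < w < 2^-1 by apply/andP; split; lra.
have [||t t01 te] := @quadratic_root R (2 + 2 * w) (2 + 4 * w) (4 * w - 4); try lra.
by exists w, w', t.
Qed.

(** The weight that [case2_weight] assigns to [t = r], the only parameter at which the tangent bound
    is an equality. *)
Definition Z3Z4_p : R := (2 - r - r ^+ 2) / (2 + 2 * r + r ^+ 2).
Local Notation p := Z3Z4_p.

Let C0 : 0 < 2 + 2 * r + r ^+ 2.
Proof. by rewrite !addr_gt0 ?mulr_gt0 ?exprn_gt0. Qed.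

Lemma Z3Z4_p01 : 0 < p < 2^-1.
Proof.
have rr := sqr_lt_self r01; have r_gt0 := r0; have r1 : r < 1 by case/andP: r01.
rewrite /p divr_gt0 //=; last by lra.
rewrite ltr_pdivrMr //.
(* [p < 1/2] amounts to [4 r + 3 r^2 > 2], for which [r > 2/5] is enough. *)
have r12 : 2 / 5 < r.
  rewrite ltNge; apply/negP => r25.
  have r2 : r ^+ 2 <= (2 / 5) ^+ 2 by rewrite lerXn2r ?nnegrE //; lra.
  have r3 : r ^+ 3 <= (2 / 5) ^+ 3 by rewrite lerXn2r ?nnegrE //; lra.
  have := rE; lra.
have r2 : (2 / 5) ^+ 2 < r ^+ 2 by rewrite ltrXn2r ?nnegrE //; lra.
lra.
Qed.

Lemma Z3Z4_ratio_le mu : symmetric_laws R S mu ->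
  entropy mu / (drift S mu * volume R S) <= 1.
Proof.
case/Z3Z4_law=> w [w' [t [-> w01 ww t01 te]]].
have [k k0 [-> ->]] := Z3Z4_rates w01 ww t01 te.
have t0 : 0 < t by case/andP: t01.
rewrite Z3Z4_volume ler_pdivrMr ?mul1r; last by rewrite !mulr_gt0 //; lra.
rewrite -mulrA ler_pM2l //; have [->|tr] := eqVneq t r; first by rewrite Z3Z4_eta_eq.
exact/ltW/Z3Z4_eta_lt.
Qed.

Local Notation mu0 := (step_law i j u v p (2^-1 - p)).

Let pp : 2 * p + 2 * (2^-1 - p) = 1. Proof. by lra. Qed.

Lemma Z3Z4_optimal : symmetric_laws R S mu0 /\ entropy mu0 = drift S mu0 * volume R S.
Proof.
have p01 := Z3Z4_p01; have [p0 p1] := andP p01.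
have p0' : 0 < 2^-1 - p by lra.
split.
  apply: step_law_symmetric => //; last by rewrite sumA sumB.
  exact: (gens_words free vg ug gu' stepA lA).
have te : (2 + 2 * p) * r ^+ 2 + (2 + 4 * p) * r + (4 * p - 4) = 0.
  by rewrite /p; field; rewrite lt0r_neq0.
have [k k0 [-> ->]] := Z3Z4_rates p01 pp r01 te.
by rewrite Z3Z4_volume Z3Z4_eta_eq mulrA.
Qed.

Lemma Z3Z4_unique mu : symmetric_laws R S mu ->
  entropy mu = drift S mu * volume R S -> mu = mu0.
Proof.
case/Z3Z4_law=> w [w' [t [-> w01 ww t01 te]]].
have [k k0 [-> ->]] := Z3Z4_rates w01 ww t01 te.
have t0 : 0 < t by case/andP: t01.
rewrite Z3Z4_volume -mulrA => /(mulfI (lt0r_neq0 k0)) e.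
have [tr|tr] := eqVneq t r; last by have := Z3Z4_eta_lt t0 tr; rewrite e ltxx.
have -> : w = p by rewrite (case2_weight t01 te) tr.
by congr step_law; have := ww; rewrite (case2_weight t01 te) tr -/p; lra.
Qed.

Lemma Z3Z4_extremal : extremal R S.
Proof.
have [muS e] := Z3Z4_optimal; apply: sup_eq_max; last first.
  by move=> _ [mu muS' <-]; exact: Z3Z4_ratio_le.
exists mu0 => //; rewrite -e divff //.
have p01 := Z3Z4_p01.
have te : (2 + 2 * p) * r ^+ 2 + (2 + 4 * p) * r + (4 * p - 4) = 0.
  by rewrite /p; field; rewrite lt0r_neq0.
have [k k0 [-> _]] := Z3Z4_rates p01 pp r01 te.
rewrite Z3Z4_eta_eq !mulf_neq0 ?lt0r_neq0 //.
by have := r0; lra.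
Qed.

Lemma Z3Z4_law_form (w w' : R) : step_law i j u v w w' = fun g =>
  w * (mass1 R (i u) g + mass1 R (i u)^-1%g g) +
  w' * (mass1 R (j v) g + mass1 R (j v)^-1%g g).
Proof.
apply/funext => g; rewrite /step_law Z3_step_weight // Z4_step_weight //.
rewrite sum_Z3 sum_Z4 /stepZ3 /stepZ4 /tab /= -(free_iV free) -(free_jV free) /mass1.
by case: ug => ->; case: vg => ->; rewrite mulZ3 mulZ4; ring.
Qed.

End Z3Z4.

(** * Z/4 * Z/4: the maximum of the ratio *)

Section Z4Z4.
Variables (R : realType) (G : groupType) (i j : 'Z_4 -> G) (u v : 'Z_4).
Hypothesis free : is_free_product i j.
Hypothesis ug : u = z41 \/ u = z43.
Hypothesis vg : v = z41 \/ v = z43.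
Local Notation S := (gens i j u v).
Local Notation good := (fun x => x = z41 \/ x = z43).

Let u1 : u != 1%g. Proof. by case: ug => ->. Qed.
Let v1 : v != 1%g. Proof. by case: vg => ->. Qed.
Let gu' : good (u^-1)%g. Proof. exact: Z4_inv_gen. Qed.
Let stepA x : good x -> forall y, (ell4 (y * x)%g <= (ell4 y).+1)%N.
Proof. by move=> h y; exact: Z4_step. Qed.
Let lA : factor_length i S ell4.
Proof.
have [g1 g2] := Z4_gensl v free ug.
by apply: Z4_length g1 g2; case: free.
Qed.
Let sumA (w : R) (x : 'Z_4) : good x -> \sum_b step_weight x w b = 2 * w.
Proof. by move=> h; rewrite Z4_step_weight // sum_Z4 /stepZ4 /tab /=; ring. Qed.

Lemma Z4Z4_volume : volume R S = ln (1 + Num.sqrt 2).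
Proof.
have s2 : (1 : R) < Num.sqrt 2 by rewrite -[X in X < _]sqrtr1 ltr_sqrt //; lra.
have s22 : Num.sqrt 2 ^+ 2 = 2 :> R by rewrite sqr_sqrtr.
have s2' : Num.sqrt 2 < 2 :> R.
  by rewrite -(ltr_pXn2r (n := 2)) ?nnegrE ?sqrtr_ge0 // s22; lra.
have r01 : 0 < (Num.sqrt 2 - 1 : R) < 1 by apply/andP; split; lra.
rewrite (gens_volume free vg ug gu' stepA lA r01).
  have e : (1 + Num.sqrt 2 : R) = (Num.sqrt 2 - 1)^-1.
    have n1 : Num.sqrt 2 - 1 != 0 :> R by rewrite lt0r_neq0 // subr_gt0.
    apply: (mulIf n1); rewrite mulVf //.
    have -> : (1 + Num.sqrt 2) * (Num.sqrt 2 - 1) = Num.sqrt 2 ^+ 2 - 1 :> R by ring.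
    by rewrite s22; ring.
  by rewrite e lnV // posrE subr_gt0.
rewrite sum1_Z4 /ell4 /tab /= expr1.
have -> : (Num.sqrt 2 - 1 + (Num.sqrt 2 - 1) ^+ 2 + (Num.sqrt 2 - 1)) *
    (2 * (Num.sqrt 2 - 1) + (Num.sqrt 2 - 1) ^+ 2) = (Num.sqrt 2 ^+ 2 - 1) ^+ 2 :> R by ring.
by rewrite s22; ring.
Qed.

Lemma Z4Z4_rates (w w' s t : R) : 0 < w -> 0 < w' -> 2 * w + 2 * w' = 1 ->
  0 < s < 1 -> 0 < t < 1 ->
  (2 * s + s ^+ 2) * (1 + t) = (2 - t ^+ 2) * (1 + s) ->
  w * (1 - s) * (2 + s) * (1 + t) = w' * (1 - t) * (2 + t) * (1 + s) ->
  exists kA k, [/\ 0 < k, kA * (2 + s) = k * (2 + t),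
    entropy (step_law i j u v w w') = kA * eta s + k * eta t &
    drift S (step_law i j u v w w') = kA * (2 + 2 * s) + k * (2 + 2 * t)].
Proof.
move=> w0 w0' ww s01 t01 curve eqn.
have [e1 e2 e3] := case3_eqs s01 t01 ww curve eqn.
have [k0 kk eE] := case3_rates s01 t01 w0' curve eqn.
set y := (t / _) in e1 eE; set M := 2 * w' * y.
have wA : factor_weights (step_weight u w).
  by rewrite Z4_step_weight //; exact/Z4_weights/ltW.
have wAB : \sum_a step_weight u w a + 2 * w' = 1 by rewrite sumA.
have gA : factor_green (step_weight u w) (hitZ4 s) M.
  by rewrite Z4_step_weight //; exact: Z4_green.
have xE : \sum_a step_weight u w a * hitZ4 s a = 2 * w * (s / (2 - s ^+ 2)).
  by rewrite Z4_step_weight // Z4_green_sum.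
have FS : (\sum_(a | a != 1%g) hitZ4 s a) * (2 * t + t ^+ 2) = 2 - t ^+ 2.
  by rewrite sum1_Z4 /hitZ4 /tab.
have [||k1 [d1 r1]] := Z4_drift s01 e1 (phi := fun a => - ln (hitZ4 s a)) => //.
  by rewrite /hitZ4 /tab /= ln1 oppr0.
have [//|//|k2 [d2 r2]] := Z4_drift s01 e1 (phi := fun a => (ell4 a)%:R).
rewrite -(Z4_step_weight _ ug) in d1 r1 d2 r2.
exists (w * (1 - s) / (1 + s)), (w' * (1 - t) / (1 + t)); split=> //.
  by rewrite (gens_entropy free vg w0' wA wAB t01 gA xE e2 FS d1) r1 -eE.
rewrite (gens_drift free vg ug gu' stepA lA w0' wA wAB t01 gA xE e2 FS d2) r2.
by congr (_ * _ + _); rewrite /ell4 /tab /=; ring.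
Qed.

Let phi : R := 2^-1 + Num.sqrt 5 / 2.
Let c : R := (2 + phi) / 2 * ln phi.
Let phi_gt1 : 1 < phi.
Proof. by have /andP[] := sqrt5_bounds R; rewrite /phi; lra. Qed.
Let phi_sqr : phi ^+ 2 = phi + 1.
Proof.
have s5 : Num.sqrt 5 ^+ 2 = 5 :> R by rewrite sqr_sqrtr.
have -> : phi ^+ 2 = 4^-1 + Num.sqrt 5 / 2 + Num.sqrt 5 ^+ 2 / 4 by rewrite /phi; field.
by rewrite s5 /phi; field.
Qed.
Let v0 : 0 < ln (1 + Num.sqrt 2) :> R.
Proof. by apply: ln_gt0; rewrite ltrDl sqrtr_gt0. Qed.

(** The inequality [D <= 0] is summed over [s] and [t] with weights [kA] and [k]. As
    [kA (2 + s) = k (2 + t)], the multiplier terms combine into a multiple of [psi0], the constraint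
    [curve] in separated form, and vanish. *)
Lemma Z4Z4_bound (w w' s t : R) : 0 < w -> 0 < w' -> 2 * w + 2 * w' = 1 ->
  0 < s < 1 -> 0 < t < 1 ->
  (2 * s + s ^+ 2) * (1 + t) = (2 - t ^+ 2) * (1 + s) ->
  w * (1 - s) * (2 + s) * (1 + t) = w' * (1 - t) * (2 + t) * (1 + s) ->
  entropy (step_law i j u v w w') / (drift S (step_law i j u v w w') * volume R S)
    <= c / ln (1 + Num.sqrt 2).
Proof.
move=> w0 w0' ww s01 t01 curve eqn.
have [kA [k [k0 kk eE eD]]] := Z4Z4_rates w0 w0' ww s01 t01 curve eqn.
have s0 : 0 < s by case/andP: s01.
have t0 : 0 < t by case/andP: t01.
have kA0 : 0 < kA.
  have p2 : 0 < 2 + s by lra.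
  by rewrite -(pmulr_lgt0 _ p2) kk mulr_gt0 //; lra.
rewrite eE eD Z4Z4_volume.
have dp : 0 < kA * (2 + 2 * s) + k * (2 + 2 * t).
  by rewrite addr_gt0 // mulr_gt0 //; lra.
rewrite invfM mulrA ler_pM2r ?invr_gt0 // ler_pdivrMr //.
have hs := ler_wpM2l (ltW kA0) (golden_D_le0 phi_gt1 phi_sqr s01).
have ht := ler_wpM2l (ltW k0) (golden_D_le0 phi_gt1 phi_sqr t01).
rewrite -/c !mulr0 in hs ht.
set lam := (phi - 1) / (2 + phi) * ln phi in hs ht.
have psi (x : R) : 0 < x -> (1 + x)^-1 + 2 - (1 + x) ^+ 2 = (2 + x) * ((1 + x)^-1 - x).
  by move=> x0; field; rewrite lt0r_neq0 //; lra.
rewrite !psi // in hs ht.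
have psi0 : ((1 + s)^-1 - s) + ((1 + t)^-1 - t) = 0.
  have n1 : 1 + s != 0 by rewrite lt0r_neq0 //; lra.
  have n2 : 1 + t != 0 by rewrite lt0r_neq0 //; lra.
  have -> : ((1 + s)^-1 - s) + ((1 + t)^-1 - t) =
     ((2 - t ^+ 2) * (1 + s) - (2 * s + s ^+ 2) * (1 + t)) / ((1 + s) * (1 + t)).
    by field; rewrite n1 n2.
  by rewrite curve subrr mul0r.
have e0 : kA * (lam * ((2 + s) * ((1 + s)^-1 - s))) + k * (lam * ((2 + t) * ((1 + t)^-1 - t))) = 0.
  have -> : kA * (lam * ((2 + s) * ((1 + s)^-1 - s))) = lam * (kA * (2 + s)) * ((1 + s)^-1 - s) by ring.
  rewrite kk.
  have -> : (1 + s)^-1 - s = - ((1 + t)^-1 - t) by apply/eqP; rewrite -addr_eq0 psi0.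
  by ring.
rewrite mulrBr mulrBr in hs; rewrite mulrBr mulrBr in ht; lra.
Qed.

(** The uniform law on [S]: by symmetry both parameters are [x = 1 / phi], where [x^2 = 1 - x]
    satisfies the constraint and [D] vanishes. *)
Lemma Z4Z4_attained : exists2 mu, symmetric_laws R S mu &
  entropy mu / (drift S mu * volume R S) = c / ln (1 + Num.sqrt 2).
Proof.
pose x := phi - 1; pose w : R := 4^-1.
have w0 : 0 < w by rewrite invr_gt0.
have ww : 2 * w + 2 * w = 1 by rewrite /w; lra.
have p2 : phi < 2 by have /andP[_] := sqrt5_bounds R; rewrite /phi; lra.
have x01 : 0 < x < 1 by apply/andP; rewrite /x; split; have := phi_gt1; lra.
have xx : x ^+ 2 = 1 - x.
  have -> : x ^+ 2 = phi ^+ 2 - 2 * phi + 1 by rewrite /x; ring.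
  by rewrite phi_sqr /x; ring.
have curve : (2 * x + x ^+ 2) * (1 + x) = (2 - x ^+ 2) * (1 + x) by rewrite xx; congr (_ * _); ring.
have [kA [k [k0 kk eE eD]]] := Z4Z4_rates w0 w0 ww x01 x01 curve erefl.
have x0 : 0 < x by case/andP: x01.
have kAk : kA = k by apply: (mulIf (x := 2 + x)) => //; rewrite lt0r_neq0 //; lra.
exists (step_law i j u v w w).
  apply: step_law_symmetric => //; last by rewrite !sumA.
  exact: (gens_words free vg ug gu' stepA lA).
rewrite eE eD kAk Z4Z4_volume.
have D0 := golden_D0 phi_gt1 phi_sqr; rewrite -/x -/c in D0.
have psi0 : (1 + x)^-1 + 2 - (1 + x) ^+ 2 = 0.
  have n1 : 1 + x != 0 by rewrite lt0r_neq0 //; lra.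
  apply: (mulIf n1); rewrite mul0r.
  have -> : ((1 + x)^-1 + 2 - (1 + x) ^+ 2) * (1 + x) = 2 - x - 3 * x ^+ 2 - x * x ^+ 2 by field.
  by rewrite xx; have := xx; rewrite expr2; lra.
rewrite psi0 mulr0 subr0 in D0.
have -> : eta x = c * (2 + 2 * x) by move/eqP: D0; rewrite subr_eq0 => /eqP.
have n2 : 2 + 2 * x != 0 by rewrite lt0r_neq0 //; lra.
field; have l0 := v0; rewrite !lt0r_neq0 //.
by rewrite addr_gt0 // mulr_gt0 //; lra.
Qed.

Lemma Z4Z4_Q : Qratio R S = (5 + Num.sqrt 5) / 4 *
  (ln (2^-1 + Num.sqrt 5 / 2) / ln (1 + Num.sqrt 2)).
Proof.
have -> : (5 + Num.sqrt 5) / 4 * (ln (2^-1 + Num.sqrt 5 / 2) / ln (1 + Num.sqrt 2)) =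
    c / ln (1 + Num.sqrt 2) :> R.
  by rewrite /c -/phi mulrA; congr (_ * _ / _); rewrite /phi; field.
apply: sup_eq_max; first by have [mu muS e] := Z4Z4_attained; exists mu.
move=> _ [mu muS <-]; move: muS.
case/(symmetric_law_step free u1 v1) => w [w' [w0 w0' -> ]].
rewrite !sumA // => ww.
have [s [t [s01 t01 curve eqn]]] := case3_exists w0 w0'.
exact: Z4Z4_bound ww s01 t01 curve eqn.
Qed.

End Z4Z4.

Lemma poly_root_between (R : realType) (p : {poly R}) (x y : R) : x < y ->
  p.[x] < 0 -> 0 < p.[y] -> exists2 z, x < z < y & p.[z] = 0.
Proof.
move=> xy px py; have [|z /andP[xz zy] /rootP pz] := @poly_ivt _ p x y (ltW xy).
  by rewrite !ltW.
exists z => //; rewrite !lt_neqAle xz zy !andbT; apply/andP; split; apply/eqP => e.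
  by rewrite e pz ltxx in px.
by rewrite -e pz ltxx in py.
Qed.

(** * The cubic equation of [p] *)

Section MiddleRoot.
Variable R : realType.
Let q : {poly R} := 5 *: 'X^3 - 13 *: 'X^2 + 7 *: 'X - 1.

Let qE x : q.[x] = 5 * x ^+ 3 - 13 * x ^+ 2 + 7 * x - 1.
Proof. by rewrite /q !hornerE. Qed.

(** [p] is a decreasing function of [r]; the bracket is narrow enough to fix six decimals of [p]. *)
Lemma cubic_parameter : exists r : R,
  [/\ 0 < r < 1, 2 * r ^+ 3 + 4 * r ^+ 2 = 1 &
   4516 / 10 ^+ 4 + 59 / 10 ^+ 7 < r < 4516 / 10 ^+ 4 + 6 / 10 ^+ 6].
Proof.
pose p : {poly R} := 2 *: 'X^3 + 4 *: 'X^2 - 1.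
have pE x : p.[x] = 2 * x ^+ 3 + 4 * x ^+ 2 - 1 by rewrite /p !hornerE.
have [|||r /andP[r1 r2] pr] := @poly_root_between R p
  (4516 / 10 ^+ 4 + 59 / 10 ^+ 7) (4516 / 10 ^+ 4 + 6 / 10 ^+ 6).
- lra.
- by rewrite pE; lra.
- by rewrite pE; lra.
exists r; rewrite r1 r2; split=> //; last by move: pr; rewrite pE; lra.
by apply/andP; split; lra.
Qed.

(** Sign changes on [[0, 1/4]] and on [[1, 2]] give one root on each side of [p], which makes [p]
    the middle one of three. *)
Lemma outer_roots : exists r1 r3 : R,
  [/\ root q r1, root q r3, r1 < 4^-1 & 1 < r3].
Proof.
have [|||r1 /andP[_ h1] q1] := @poly_root_between R q 0 4^-1.
- lra.
- by rewrite qE; lra.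
- by rewrite qE; lra.
have [|||r3 /andP[h3 _] q3] := @poly_root_between R q 1 2.
- lra.
- by rewrite qE; lra.
- by rewrite qE; lra.
by exists r1, r3; split=> //; apply/rootP.
Qed.

Lemma Z3Z4_p_root (r : R) : 0 < r -> 2 * r ^+ 3 + 4 * r ^+ 2 = 1 -> root q (Z3Z4_p r).
Proof.
move=> r0 rE; have C0 : 2 + 2 * r + r ^+ 2 != 0.
  by rewrite lt0r_neq0 // !addr_gt0 ?mulr_gt0 ?exprn_gt0.
apply/rootP; rewrite qE.
(* Over the common denominator the numerator is divisible by the equation of [r]; the first factor
   is the quotient of this polynomial division. *)
have -> : 5 * Z3Z4_p r ^+ 3 - 13 * Z3Z4_p r ^+ 2 + 7 * Z3Z4_p r - 1 =
    (16 - 28 * r ^+ 2 - 13 * r ^+ 3) * (2 * r ^+ 3 + 4 * r ^+ 2 - 1) /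
    (2 + 2 * r + r ^+ 2) ^+ 3.
  by rewrite /Z3Z4_p; field.
by rewrite rE subrr mulr0 mul0r.
Qed.

Lemma Z3Z4_p_bounds (r : R) :
  4516 / 10 ^+ 4 + 59 / 10 ^+ 7 < r < 4516 / 10 ^+ 4 + 6 / 10 ^+ 6 ->
  432 / 10 ^+ 3 + 692 / 10 ^+ 6 <= Z3Z4_p r < 432 / 10 ^+ 3 + 693 / 10 ^+ 6.
Proof.
case/andP=> r1 r2.
have sq (x y : R) : 0 < x -> x < y -> x ^+ 2 < y ^+ 2.
  by move=> x0 xy; rewrite ltrXn2r ?nnegrE ?ltW // (lt_trans x0).
have a0 : 0 < (4516 / 10 ^+ 4 + 59 / 10 ^+ 7 : R) by lra.
have r0 : 0 < r by exact: lt_trans r1.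
have lo := sq _ _ a0 r1; have up := sq _ _ r0 r2.
have C0 : 0 < 2 + 2 * r + r ^+ 2 by lra.
rewrite /Z3Z4_p (ler_pdivlMr _ _ C0) (ltr_pdivrMr _ _ C0); apply/andP; split; lra.
Qed.

Lemma middle_root : exists r r1 r3 : R, [/\ 0 < r < 1, 2 * r ^+ 3 + 4 * r ^+ 2 = 1,
  [/\ root q r1, root q (Z3Z4_p r) & root q r3], r1 < Z3Z4_p r < r3 &
  432 / 10 ^+ 3 + 692 / 10 ^+ 6 <= Z3Z4_p r < 432 / 10 ^+ 3 + 693 / 10 ^+ 6].
Proof.
have [r [r01 rE rb]] := cubic_parameter; have [r1 [r3 [q1 q3 l1 l3]]] := outer_roots.
have pb := Z3Z4_p_bounds rb; exists r, r1, r3; split=> //.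
  by split=> //; apply: Z3Z4_p_root rE; case/andP: r01.
by case/andP: pb => p1 p2; apply/andP; split; lra.
Qed.

End MiddleRoot.

Lemma golden_parameter (R : realType) : exists2 r : R, 0 < r < 1 & r ^+ 2 + r - 1 = 0.
Proof.
have [||r r01] := @quadratic_root R 1 1 (-1).
- lra.
- lra.
by rewrite !mul1r => rE; exists r.
Qed.

Lemma not_extremal_of_lt (R : realType) (G : groupType) (S : set G) :
  Qratio R S < 987 / 10 ^+ 3 + 687 / 10 ^+ 6 -> ~ extremal R S.
Proof. by rewrite /extremal => h e; rewrite e in h; lra. Qed.

Theorem mainTheorem9 (R : realType) :
  [/\ forall (G : groupType) (i : 'Z_2 -> G) (j : 'Z_4 -> G)
        (u : 'Z_2) (v : 'Z_4),
        is_free_product i j ->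
        generator [set: 'Z_2]%SET u -> generator [set: 'Z_4]%SET v ->
        let a := i u in
        let b := j v in
        let S : set G := [set a; b; b^-1%g] in
        extremal R S /\
        forall mu : G -> R, symmetric_laws R S mu ->
          entropy mu / (drift S mu * volume R S) < 1,
      forall (G : groupType) (i : 'Z_3 -> G) (j : 'Z_4 -> G)
        (u : 'Z_3) (v : 'Z_4),
        is_free_product i j ->
        generator [set: 'Z_3]%SET u -> generator [set: 'Z_4]%SET v ->
        let a := i u in
        let b := j v in
        let S : set G := [set a; a^-1%g; b; b^-1%g] in
        extremal R S /\
        exists p r1 r3 : R,
          [/\ let q : {poly R} :=
                5 *: 'X^3 - 13 *: 'X^2 + 7 *: 'X - 1 in
              [/\ root q r1, root q p & root q r3],
              r1 < p < r3,
              432 / 10 ^+ 3 + 692 / 10 ^+ 6 <= p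
                < 432 / 10 ^+ 3 + 693 / 10 ^+ 6 &
              forall mu : G -> R,
                (symmetric_laws R S mu /\
                 entropy mu = drift S mu * volume R S) <->
                mu = (fun g =>
                  p * (mass1 R a g + mass1 R a^-1%g g) +
                  (2^-1 - p) * (mass1 R b g + mass1 R b^-1%g g))] &
      forall (G : groupType) (i j : 'Z_4 -> G) (u v : 'Z_4),
        is_free_product i j ->
        generator [set: 'Z_4]%SET u -> generator [set: 'Z_4]%SET v ->
        let a := i u in
        let b := j v in
        let S : set G := [set a; a^-1%g; b; b^-1%g] in
        [/\ ~ extremal R S,
            Qratio R S =
              (5 + Num.sqrt 5) / 4 *
              (ln (2^-1 + Num.sqrt 5 / 2) / ln (1 + Num.sqrt 2)) &
            987 / 10 ^+ 3 + 686 / 10 ^+ 6 <= Qratio R S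
              < 987 / 10 ^+ 3 + 687 / 10 ^+ 6]].
Proof.
split.
- move=> G i j u v free /Z2_generator -> /Z4_generator vg a b S.
  (* The generator of Z/2 is its own inverse, so [gens] lists it twice. *)
  have -> : S = gens i j z21 v.
    rewrite /S /gens /a /b -(free_iV free) mulZ2.
    by apply/seteqP; split=> x /=; tauto.
  have [r r01 rE] := golden_parameter R.
  split; first exact: (Z2Z4_extremal free vg r01 rE).
  by move=> mu; exact: (Z2Z4_ratio free vg r01 rE).
- move=> G i j u v free /Z3_generator ug /Z4_generator vg a b S.
  have [r [r1 [r3 [r01 rE roots ord bounds]]]] := middle_root R.
  split; first exact: (Z3Z4_extremal free ug vg r01 rE).
  exists (Z3Z4_p r), r1, r3; split=> //.
  rewrite -(Z3Z4_law_form free ug vg) => mu; split.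
    by case; exact: (Z3Z4_unique free ug vg r01 rE).
  by move=> ->; exact: (Z3Z4_optimal free ug vg r01 rE).
- move=> G i j u v free /Z4_generator ug /Z4_generator vg a b S.
  have Q : Qratio R S = _ := Z4Z4_Q R free ug vg.
  have := log_ratio_bounds R; rewrite -Q => Qb; split=> //.
  by apply: not_extremal_of_lt; case/andP: Qb.
Qed.
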